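(* Let $d\ge1$ and let $(Y_n)_{n\in\mathbb{N}}$ be a sequence of i.i.d. $\mathbb{R}^d$-valued zero-mean random variables with unit (identity) covariance matrix. Let $\phi$ be the characteristic function of $Y_0$. Assume that there are $\alpha>0$ and a constant $C_\sharp$ with $$|\phi(u)|\le C_\sharp(1+|u|)^{-\alpha},\quad u\in\mathbb{R}^d,$$ and that $E[|Y_0|^k]<\infty$ for all $k\in\mathbb{N}$. Let $S_n=\frac{1}{\sqrt n}\sum_{j=1}^nY_j$, and let $\Phi$ be a random variable with $d$-dimensional standard Gaussian law. Then for each $\epsilon>0$ there are constants $C_\epsilon$ and $C'_\epsilon$ such that, for all $n\ge2$, $$d_{TV}(S_n,\Phi)\le C_\epsilon n^{-\frac12+\epsilon}$$ and also $$\sup_{x\in\mathbb{R}^d}|f_{S_n}(x)-f_\Phi(x)|\le C'_\epsilon n^{-\frac12+\epsilon},$$ where $f_{S_n}$ denotes the density function of $S_n$ and $f_\Phi$ is the standard $d$-dimensional Gaussian density.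
   Context: $|\cdot|$ is the Euclidean norm; the characteristic function is $\phi(u)=E[e^{i\langle u,Y_0\rangle}]$. $d_{TV}(X_1,X_2)=\sup_{|f|\le1}|E[f(X_1)]-E[f(X_2)]|$, the supremum being over measurable $f:\mathbb{R}^d\to\mathbb{R}$ with $|f|\le1$ (total variation distance of the laws). Densities are with respect to $d$-dimensional Lebesgue measure.
   Formalization: The density bound is stated for those n≥2 where S_n has an essentially bounded density (always if αn>d), as ess sup, and as sup for the continuous version; as written it fails: d=1, Y_0 with density c|x|^{-0.9} on [-L,L] gives unbounded f_{S_2}. *)

(* Defs.v *)
From HB Require Import structures.
From mathcomp Require Import all_boot all_order all_algebra finmap complex.
From mathcomp Require Import all_classical all_reals all_analysis ess_sup_inf.

Set Implicit Arguments.
Unset Strict Implicit.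
Unset Printing Implicit Defensive.

Import Order.TTheory GRing.Theory Num.Theory.
Import numFieldNormedType.Exports.

Local Open Scope classical_set_scope.
Local Open Scope ring_scope.

(* R^d is 'rV[R]_d, with the sigma-algebra generated by the coordinates, which
   is the Borel one (the library equips n.-tuple T in the same way). *)
Definition measure_rV_display : measure_display -> measure_display.
Proof. exact. Qed.

Section measurable_rV.
Context {disp} {T : measurableType disp}.
Variable n : nat.

Let coord : 'I_n -> 'rV[T]_n -> T := fun i v => v ord0 i.

Let rV_set0 : g_sigma_preimage coord set0.
Proof. exact: sigma_algebra0. Qed.

Let rV_setC A : g_sigma_preimage coord A -> g_sigma_preimage coord (~` A).
Proof. exact: sigma_algebraC. Qed.

Let rV_bigcup (F : _^nat) : (forall i, g_sigma_preimage coord (F i)) ->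
  g_sigma_preimage coord (\bigcup_i (F i)).
Proof. exact: sigma_algebra_bigcup. Qed.

HB.instance Definition _ := @isMeasurable.Build (measure_rV_display disp)
  ('rV[T]_n) (g_sigma_preimage coord) rV_set0 rV_setC rV_bigcup.

End measurable_rV.

Lemma measurable_coord_rV disp (T : measurableType disp) n (i : 'I_n) :
  measurable_fun [set: 'rV[T]_n] (fun v : 'rV[T]_n => v ord0 i).
Proof.
move=> _ Y mY; rewrite setTI; apply: sub_sigma_algebra => /=.
rewrite -bigcup_seq/=; exists i => /=; first by rewrite mem_index_enum.
by exists Y => //; rewrite setTI.
Qed.

Lemma measurable_fun_rVP d1 d2 (T1 : measurableType d1)
    (T2 : measurableType d2) n (f : T1 -> 'rV[T2]_n) :
  measurable_fun [set: T1] f <->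
  forall i, measurable_fun [set: T1] (fun t => f t ord0 i).
Proof.
split=> [mf i|mf].
  apply: (measurableT_comp (measurable_coord_rV i)); exact: mf.
apply: (@measurability _ _ _ _ _ _
  (\big[setU/set0]_(i < n) preimage_set_system setT
     (fun v : 'rV[T2]_n => v ord0 i) measurable)) => //.
move=> _ [B + <-]; rewrite -bigcup_seq => -[i _] [A mA <-].
rewrite !setTI -comp_preimage.
by have := mf i measurableT A mA; rewrite setTI.
Qed.

Section lebesgue_rV.
Context {R : realType}.

Definition cons_rV n (p : R * 'rV[R]_n) : 'rV[R]_n.+1 :=
  row_mx (p.1)%:M p.2.

Lemma cons_rV0 n (p : R * 'rV[R]_n) : cons_rV p ord0 ord0 = p.1.
Proof.
rewrite /cons_rV mxE; case: splitP => [j _|//].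
by rewrite (ord1 j) mxE eqxx mulr1n.
Qed.

Lemma cons_rVS n (p : R * 'rV[R]_n) i :
  cons_rV p ord0 (lift ord0 i) = p.2 ord0 i.
Proof.
rewrite /cons_rV mxE; case: splitP => [[[|//] ?] //|j [/val_inj ->//]].
Qed.

Lemma measurable_cons_rV n :
  measurable_fun [set: R * 'rV[R]_n] (@cons_rV n).
Proof.
apply/measurable_fun_rVP => i; case: (unliftP ord0 i) => [j|] ->.
  rewrite (_ : (fun t => _) = (fun p : R * 'rV[R]_n => p.2 ord0 j)); last first.
    by apply/funext => p; rewrite cons_rVS.
  exact: (measurableT_comp (measurable_coord_rV j) measurable_snd).
rewrite (_ : (fun t => _) = fst) //.
by apply/funext => p; rewrite cons_rV0.
Qed.

Definition uncons_rV n (v : 'rV[R]_n.+1) : R * 'rV[R]_n :=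
  (v ord0 ord0, \row_i v ord0 (lift ord0 i)).

Lemma cons_rVK n : cancel (@cons_rV n) (@uncons_rV n).
Proof.
move=> [x v]; rewrite /uncons_rV cons_rV0; congr pair.
by apply/rowP => i; rewrite mxE cons_rVS.
Qed.

Lemma uncons_rVK n : cancel (@uncons_rV n) (@cons_rV n).
Proof.
move=> v; apply/rowP => i; case: (unliftP ord0 i) => [j|] ->.
  by rewrite cons_rVS mxE.
by rewrite cons_rV0.
Qed.

Lemma measurable_uncons_rV n :
  measurable_fun [set: 'rV[R]_n.+1] (@uncons_rV n).
Proof.
apply/measurable_fun_pairP; split; first exact: measurable_coord_rV.
apply/measurable_fun_rVP => i /=.
rewrite (_ : (fun t => _) =
    (fun v : 'rV[R]_n.+1 => v ord0 (lift ord0 i))); last first.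
  by apply/funext => v; rewrite mxE.
exact: measurable_coord_rV.
Qed.

Section step.
Variables (n : nat) (mu : {sigma_finite_measure set 'rV[R]_n -> \bar R}).

Definition lebesgue_rV_step : set 'rV[R]_n.+1 -> \bar R :=
  pushforward (lebesgue_measure \x mu)%E (@cons_rV n).

Let step0 : lebesgue_rV_step set0 = 0%E.
Proof. by rewrite /lebesgue_rV_step /pushforward preimage_set0 measure0. Qed.

Let step_ge0 A : (0 <= lebesgue_rV_step A)%E.
Proof. rewrite /lebesgue_rV_step /pushforward; exact: measure_ge0. Qed.

Let step_sigma_additive : semi_sigma_additive lebesgue_rV_step.
Proof.
move=> F mF tF mUF; rewrite /lebesgue_rV_step /pushforward preimage_bigcup.
apply: measure_semi_sigma_additive.
- move=> k; rewrite -[X in measurable X]setTI.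
  exact: (measurable_cons_rV measurableT).
- apply/trivIsetP => /= i j _ _ ij; rewrite -preimage_setI.
  by move/trivIsetP : tF => /(_ _ _ _ _ ij) ->//; rewrite preimage_set0.
- rewrite -preimage_bigcup -[X in measurable X]setTI.
  exact: (measurable_cons_rV measurableT).
Qed.

HB.instance Definition _ := isMeasure.Build _ _ _ lebesgue_rV_step
  step0 step_ge0 step_sigma_additive.

Let step_sigma_finite : sigma_finite setT lebesgue_rV_step.
Proof.
have /sigma_finiteP[F [TF ndF Foo]] :=
  sigma_finiteT (@lebesgue_measure R : {sigma_finite_measure set _ -> \bar R}).
have /sigma_finiteP[G [TG ndG Goo]] := sigma_finiteT mu.
exists (fun k => @uncons_rV n @^-1` (F k `*` G k)).
  rewrite -preimage_bigcup (_ : \bigcup_k _ = setT) ?preimage_setT//.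
  apply/seteqP; split=> // -[x y] _.
  have [k _ Fkx] : (\bigcup_k F k) x by rewrite -TF.
  have [l _ Gly] : (\bigcup_k G k) y by rewrite -TG.
  exists (maxn k l) => //; split.
  - by move: x Fkx; exact/subsetPset/ndF/leq_maxl.
  - by move: y Gly; exact/subsetPset/ndG/leq_maxr.
move=> k; have [mF Fk] := Foo k; have [mG Gk] := Goo k; split.
  rewrite -[X in measurable X]setTI.
  by apply: (measurable_uncons_rV measurableT); exact: measurableX.
rewrite /lebesgue_rV_step /pushforward -comp_preimage.
rewrite (_ : @uncons_rV n \o _ = id).
  by rewrite preimage_id product_measure1E// lte_mul_pinfty// ge0_fin_numE.
by apply/funext => p /=; rewrite cons_rVK.
Qed.

HB.instance Definition _ := Measure_isSigmaFinite.Build _ _ _ lebesgue_rV_step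
  step_sigma_finite.

End step.

Fixpoint lebesgue_rV n : {sigma_finite_measure set 'rV[R]_n -> \bar R} :=
  match n with
  | 0 => @dirac _ ('rV[R]_0) 0 R
  | n'.+1 => lebesgue_rV_step (lebesgue_rV n')
  end.

Lemma lebesgue_rV_box n (A : 'I_n -> set R) :
  (forall i, measurable (A i)) ->
  lebesgue_rV n [set v | forall i, A i (v ord0 i)] =
  (\prod_(i < n) lebesgue_measure (A i))%E.
Proof.
elim: n A => [|n IHn] A mA.
  by rewrite big_ord0 /= diracE mem_set// => -[].
pose B := [set v : 'rV[R]_n | forall i, A (lift ord0 i) (v ord0 i)].
have mB : measurable B.
  rewrite (_ : B = \bigcap_(i in [set: 'I_n])
      ((fun v : 'rV[R]_n => v ord0 i) @^-1` A (lift ord0 i))).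
    apply: fin_bigcap_measurable => [|i _]; first exact: finite_finset.
    rewrite -[X in measurable X]setTI.
    by apply: (measurable_coord_rV i measurableT); exact: mA.
  by apply/seteqP; split => v h i; [move=> _; exact: h|exact: (h i I)].
rewrite big_ord_recl /= /lebesgue_rV_step /pushforward.
rewrite (_ : _ @^-1` _ = A ord0 `*` B).
  have mA0 := mA ord0; rewrite product_measure1E//.
  rewrite (_ : _ B = \prod_(i < n) lebesgue_measure (A (lift ord0 i)))%E//.
  by apply: (IHn (fun i => A (lift ord0 i))) => i; exact: mA.
apply/seteqP; split => -[x v] /=.
  move=> h; split; first by have := h ord0; rewrite cons_rV0.
  by move=> i; have := h (lift ord0 i); rewrite cons_rVS.
move=> [/= h0 h] i; case: (unliftP ord0 i) => [j|] ->.
  by rewrite cons_rVS; exact: h.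
by rewrite cons_rV0.
Qed.

End lebesgue_rV.

Arguments lebesgue_rV : clear implicits.

Section euclidean.
Context {R : realType} {d : nat}.
Implicit Types u v x : 'rV[R]_d.

Definition inner u v : R := \sum_i u ord0 i * v ord0 i.

(* The library's norm `|v| on row vectors is the max norm. *)
Definition enorm v : R := Num.sqrt (inner v v).

Definition std_gauss_pdf x : R :=
  (2 * pi) `^ (- (d%:R / 2)) * expR (- (enorm x ^+ 2 / 2)).

End euclidean.

Section random.
Context {R : realType}.

Definition expi (x : R) : R[i] := Complex (cos x) (sin x).

Definition cexpectation disp (T : measurableType disp) (P : probability T R)
    (Z : T -> R[i]) : R[i] :=
  Complex (fine 'E_P[fun t => complex.Re (Z t)])
          (fine 'E_P[fun t => complex.Im (Z t)]).

Definition char_fun disp (T : measurableType disp) (P : probability T R)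
    d (X : T -> 'rV[R]_d) (u : 'rV[R]_d) : R[i] :=
  cexpectation P (fun t => expi (inner u (X t))).

Definition mutually_independent disp (T : measurableType disp)
    (P : probability T R) disp' (V : measurableType disp') (X : nat -> T -> V) :=
  forall (J : {fset nat}) (A : nat -> set V),
    (forall j, j \in J -> measurable (A j)) ->
    P (\bigcap_(j in [set` J]) (X j @^-1` A j)) =
    (\prod_(j <- J) P (X j @^-1` A j))%E.

Definition identically_distributed disp (T : measurableType disp)
    (P : probability T R) disp' (V : measurableType disp')
    (X : nat -> {RV P >-> V}) :=
  forall n (A : set V), measurable A ->
    distribution P (X n) A = distribution P (X 0%N) A.

(* f is a version of the density of the law of X. *)
Definition has_density disp (T : measurableType disp) (P : probability T R)
    d (X : T -> 'rV[R]_d) (f : 'rV[R]_d -> R) :=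
  [/\ measurable_fun setT f, (forall x, 0 <= f x) &
      forall A : set 'rV[R]_d, measurable A ->
        P (X @^-1` A) = (\int[lebesgue_rV R d]_(x in A) (f x)%:E)%E].

Definition dTV disp1 (T1 : measurableType disp1) (P1 : probability T1 R)
    disp2 (T2 : measurableType disp2) (P2 : probability T2 R)
    disp' (V : measurableType disp') (X1 : T1 -> V) (X2 : T2 -> V) : \bar R :=
  ereal_sup [set (`| 'E_P1[f \o X1] - 'E_P2[f \o X2] |)%E |
    f in [set f : V -> R | measurable_fun setT f /\ forall x, `|f x| <= 1]].

Definition normalized_sum T d (Y : nat -> T -> 'rV[R]_d) (n : nat) (t : T) :
    'rV[R]_d :=
  (Num.sqrt n%:R)^-1 *: \sum_(1 <= j < n.+1) Y j t.

End random.

(* Main.v *)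
(* Let [psi] be the characteristic function of [Y_0], so that the one of [S_n]
   is [psi (u / sqrt n) ^+ n]. A third-order Taylor expansion gives
   [psi w = exp (- |w|^2 / 2) + O(|w|^3)]. The decay hypothesis gives
   [|psi| <= 1/2] outside a ball, and the inequality
   [1 - |psi (2 w)| <= 4 (1 - |psi w|)] turns this into
   [|psi w| <= exp (- c |w|^2)] inside the ball. Together these yield
   [|psi (u / sqrt n) ^+ n - exp (- |u|^2 / 2)| <= K n^(-1/2) (1 + |u|)^(-b)]
   for some [b > d] and all large [n], and Fourier inversion bounds the distance
   of the densities uniformly by [O(n^(-1/2))]. For the total variation, half of
   the L1 distance is the integral of [(g - f)^+ <= min (D, g) <= D^(1-p) g^p]
   with [D = O(n^(-1/2))] and [g] the Gaussian density, and [g^p] is integrable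
   for every [p > 0]. The inversion formula is proved by smoothing with Gaussians
   of variance [s^2 -> 0], tested against Lipschitz tents that increase to
   indicators of boxes. *)
Require Import Defs.
From HB Require Import structures.
From mathcomp Require Import all_boot all_order all_algebra finmap complex.
From mathcomp Require Import all_classical all_reals all_analysis ess_sup_inf.
From mathcomp Require Import ring lra measurable_realfun.

Import Order.TTheory GRing.Theory Num.Theory.
Import numFieldNormedType.Exports.

Local Open Scope classical_set_scope.
Local Open Scope ring_scope.

Set Implicit Arguments.
Unset Strict Implicit.
Unset Printing Implicit Defensive.

(** [phi] need not be integrable; its [n]-th power is once [alpha * n > d]. Inversion, and with it
    every rate, therefore starts at some rank [n0]. The finitely many smaller [n] are absorbed into
    the constants: by the trivial bound 2 for total variation, and for densities by the fact that
    all densities of one law agree almost everywhere. The doubling inequality replaces a compactness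
    argument: it carries the gap below 1, known far from the origin, inward with an explicit
    constant. The density estimate itself loses nothing against [n^(-1/2)]. The loss [eps] is spent
    in total variation, because a uniform bound on the difference of two densities says nothing
    about its integral over infinite volume and has to be interpolated with the Gaussian tail. Both
    densities have mass 1, so one positive part controls the other; choosing [(g - f)^+] means that
    no tail estimate for [f] is required. Integrals are kept real: a characteristic function enters
    through its cosine and sine parts, and complex numbers appear only for products and moduli. *)

Section Rintegral_aux.
Context d (T : measurableType d) (R : realType).
Variable mu : {measure set T -> \bar R}.
Implicit Types f g : T -> R.

Lemma integrable_dominated f g : measurable_fun setT f ->
  (forall x, `|f x| <= g x) -> mu.-integrable setT (EFin \o g) ->
  mu.-integrable setT (EFin \o f).
Proof.
move=> mf fg; apply: le_integrable => //; first exact/measurable_EFinP.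
by move=> x _ /=; rewrite lee_fin (le_trans (fg x))// ler_norm.
Qed.

Lemma EFin_Rintegral f : mu.-integrable setT (EFin \o f) ->
  (\int[mu]_x f x)%:E = (\int[mu]_x (f x)%:E)%E.
Proof. by move=> intf; rewrite fineK//; exact: integrable_fin_num. Qed.

Lemma Rintegral_dominated_cvg (f_ : nat -> T -> R) f g :
  (forall n, measurable_fun setT (f_ n)) ->
  (forall x, f_ n x @[n --> \oo] --> f x) ->
  mu.-integrable setT (EFin \o g) ->
  (forall n x, `|f_ n x| <= g x) ->
  \int[mu]_x f_ n x @[n --> \oo] --> \int[mu]_x f x.
Proof.
move=> mf_ ff ig fg.
have mf' n : measurable_fun setT (EFin \o f_ n) by exact/measurable_EFinP/mf_.
have mf : measurable_fun setT (EFin \o f).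
  by apply/measurable_EFinP/(measurable_fun_cvg mf_) => x _; exact: ff.
have ff' x : [set: T] x -> (EFin \o f_ n) x @[n --> \oo] --> (EFin \o f) x.
  by move=> _; apply: cvg_EFin; [exact: nearW|exact: ff].
have [||intf _ h] := dominated_convergence measurableT mf' mf _ ig _.
- exact: aeW.
- by apply: aeW => x n _; rewrite /= lee_fin.
- by apply: fine_cvg; rewrite fineK//; exact: integrable_fin_num.
Qed.

End Rintegral_aux.

(** Every section is assumed integrable, not just almost every one, so that [fine] can be removed
    from each inner integral before Fubini applies. *)
Lemma Rintegral_Fubini d1 d2 (T1 : measurableType d1) (T2 : measurableType d2)
    (R : realType) (m1 : {sigma_finite_measure set T1 -> \bar R})
    (m2 : {sigma_finite_measure set T2 -> \bar R}) (f : T1 * T2 -> R) :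
  (m1 \x m2)%E.-integrable setT (EFin \o f) ->
  (forall x, m2.-integrable setT (fun y => (f (x, y))%:E)) ->
  (forall y, m1.-integrable setT (fun x => (f (x, y))%:E)) ->
  \int[m1]_x \int[m2]_y f (x, y) = \int[m2]_y \int[m1]_x f (x, y).
Proof.
move=> intf if2 if1.
rewrite [LHS]/Rintegral [RHS]/Rintegral; congr fine.
under eq_integral => x _ do rewrite (EFin_Rintegral (if2 x)).
under [RHS]eq_integral => y _ do rewrite (EFin_Rintegral (if1 y)).
exact: Fubini intf.
Qed.

(** * One-dimensional integrals *)

Section real_line.
Context (R : realType).
Local Notation mu := (@lebesgue_measure R).

(** Integration by parts on the whole line: the integral over [[-(n+1), n+1]] is a difference of
    boundary values of [G], which are at most [C / (n+1)]. *)
Lemma Rintegral_derive_eq0 (G g : R -> R) (C : R) :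
  (forall x : R, is_derive x 1 G (g x)) -> continuous g ->
  mu.-integrable setT (EFin \o g) ->
  (forall x, `|x| * `|G x| <= C) ->
  \int[mu]_x g x = 0.
Proof.
move=> dG cg ig GC.
have mg : measurable_fun setT g by exact: continuous_measurable_fun.
pose A n : set R := [set` `[- n.+1%:R, n.+1%:R]].
have h : \int[mu]_x (g \_ (A n)) x @[n --> \oo] --> \int[mu]_x g x.
  apply: (@Rintegral_dominated_cvg _ _ _ mu _ _ (fun x => `|g x|)).
  - move=> n; apply/(measurable_restrictT _ _).1 => //.
    exact: measurable_itv.
    exact: measurable_funTS.
  - move=> x; apply: cvg_near_cst; near=> n.
    rewrite patchE mem_set// /A /= in_itv/= -ler_norml.
    apply/ltW/(@lt_le_trans _ _ n%:R); last by rewrite ler_nat.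
    near: n; exact: nbhs_infty_gtr.
  - exact: integrable_norm.
  - by move=> n x; rewrite patchE; case: ifP => //=; rewrite normr0.
have eF : (fun n => \int[mu]_x (g \_ (A n)) x) = (fun n => G n.+1%:R - G (- n.+1%:R)).
  apply/funext => n; rewrite -Rintegral_mkcond /Rintegral.
  have n0 : - n.+1%:R < n.+1%:R :> R by rewrite gtrN.
  have cG : continuous G.
    move=> x; apply: differentiable_continuous; apply/derivable1_diffP.
    by have [] := dG x.
  rewrite (@continuous_FTC2 _ g G)//.
  - exact: continuous_subspaceT.
  - split => //.
    + by apply: cvg_at_right_filter; exact: cG.
    + by apply: cvg_at_left_filter; exact: cG.
  - by move=> x _; rewrite derive1E derive_val.
move: h; rewrite eF => h.
apply: (cvg_unique _ h) => //=.
apply/cvgr0Pnorm_le => e e0; near=> n.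
have nC b : `|G ((-1) ^+ b * n.+1%:R)| <= C / n.+1%:R.
  rewrite ler_pdivlMr// mulrC; apply: (le_trans _ (GC ((-1) ^+ b * n.+1%:R))).
  by rewrite normrM normrX normrN1 expr1n mul1r normr_nat.
rewrite (le_trans (ler_normB _ _))//.
have := nC true; have := nC false; rewrite expr1 expr0 mulN1r mul1r => h1 h2.
rewrite (le_trans (lerD h1 h2))// -mulrDl ler_pdivrMr// -ler_pdivrMl//.
apply/ltW/(@lt_le_trans _ _ n%:R); last by rewrite ler_nat.
near: n; exact: nbhs_infty_gtr.
Unshelve. all: end_near. Qed.

Lemma normal_pdf0E (s u : R) : s != 0 ->
  normal_pdf 0 s u = normal_peak s * expR (- (u ^+ 2 / (s ^+ 2 *+ 2))).
Proof. by move=> s0; rewrite normal_pdfE// /normal_fun subr0 mulNr. Qed.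

Lemma normal_peak_sqrt2 (s : R) : 0 < s ->
  normal_peak s = Num.sqrt 2 * normal_peak (Num.sqrt 2 * s).
Proof.
move=> s0; rewrite /normal_peak exprMn sqr_sqrtr//.
have -> : 2 * s ^+ 2 * pi *+ 2 = 2 * (s ^+ 2 * pi *+ 2) by ring.
rewrite sqrtrM// invfM mulrA divff ?mul1r// gt_eqF// sqrtr_gt0.
Qed.

(** Half of the exponent pays for the factor [|u|]: with [t = u^2 / (4 s^2)] the left exponent is
    [-(t + t)], and [exp t >= 1 + t] leaves [s |u| <= 4 s^2 + u^2], a consequence of
    [(2 s - |u|)^2 >= 0]. *)
Lemma norm_expR_le (s u : R) : 0 < s ->
  `|u| * expR (- (u ^+ 2 / (s ^+ 2 *+ 2))) <=
  4 * s * expR (- (u ^+ 2 / ((Num.sqrt 2 * s) ^+ 2 *+ 2))).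
Proof.
move=> s0; set t := (u ^+ 2 / ((Num.sqrt 2 * s) ^+ 2 *+ 2)).
have -> : u ^+ 2 / (s ^+ 2 *+ 2) = t + t.
  rewrite /t exprMn sqr_sqrtr//; field; exact: lt0r_neq0.
rewrite opprD expRD mulrA ler_wpM2r ?expR_ge0//.
rewrite expRN ler_pdivrMr ?expR_gt0//.
apply: (@le_trans _ _ (4 * s * (1 + t))); last first.
  by rewrite ler_wpM2l ?expR_ge1Dx// mulr_ge0// ltW.
have -> : 4 * s * (1 + t) = 4 * s + `|u| ^+ 2 / s.
  rewrite /t exprMn sqr_sqrtr// real_normK ?num_real//; field; exact: lt0r_neq0.
rewrite -(ler_pM2l s0) mulrDr [s * (_ / s)]mulrC divfK ?gt_eqF//.
have := sqr_ge0 (2 * s - `|u|); have := normr_ge0 u; nra.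
Qed.

Lemma normal_pdf_norm_le (s u : R) : 0 < s ->
  `|u| * normal_pdf 0 s u <=
  4 * Num.sqrt 2 * s * normal_pdf 0 (Num.sqrt 2 * s) u.
Proof.
move=> s0; have r0 : 0 < Num.sqrt 2 :> R by rewrite sqrtr_gt0.
rewrite !normal_pdf0E ?gt_eqF ?mulr_gt0// [in leLHS]normal_peak_sqrt2//.
set p := normal_peak _; have p0 : 0 <= p by exact: normal_peak_ge0.
set E := expR (- (u ^+ 2 / ((_ * s) ^+ 2 *+ 2))).
have -> : 4 * Num.sqrt 2 * s * (p * E) = Num.sqrt 2 * p * (4 * s * E) by ring.
by rewrite mulrCA ler_wpM2l ?norm_expR_le// mulr_ge0// ltW.
Qed.

Lemma integrable_norm_normal_pdf (s : R) : 0 < s ->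
  mu.-integrable setT (fun u => (`|u| * normal_pdf 0 s u)%:E).
Proof.
move=> s0; apply: (@integrable_dominated _ _ _ mu (fun u : R => `|u| * normal_pdf 0 s u)
  (fun u : R => 4 * Num.sqrt 2 * s * normal_pdf 0 (Num.sqrt 2 * s) u)).
- apply: measurable_funM; last exact: measurable_normal_pdf.
  exact: normr_measurable.
- move=> u; rewrite ger0_norm; first exact: normal_pdf_norm_le.
  by rewrite mulr_ge0// normal_pdf_ge0.
- rewrite /comp; under eq_fun do rewrite EFinM.
  apply: integrableZl => //; exact: integrable_normal_pdf.
Qed.

Lemma is_derive_normal_pdf (s u : R) : s != 0 ->
  is_derive u 1 (normal_pdf 0 s) (- (u / s ^+ 2) * normal_pdf 0 s u).
Proof.
move=> s0; have -> : normal_pdf 0 s =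
    (fun v => normal_peak s * expR (- (v ^+ 2 / (s ^+ 2 *+ 2)))).
  by apply/funext => v; rewrite normal_pdf0E.
apply: is_derive_eq.
rewrite /GRing.scale/=; field; exact: s0.
Qed.

Lemma integrable_normal_pdfM (s : R) (h : R -> R) : s != 0 ->
  measurable_fun setT h -> (forall x, `|h x| <= 1) ->
  mu.-integrable setT (fun u => (normal_pdf 0 s u * h u)%:E).
Proof.
move=> s0 mh h1.
apply: (@integrable_dominated _ _ _ mu (fun u : R => normal_pdf 0 s u * h u)
  (fun u : R => normal_pdf 0 s u)).
- by apply: measurable_funM => //; exact: measurable_normal_pdf.
- by move=> u; rewrite normrM ger0_norm ?normal_pdf_ge0// ler_piMr// normal_pdf_ge0.
- exact: integrable_normal_pdf.
Qed.

Lemma measurable_cosM (a y : R) : measurable_fun setT (fun u : R => cos (a + u * y)).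
Proof.
apply: continuous_measurable_fun => x.
apply: (@continuous_comp _ _ _ (fun u : R => a + u * y)); last exact: continuous_cos.
by apply: cvgD; [exact: cvg_cst|exact: mulrr_continuous].
Qed.

Lemma measurable_sinM (a y : R) : measurable_fun setT (fun u : R => sin (a + u * y)).
Proof.
apply: continuous_measurable_fun => x.
apply: (@continuous_comp _ _ _ (fun u : R => a + u * y)); last exact: continuous_sin.
by apply: cvgD; [exact: cvg_cst|exact: mulrr_continuous].
Qed.

Lemma norm_cos_le1 (x : R) : `|cos x| <= 1.
Proof. by rewrite ler_norml cos_geN1 cos_le1. Qed.

Lemma norm_sin_le1 (x : R) : `|sin x| <= 1.
Proof. by rewrite ler_norml sin_geN1 sin_le1. Qed.

Lemma integrable_normal_sin (s a y : R) : 0 < s ->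
  mu.-integrable setT (fun u => (u * normal_pdf 0 s u * sin (a + u * y))%:E).
Proof.
move=> s0.
apply: (@integrable_dominated _ _ _ mu
  (fun u : R => u * normal_pdf 0 s u * sin (a + u * y)) (fun u : R => `|u| * normal_pdf 0 s u)).
- apply: measurable_funM; last exact: measurable_sinM.
  by apply: measurable_funM => //; exact: measurable_normal_pdf.
- move=> u; rewrite !normrM (ger0_norm (normal_pdf_ge0 _ _ _)) ler_piMr//.
    by rewrite mulr_ge0// normal_pdf_ge0.
  exact: norm_sin_le1.
- exact: integrable_norm_normal_pdf.
Qed.

(** The Gaussian density satisfies [s^2 * g' = - u * g], so the difference of the two integrands is
    the derivative of [s^2 * g * sin (a + u y)]. *)
Lemma integral_normal_sin (s a y : R) : 0 < s ->
  \int[mu]_u (u * normal_pdf 0 s u * sin (a + u * y)) =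
  s ^+ 2 * y * \int[mu]_u (normal_pdf 0 s u * cos (a + u * y)).
Proof.
move=> s0; have sn0 := lt0r_neq0 s0.
have i1 : mu.-integrable setT (fun u => (s ^+ 2 * y * (normal_pdf 0 s u * cos (a + u * y)))%:E).
  under eq_fun do rewrite EFinM.
  apply: integrableZl => //; apply: integrable_normal_pdfM => //.
    exact: measurable_cosM.
  by move=> x; exact: norm_cos_le1.
have i2 := integrable_normal_sin a y s0.
have : \int[mu]_u (s ^+ 2 * y * (normal_pdf 0 s u * cos (a + u * y)) -
    u * normal_pdf 0 s u * sin (a + u * y)) = 0.
  apply: (@Rintegral_derive_eq0 (fun u => s ^+ 2 * (normal_pdf 0 s u * sin (a + u * y))) _
    (s ^+ 2 * (4 * Num.sqrt 2 * s * normal_peak (Num.sqrt 2 * s)))).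
  - move=> u; have := is_derive_normal_pdf u sn0 => ?.
    apply: is_derive_eq; rewrite /GRing.scale/=; field.
    exact: sn0.
  - have cw := continuous_normal_pdf (m := 0) sn0.
    have cy : continuous (fun u : R => a + u * y).
      by move=> u; apply: cvgD; [exact: cvg_cst|exact: mulrr_continuous].
    move=> u; apply: cvgB; apply: cvgM.
    + exact: cvg_cst.
    + apply: cvgM; first exact: cw.
      by apply: (continuous_comp (cy u)); exact: continuous_cos.
    + by apply: cvgM; [exact: cvg_id|exact: cw].
    + by apply: (continuous_comp (cy u)); exact: continuous_sin.
  - exact: (integrableB measurableT i1 i2).
  - move=> u; rewrite normrM (ger0_norm (sqr_ge0 _)) mulrCA ler_wpM2l ?sqr_ge0//.
    rewrite normrM (ger0_norm (normal_pdf_ge0 _ _ _)) mulrA.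
    apply: (@le_trans _ _ (`|u| * normal_pdf 0 s u)).
      by rewrite ler_piMr ?norm_sin_le1// mulr_ge0// normal_pdf_ge0.
    apply: le_trans (normal_pdf_norm_le _ s0) _.
    apply: ler_wpM2l; first by rewrite !mulr_ge0 ?sqrtr_ge0// ltW.
    by apply: normal_pdf_ub; rewrite mulf_neq0 ?gt_eqF ?sqrtr_gt0.
rewrite RintegralB// RintegralZl//; first by move/subr0_eq.
apply: integrable_normal_pdfM => //; first exact: measurable_cosM.
by move=> x; exact: norm_cos_le1.
Qed.

(** As a function of [y] the integral solves [F' = - s^2 y F] with [F 0 = cos a], by differentiation
    under the integral sign. Hence [F y * exp (s^2 y^2 / 2)] is constant. *)
Lemma integral_normal_cos (s a y : R) : 0 < s ->
  \int[mu]_u (normal_pdf 0 s u * cos (a + u * y)) =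
  cos a * expR (- (s ^+ 2 * y ^+ 2 / 2)).
Proof.
move=> s0; have sn0 := lt0r_neq0 s0.
pose f y u : R := normal_pdf 0 s u * cos (a + u * y).
pose F y := \int[mu]_u f y u.
have fi z : mu.-integrable setT (EFin \o f z).
  apply: integrable_normal_pdfM => //; first exact: measurable_cosM.
  by move=> x; exact: norm_cos_le1.
have df (z u : R) : is_derive z 1 (f ^~ u) (- (u * normal_pdf 0 s u * sin (a + u * z))).
  rewrite /f; apply: is_derive_eq; rewrite /GRing.scale/=; ring.
have dF (z : R) : is_derive z 1 F (- (s ^+ 2 * z) * F z).
  have zI : (`]z - 1, z + 1[%classic : set R) z.
    by rewrite /= in_itv/= ltrBlDr !ltrDl ltr01.
  have d1 u x : partial1of2 f x u = - (u * normal_pdf 0 s u * sin (a + u * x)).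
    by rewrite partial1of2E derive_val.
  have D x (u : R) : `]z - 1, z + 1[%classic x -> [set: R] u -> derivable (f ^~ u) x 1.
    by move=> _ _; case: (df x u).
  have ub x (u : R) : `]z - 1, z + 1[%classic x -> [set: R] u ->
      `|partial1of2 f x u| <= `|u| * normal_pdf 0 s u.
    move=> _ _; rewrite d1 normrN !normrM (ger0_norm (normal_pdf_ge0 _ _ _)).
    by rewrite ler_piMr ?norm_sin_le1// mulr_ge0// normal_pdf_ge0.
  have G0 (u : R) : 0 <= `|u| * normal_pdf 0 s u by rewrite mulr_ge0// normal_pdf_ge0.
  apply: DeriveDef.
    exact: (derivable_under_integral measurableT zI (fun x _ => fi x) D G0
      (integrable_norm_normal_pdf s0) ub).
  rewrite -derive1E (differentiation_under_integral measurableT zI (fun x _ => fi x) D G0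
      (integrable_norm_normal_pdf s0) ub).
  rewrite /F mulNr -integral_normal_sin//.
  under eq_Rintegral do rewrite d1 -mulN1r.
  rewrite RintegralZl ?mulN1r//; exact: integrable_normal_sin.
have dE (z : R) : is_derive z 1 (fun z => F z * expR (s ^+ 2 * z ^+ 2 / 2)) 0.
  have := dF z => ?; apply: is_derive_eq; rewrite /GRing.scale/=; by field.
have := is_derive_0_is_cst y 0 dE.
have -> : F 0 = cos a.
  rewrite /F; under eq_Rintegral do rewrite /f mulr0 addr0.
  rewrite RintegralZr//; last exact: integrable_normal_pdf.
  by rewrite /Rintegral integral_normal_pdf mul1r.
rewrite expr0n/= mulr0 mul0r expR0 mulr1 => h.
by rewrite expRN -h mulfK// gt_eqF// expR_gt0.
Qed.

Lemma measurable_decay (p : R) :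
  measurable_fun setT (fun x : R => (1 + `|x|) `^ (- p)).
Proof.
apply: (measurableT_comp (measurable_powR (- p))).
by apply: measurable_funD => //; exact: normr_measurable.
Qed.

Lemma integrable_decay (p : R) : 1 < p ->
  mu.-integrable setT (fun x => ((1 + `|x|) `^ (- p))%:E).
Proof.
move=> p1; have p0 : 0 < p - 1 by rewrite subr_gt0.
have e0 (x : R) : 0 < 1 + `|x| by rewrite ltr_pwDl.
have cf : continuous (fun x : R => (1 + `|x|) `^ (- p)).
  move=> x; apply: (@continuous_comp _ _ _ (fun x : R => 1 + `|x|) (fun y => y `^ (- p))).
    by apply: cvgD; [exact: cvg_cst|exact: norm_continuous].
  apply: differentiable_continuous; apply/derivable1_diffP.
  by have [] := is_derive1_powR (- p) (e0 x).
apply/integrableP; split.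
  by apply/measurable_EFinP; exact: measurable_decay.
under eq_integral => x _.
  rewrite gee0_abs; last by rewrite lee_fin powR_ge0.
  over.
rewrite ge0_symfun_integralT//; last first.
  by move=> x /=; rewrite normrN.
have -> : [set x : R | 0 <= x] = [set` `[0, +oo[].
  by apply/seteqP; split => x /=; rewrite in_itv/= andbT.
(* Stated beyond the half-line of integration, so that 0 is an interior point and one-sided
   continuity at 0 follows from derivability. *)
have dF (x : R) : -1 < x -> is_derive x 1 (fun x => - (p - 1)^-1 * (1 + x) `^ (1 - p))
    ((1 + x) `^ (- p)).
  move=> x1; have x0 : 0 < 1 + x by rewrite -ltrBlDl sub0r.
  have dx := is_derive1_powR (1 - p) x0.
  have dg : is_derive x 1 (fun x => 1 + x) (1 : R).
    by have := is_deriveD (is_derive_cst (1 : R) x 1) (is_derive_id x 1); rewrite add0r.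
  have := @is_derive1_comp _ (fun y => y `^ (1 - p)) (fun x => 1 + x) x _ _ dx dg => ?.
  apply: is_derive_eq; rewrite /GRing.scale/= (_ : 1 - p - 1 = - p); last by ring.
  by field; rewrite subr_eq0 gt_eqF.
rewrite (@ge0_continuous_FTC2y _ _ (fun x => - (p - 1)^-1 * (1 + x) `^ (1 - p)) _ 0)//.
- by rewrite -EFinB -EFinM ltry.
- exact: continuous_subspaceT.
- suff h0 : (1 + x) `^ (1 - p) @[x --> +oo] --> (0 : R).
    by have := cvgM (cvg_cst (- (p - 1)^-1)) h0; rewrite mulr0; exact.
  apply/cvgr0Pnorm_le => e e_gt0; near=> x.
  have x0 : 0 <= x by near: x; exact: nbhs_pinfty_ge.
  rewrite ger0_norm ?powR_ge0// -opprB powRN.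
  rewrite -[leRHS]invrK lef_pV2 ?posrE ?invr_gt0 ?powR_gt0 ?ltr_pwDl//.
  have -> : e^-1 = (e^-1 `^ (p - 1)^-1) `^ (p - 1).
    by rewrite -powRrM mulVf ?gt_eqF// powRr1// invr_ge0 ltW.
  apply: ge0_ler_powR; rewrite ?nnegrE ?powR_ge0 ?(ltW p0)//; first exact: addr_ge0.
  apply: (@le_trans _ _ x); last by rewrite lerDr.
  by near: x; apply: nbhs_pinfty_ge; exact: num_real.
- by move=> x x0; case: (dF x) => //; apply: lt_trans x0.
- have d0 : derivable (fun x : R => - (p - 1)^-1 * (1 + x) `^ (1 - p)) 0 1.
    by case: (dF 0); rewrite ?ltrN10.
  have /derivable1_diffP/differentiable_continuous := d0.
  exact: cvg_at_right_filter.
- move=> x; rewrite in_itv/= andbT => x0.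
  by have := dF x (lt_trans (ltrN10 R) x0) => ?; rewrite derive1E derive_val gtr0_norm.
Unshelve. all: end_near. Qed.

End real_line.

(** * Integration on R^d *)

Section lebesgue_rV_integral.
Context (R : realType).
Local Notation leb := (@lebesgue_measure R).

Lemma ge0_integral_rVS n (f : 'rV[R]_n.+1 -> \bar R) :
  measurable_fun setT f -> (forall v, (0 <= f v)%E) ->
  (\int[lebesgue_rV R n.+1]_v f v =
   \int[leb]_x \int[lebesgue_rV R n]_v f (cons_rV (x, v)))%E.
Proof.
move=> mf f0.
rewrite [LHS](_ : _ = \int[pushforward (leb \x lebesgue_rV R n) (@cons_rV R n)]_v f v)%E//.
rewrite ge0_integral_pushforward//; last exact: measurable_cons_rV.
rewrite preimage_setT.
rewrite fubini_tonelli1//; last by move=> x; exact: f0.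
by apply: measurableT_comp => //; exact: measurable_cons_rV.
Qed.

Lemma measurable_prod_rV n (f : 'I_n -> R -> R) :
  (forall i, measurable_fun setT (f i)) ->
  measurable_fun setT (fun v : 'rV[R]_n => \prod_i f i (v ord0 i)).
Proof.
move=> mf; apply: measurable_prod => i _.
by apply: (measurableT_comp (mf i)); exact: measurable_coord_rV.
Qed.

Lemma integral_rV_prod n (f : 'I_n -> R -> R) (c : 'I_n -> R) :
  (forall i, measurable_fun setT (f i)) -> (forall i x, 0 <= f i x) ->
  (forall i, \int[leb]_x (f i x)%:E = (c i)%:E)%E ->
  (\int[lebesgue_rV R n]_v (\prod_i f i (v ord0 i))%:E = (\prod_i c i)%:E)%E.
Proof.
move=> + + +; elim: n f c => [|n IHn] f c mf f0 fc.
  rewrite big_ord0 /=; under eq_integral do rewrite big_ord0.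
  by rewrite integral_cst//= diracE in_setT mule1.
rewrite ge0_integral_rVS; last 2 first.
- by apply/measurable_EFinP; exact: measurable_prod_rV.
- by move=> v; rewrite lee_fin prodr_ge0.
transitivity (\int[leb]_x ((f ord0 x)%:E * (\prod_i c (lift ord0 i))%:E))%E.
  apply: eq_integral => x _.
  rewrite -(IHn (fun i => f (lift ord0 i)) (fun i => c (lift ord0 i)))//.
  rewrite -ge0_integralZl_EFin//.
  - apply: eq_integral => v _; rewrite big_ord_recl cons_rV0 EFinM; congr (_ * _%:E)%E.
    by apply: eq_bigr => i _; rewrite cons_rVS.
  - by move=> v _; rewrite lee_fin prodr_ge0.
  - apply/measurable_EFinP.
    exact: (measurable_prod_rV (fun i => mf (lift ord0 i))).
rewrite ge0_integralZr//.
- by rewrite fc big_ord_recl EFinM.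
- by apply/measurable_EFinP; exact: mf.
- by move=> x _; rewrite lee_fin.
- by rewrite lee_fin prodr_ge0// => i _; rewrite -lee_fin -fc integral_ge0// => x _; rewrite lee_fin.
Qed.

(** The measure in dimension [n.+1] is the image of a product under [cons_rV]. Integrability on that
    product comes from the nonnegative case applied to the absolute value, after which Fubini
    applies. *)
Lemma Rintegral_rVS n (f : 'rV[R]_n.+1 -> R) :
  (lebesgue_rV R n.+1).-integrable setT (EFin \o f) ->
  (forall x, (lebesgue_rV R n).-integrable setT (fun v => (f (cons_rV (x, v)))%:E)) ->
  \int[lebesgue_rV R n.+1]_v f v =
  \int[leb]_x \int[lebesgue_rV R n]_v f (cons_rV (x, v)).
Proof.
move=> intf intfx; have /integrableP[mf foo] := intf.
rewrite [LHS]/Rintegral [RHS]/Rintegral; congr fine.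
under [RHS]eq_integral => x _ do rewrite (EFin_Rintegral (intfx x)).
rewrite [LHS](_ : _ = \int[pushforward (leb \x lebesgue_rV R n) (@cons_rV R n)]_v (f v)%:E)%E//.
have mfc : measurable_fun setT (fun p : R * 'rV[R]_n => (f (cons_rV p))%:E).
  by apply: (measurableT_comp mf); exact: measurable_cons_rV.
have intfc : (leb \x lebesgue_rV R n)%E.-integrable setT
    (fun p : R * 'rV[R]_n => (f (cons_rV p))%:E).
  apply/integrableP; split => //.
  rewrite fubini_tonelli1//; last exact: measurableT_comp.
  by move: foo; rewrite ge0_integral_rVS//; exact: measurableT_comp.
rewrite integral_pushforward//; last exact: measurable_cons_rV.
by rewrite preimage_setT -integral12_prod_meas1.
Qed.

Lemma measurable_inner n (y : 'rV[R]_n) : measurable_fun setT (fun v => inner v y).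
Proof.
apply: measurable_sum => i; apply: measurable_funM => //.
exact: measurable_coord_rV.
Qed.

Lemma inner_ge0 n (v : 'rV[R]_n) : 0 <= inner v v.
Proof. by apply: sumr_ge0 => i _; rewrite -expr2 sqr_ge0. Qed.

Lemma enorm_ge0 n (v : 'rV[R]_n) : 0 <= enorm v.
Proof. exact: sqrtr_ge0. Qed.

Lemma sqr_enorm n (v : 'rV[R]_n) : enorm v ^+ 2 = inner v v.
Proof. by rewrite sqr_sqrtr// inner_ge0. Qed.

Lemma measurable_enorm n : measurable_fun setT (@enorm R n).
Proof.
apply: (measurableT_comp (continuous_measurable_fun (@sqrt_continuous R))).
apply: measurable_sum => i; apply: measurable_funM; exact: measurable_coord_rV.
Qed.

(** The centered Gaussian density with covariance [s^2] times the identity, as a product so that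
    integrals split by coordinate; [gauss_rVE] gives the radial form. *)
Definition gauss_rV (s : R) n (v : 'rV[R]_n) : R :=
  \prod_i normal_pdf 0 s (v ord0 i).

Lemma gauss_rV_ge0 s n (v : 'rV[R]_n) : 0 <= gauss_rV s v.
Proof. by apply: prodr_ge0 => i _; exact: normal_pdf_ge0. Qed.

Lemma gauss_rVE s n (v : 'rV[R]_n) : s != 0 ->
  gauss_rV s v = normal_peak s ^+ n * expR (- (enorm v ^+ 2 / (s ^+ 2 *+ 2))).
Proof.
move=> s0; rewrite /gauss_rV; under eq_bigr do rewrite normal_pdf0E//.
rewrite big_split/= prodr_const card_ord; apply: congr1.
rewrite -expR_sum sqr_enorm /inner mulr_suml -sumrN; apply: congr1.
by apply: eq_bigr => i _; rewrite expr2.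
Qed.

Lemma measurable_gauss_rV s n : measurable_fun setT (@gauss_rV s n).
Proof.
by apply: (@measurable_prod_rV n (fun=> normal_pdf 0 s)) => i; exact: measurable_normal_pdf.
Qed.

Lemma normal_pdfB (m s x : R) : s != 0 -> normal_pdf m s x = normal_pdf 0 s (x - m).
Proof. by move=> s0; rewrite !normal_pdfE// /normal_fun subr0. Qed.

Lemma integral_gauss_rVB s n (m : 'rV[R]_n) : s != 0 ->
  (\int[lebesgue_rV R n]_v (gauss_rV s (v - m))%:E = 1)%E.
Proof.
move=> s0; rewrite -[RHS](_ : (\prod_(i < n) (1 : R))%:E = 1%E); last by rewrite big1.
rewrite -(@integral_rV_prod n (fun i => normal_pdf (m ord0 i) s))//.
- apply: eq_integral => v _; congr EFin; apply: eq_bigr => i _.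
  by rewrite !mxE -normal_pdfB.
- by move=> i; exact: measurable_normal_pdf.
- by move=> i x; exact: normal_pdf_ge0.
- by move=> i; exact: integral_normal_pdf.
Qed.

Lemma integral_gauss_rV s n : s != 0 ->
  (\int[lebesgue_rV R n]_v (gauss_rV s v)%:E = 1)%E.
Proof.
by move=> /(integral_gauss_rVB (0 : 'rV[R]_n)) <-; apply: eq_integral => v _; rewrite subr0.
Qed.

Lemma integrable_gauss_rV s n : s != 0 ->
  (lebesgue_rV R n).-integrable setT (EFin \o @gauss_rV s n).
Proof.
move=> s0; apply/integrableP; split.
  by apply/measurable_EFinP; exact: measurable_gauss_rV.
under eq_integral do rewrite /= ger0_norm ?gauss_rV_ge0//.
by rewrite integral_gauss_rV// ltry.
Qed.

Lemma integrable_gauss_rVM s n (h : 'rV[R]_n -> R) : s != 0 ->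
  measurable_fun setT h -> (forall x, `|h x| <= 1) ->
  (lebesgue_rV R n).-integrable setT (fun v => (gauss_rV s v * h v)%:E).
Proof.
move=> s0 mh h1.
apply: (@integrable_dominated _ _ _ (lebesgue_rV R n)
  (fun v : 'rV[R]_n => gauss_rV s v * h v) (fun v : 'rV[R]_n => gauss_rV s v)).
- by apply: measurable_funM => //; exact: measurable_gauss_rV.
- by move=> u; rewrite normrM ger0_norm ?gauss_rV_ge0// ler_piMr// gauss_rV_ge0.
- exact: integrable_gauss_rV.
Qed.

Lemma measurable_cos_inner n a (y : 'rV[R]_n) :
  measurable_fun setT (fun v => cos (a + inner v y)).
Proof.
apply: (measurableT_comp (continuous_measurable_fun (@continuous_cos R))).
by apply: measurable_funD => //; exact: measurable_inner.
Qed.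

Lemma inner_cons_rV n x (v : 'rV[R]_n) (y : 'rV[R]_n.+1) :
  inner (cons_rV (x, v)) y =
  x * y ord0 ord0 + inner v (\row_i y ord0 (lift ord0 i)).
Proof.
rewrite /inner big_ord_recl cons_rV0; congr (_ + _).
by apply: eq_bigr => i _; rewrite cons_rVS mxE.
Qed.

(* The phase [a] makes the statement strong enough for an induction on the dimension. *)
Lemma integral_gauss_rV_cos s n a (y : 'rV[R]_n) : 0 < s ->
  \int[lebesgue_rV R n]_v (gauss_rV s v * cos (a + inner v y)) =
  cos a * expR (- (s ^+ 2 * enorm y ^+ 2 / 2)).
Proof.
move=> s0; have sn0 := lt0r_neq0 s0.
elim: n a y => [|n IHn] a y.
  rewrite (_ : (fun v => _) = cst (cos a)); last first.
    by apply/funext => v; rewrite /gauss_rV /inner !big_ord0 mul1r addr0.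
  rewrite Rintegral_cst//= indicE in_setT mulr1 sqr_enorm /inner big_ord0.
  by rewrite mulr0 mul0r oppr0 expR0 mulr1.
have gc x (v : 'rV[R]_n) : gauss_rV s (cons_rV (x, v)) = normal_pdf 0 s x * gauss_rV s v.
  rewrite /gauss_rV big_ord_recl cons_rV0; congr (_ * _).
  by apply: eq_bigr => i _; rewrite cons_rVS.
pose y' : 'rV[R]_n := \row_i y ord0 (lift ord0 i).
have intv x := integrable_gauss_rVM sn0 (measurable_cos_inner (a + x * y ord0 ord0) y')
  (fun v => norm_cos_le1 _).
have e x v : gauss_rV s (cons_rV (x, v)) * cos (a + inner (cons_rV (x, v)) y) =
    normal_pdf 0 s x * (gauss_rV s v * cos (a + x * y ord0 ord0 + inner v y')).
  by rewrite gc inner_cons_rV addrA mulrA.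
rewrite Rintegral_rVS.
- have e2 x : \int[lebesgue_rV R n]_v
      (gauss_rV s (cons_rV (x, v)) * cos (a + inner (cons_rV (x, v)) y)) =
      normal_pdf 0 s x * cos (a + x * y ord0 ord0) * expR (- (s ^+ 2 * enorm y' ^+ 2 / 2)).
    under eq_Rintegral => v _ do rewrite e.
    by rewrite (RintegralZl _ measurableT (intv x)) IHn mulrA.
  under eq_Rintegral => x _ do rewrite e2.
  rewrite RintegralZr//; last first.
    apply: integrable_normal_pdfM => //; first exact: measurable_cosM.
    by move=> x; exact: norm_cos_le1.
  rewrite integral_normal_cos// -[LHS]mulrA -expRD; congr (_ * expR _).
  rewrite !sqr_enorm [in RHS]/inner big_ord_recl.
  rewrite (_ : inner y' y' = \sum_(i < n) y ord0 (lift ord0 i) * y ord0 (lift ord0 i)).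
    by field.
  by apply: eq_bigr => i _; rewrite !mxE.
- apply: integrable_gauss_rVM => //; first exact: measurable_cos_inner.
  by move=> v; exact: norm_cos_le1.
- move=> x; under eq_fun do rewrite e EFinM.
  exact: integrableZl.
Qed.

(** Doubling the variance absorbs the factor [|v|], as in dimension one; the normalizing constants
    account for [sqrt 2 ^+ n]. It serves as a first-moment bound of order [s]. *)
Lemma enorm_gauss_rV_le s n (v : 'rV[R]_n) : 0 < s ->
  enorm v * gauss_rV s v <=
  4 * Num.sqrt 2 ^+ n * s * gauss_rV (Num.sqrt 2 * s) v.
Proof.
move=> s0; have r0 : 0 < Num.sqrt 2 :> R by rewrite sqrtr_gt0.
rewrite !gauss_rVE ?gt_eqF ?mulr_gt0// [in leLHS]normal_peak_sqrt2// exprMn.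
set p := normal_peak _ ^+ n; set q := Num.sqrt 2 ^+ n.
have p0 : 0 <= p by rewrite exprn_ge0// normal_peak_ge0.
have q0 : 0 <= q by rewrite exprn_ge0// ltW.
have := norm_expR_le (enorm v) s0; rewrite ger0_norm ?enorm_ge0// => h.
rewrite mulrCA (_ : _ * (p * _) = q * p * (4 * s *
  expR (- (enorm v ^+ 2 / ((Num.sqrt 2 * s) ^+ 2 *+ 2))))); last by ring.
by rewrite ler_wpM2l// mulr_ge0.
Qed.

Lemma std_gauss_pdfE n (x : 'rV[R]_n) : std_gauss_pdf x = gauss_rV 1 x.
Proof.
rewrite gauss_rVE ?oner_eq0// /std_gauss_pdf expr1n; congr (_ * expR (- (_ / _))).
rewrite /normal_peak expr1n mul1r exprVn -powR_mulrn ?sqrtr_ge0//.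
have pi2 : 0 <= pi *+ 2 :> R by rewrite mulrn_wge0// pi_ge0.
rewrite -(powR12_sqrt pi2) -powRrM powRN mulr_natl.
by congr (_ `^ _)^-1; rewrite mulrC.
Qed.

Lemma coord_le_enorm n (v : 'rV[R]_n) i : `|v ord0 i| <= enorm v.
Proof.
rewrite -sqrtr_sqr ler_sqrt ?sqr_ge0 ?inner_ge0// /inner (bigD1 i)//= -expr2 lerDl.
by apply: sumr_ge0 => j _; rewrite -expr2 sqr_ge0.
Qed.

Lemma measurable_enorm_decay n (b : R) :
  measurable_fun setT (fun v : 'rV[R]_n => (1 + enorm v) `^ (- b)).
Proof.
apply: (measurableT_comp (measurable_powR (- b))).
by apply: measurable_funD => //; exact: measurable_enorm.
Qed.

(** A substitute for polar coordinates: split the exponent evenly as [b = n p] with [p > 1] and use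
    [|v_i| <= |v|] in each of the [n] factors. The majorant is a product of integrable functions of
    one variable. *)
Lemma integrable_enorm_decay n (b : R) : (0 < n)%N -> n%:R < b ->
  (lebesgue_rV R n).-integrable setT (fun v => ((1 + enorm v) `^ (- b))%:E).
Proof.
move=> n0 nb; have n0' : 0 < n%:R :> R by rewrite ltr0n.
pose p := b / n%:R; have p1 : 1 < p by rewrite ltr_pdivlMr// mul1r.
apply: (@integrable_dominated _ _ _ (lebesgue_rV R n)
  (fun v : 'rV[R]_n => (1 + enorm v) `^ (- b))
  (fun v : 'rV[R]_n => \prod_i (1 + `|v ord0 i|) `^ (- p))).
- exact: measurable_enorm_decay.
- move=> v; rewrite ger0_norm ?powR_ge0//.
  have -> : (1 + enorm v) `^ (- b) = \prod_(i < n) (1 + enorm v) `^ (- p).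
    rewrite prodr_const card_ord -powR_mulrn ?powR_ge0// -powRrM.
    by rewrite mulNr /p divfK// gt_eqF.
  apply: ler_prod => i _; rewrite powR_ge0 !powRN lef_pV2 ?posrE ?powR_gt0 ?ltr_pwDl ?enorm_ge0//=.
  apply: ge0_ler_powR; rewrite ?nnegrE ?addr_ge0 ?enorm_ge0 ?(ltW (lt_trans ltr01 p1))//.
  by rewrite lerD2l coord_le_enorm.
- have mp : measurable_fun setT (fun v : 'rV[R]_n => \prod_i (1 + `|v ord0 i|) `^ (- p)).
    exact: (@measurable_prod_rV n (fun _ x => (1 + `|x|) `^ (- p)) (fun _ => measurable_decay _)).
  apply/integrableP; split; first exact/measurable_EFinP.
  under eq_integral => v _.
    rewrite /= ger0_norm; last by apply: prodr_ge0 => i _; exact: powR_ge0.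
    over.
  rewrite (@integral_rV_prod n (fun _ x => (1 + `|x|) `^ (- p))
    (fun=> \int[leb]_x (1 + `|x|) `^ (- p)))//.
  + by rewrite ltry.
  + by move=> _; exact: measurable_decay.
  + by move=> _; rewrite -EFin_Rintegral//; exact: integrable_decay.
Qed.

(** A coordinatewise version of Cauchy-Schwarz; the factor [n] only affects constants. *)
Lemma inner_norm_le n (u v : 'rV[R]_n) : `|inner u v| <= n%:R * enorm u * enorm v.
Proof.
rewrite (le_trans (ler_norm_sum _ _ _))//.
have -> : n%:R * enorm u * enorm v = \sum_(i < n) enorm u * enorm v.
  by rewrite sumr_const card_ord -mulrA mulr_natl.
by apply: ler_sum => i _; rewrite normrM ler_pM ?coord_le_enorm.
Qed.

End lebesgue_rV_integral.

(** * Fourier inversion *)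

Section trigonometric_bounds.
Context (R : realType).
Implicit Types f df : R -> R.

(** The engine for the Taylor inequalities below: each expression has the previous one as its
    derivative and vanishes at 0, so positivity climbs one degree at a time. *)
Lemma derive_ge0_ge0 f df : (forall x : R, is_derive x 1 f (df x)) -> f 0 = 0 ->
  (forall x, 0 <= x -> 0 <= df x) -> forall x, 0 <= x -> 0 <= f x.
Proof.
move=> f' f0 df0 x; rewrite le_eqVlt => /predU1P[<-|x0]; first by rewrite f0.
have cf : {within `[0, x], continuous f}.
  apply: continuous_subspaceT => y; apply: differentiable_continuous.
  by apply/derivable1_diffP; case: (f' y).
have [c] := MVT x0 (fun y _ => f' y) cf.
rewrite in_itv/= => /andP[c0 _]; rewrite f0 !subr0 => ->.
by rewrite mulr_ge0 ?df0 ?ltW.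
Qed.

Lemma derive_le1_lipschitz f df : (forall x : R, is_derive x 1 f (df x)) ->
  (forall x, `|df x| <= 1) -> forall a b, `|f a - f b| <= `|a - b|.
Proof.
move=> f' df1; have cf a b : {within `[a, b], continuous f}.
  apply: continuous_subspaceT => y; apply: differentiable_continuous.
  by apply/derivable1_diffP; case: (f' y).
have key a b : a <= b -> `|f b - f a| <= `|b - a|.
  move=> ab; have [c _ ->] := MVT_segment ab (fun y _ => f' y) (cf a b).
  by rewrite normrM ler_piMl.
move=> a b; case/orP: (le_total a b) => [ab|ba]; last exact: key.
by rewrite distrC [leRHS]distrC; exact: key.
Qed.

Lemma cos_lipschitz (a b : R) : `|cos a - cos b| <= `|a - b|.
Proof.
apply: (derive_le1_lipschitz (@is_derive_cos R)) => x.
by rewrite normrN; exact: norm_sin_le1.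
Qed.

Lemma sin_lipschitz (a b : R) : `|sin a - sin b| <= `|a - b|.
Proof. by apply: (derive_le1_lipschitz (@is_derive_sin R)); exact: norm_cos_le1. Qed.

Lemma sin_le_id (x : R) : 0 <= x -> 0 <= x - sin x.
Proof.
apply: (@derive_ge0_ge0 (fun x => x - sin x) (fun x => 1 - cos x)); last 2 first.
- by rewrite sin0 subr0.
- by move=> y _; rewrite subr_ge0 cos_le1.
Qed.

Lemma cos_ge_quad (x : R) : 0 <= x -> 0 <= cos x - 1 + x ^+ 2 / 2.
Proof.
apply: (@derive_ge0_ge0 (fun x => cos x - 1 + x ^+ 2 / 2) (fun x => x - sin x)); last 2 first.
- by rewrite cos0 expr0n/= mul0r addr0 subrr.
- exact: sin_le_id.
by move=> y; apply: is_derive_eq; rewrite /GRing.scale/=; field.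
Qed.

Lemma sin_ge_cubic (x : R) : 0 <= x -> 0 <= x ^+ 3 / 6 - (x - sin x).
Proof.
apply: (@derive_ge0_ge0 (fun x => x ^+ 3 / 6 - (x - sin x)) (fun x => cos x - 1 + x ^+ 2 / 2)); last 2 first.
- by rewrite sin0 expr0n/= mul0r !subr0.
- exact: cos_ge_quad.
by move=> y; apply: is_derive_eq; rewrite /GRing.scale/=; field.
Qed.

Lemma cos_ge_lin (x : R) : 0 <= x -> 0 <= x - (1 - cos x).
Proof.
apply: (@derive_ge0_ge0 (fun x => x - (1 - cos x)) (fun x => 1 - sin x)); last 2 first.
- by rewrite cos0 !subrr.
- by move=> y _; rewrite subr_ge0 sin_le1.
by move=> y; apply: is_derive_eq; rewrite /GRing.scale/=; field.
Qed.

Lemma sin_ge_quad (x : R) : 0 <= x -> 0 <= x ^+ 2 / 2 - (x - sin x).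
Proof.
apply: (@derive_ge0_ge0 (fun x => x ^+ 2 / 2 - (x - sin x)) (fun x => x - (1 - cos x))); last 2 first.
- by rewrite sin0 expr0n/= mul0r !subr0.
- exact: cos_ge_lin.
by move=> y; apply: is_derive_eq; rewrite /GRing.scale/=; field.
Qed.

Lemma cos_le_cubic (x : R) : 0 <= x -> 0 <= x ^+ 3 / 6 - (cos x - 1 + x ^+ 2 / 2).
Proof.
apply: (@derive_ge0_ge0 (fun x => x ^+ 3 / 6 - (cos x - 1 + x ^+ 2 / 2)) (fun x => x ^+ 2 / 2 - (x - sin x))); last 2 first.
- by rewrite cos0 !expr0n/= !mul0r subrr addr0 subrr.
- exact: sin_ge_quad.
by move=> y; apply: is_derive_eq; rewrite /GRing.scale/=; field.
Qed.

Lemma norm_cos_taylor (x : R) : `|cos x - 1 + x ^+ 2 / 2| <= `|x| ^+ 3.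
Proof.
have key (y : R) : 0 <= y -> `|cos y - 1 + y ^+ 2 / 2| <= y ^+ 3.
  move=> y0; have := cos_ge_quad y0; have := cos_le_cubic y0.
  have := exprn_ge0 3 y0; move=> ? ? ?; rewrite ger0_norm; lra.
case/orP: (le_total 0 x) => x0; first by rewrite (ger0_norm x0); exact: key.
by rewrite (ler0_norm x0); have := key (- x); rewrite cosN sqrrN oppr_ge0 x0; exact.
Qed.

Lemma norm_sin_taylor (x : R) : `|sin x - x| <= `|x| ^+ 3.
Proof.
have key (y : R) : 0 <= y -> `|sin y - y| <= y ^+ 3.
  move=> y0; have := sin_le_id y0; have := sin_ge_cubic y0.
  have := exprn_ge0 3 y0; move=> ? ? ?; rewrite distrC ger0_norm; lra.
case/orP: (le_total 0 x) => x0; first by rewrite (ger0_norm x0); exact: key.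
rewrite (ler0_norm x0); have := key (- x); rewrite sinN -opprD normrN oppr_ge0 x0; exact.
Qed.

End trigonometric_bounds.

Section gaussian_fourier.
Context (R : realType).

Lemma normal_peakM_inv (s : R) : 0 < s ->
  normal_peak s * normal_peak s^-1 = (2 * pi)^-1.
Proof.
move=> s0; rewrite /normal_peak -invfM -sqrtrM; last first.
  by rewrite mulrn_wge0// mulr_ge0 ?pi_ge0// sqr_ge0.
have -> : s ^+ 2 * pi *+ 2 * (s^-1 ^+ 2 * pi *+ 2) = (2 * pi) ^+ 2.
  by field; rewrite gt_eqF.
by rewrite sqrtr_sqr ger0_norm ?mulr_ge0 ?pi_ge0.
Qed.

Context (d : nat).
Implicit Types u v w y : 'rV[R]_d.
Local Notation leb := (lebesgue_rV R d).

(** The characteristic function of the Gaussian of variance [s^2]: smoothing a law by that Gaussian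
    multiplies by this factor on the Fourier side. *)
Definition damp (s : R) u := expR (- (s ^+ 2 * enorm u ^+ 2 / 2)).

Lemma damp_ge0 s u : 0 <= damp s u. Proof. exact: expR_ge0. Qed.

Lemma damp_le1 s u : damp s u <= 1.
Proof. by rewrite -expR0 ler_expR oppr_le0; apply: divr_ge0 => //; exact: mulr_ge0 (sqr_ge0 _) (sqr_ge0 _). Qed.

Lemma cvg_damp u : damp n.+1%:R^-1 u @[n --> \oo] --> (1 : R).
Proof.
have d0 : derivable (fun s : R => expR (- (s ^+ 2 * enorm u ^+ 2 / 2))) 0 1 by [].
have /derivable1_diffP/differentiable_continuous c0 := d0.
have := cvg_comp harmonic _ cvg_harmonic c0.
by rewrite expr0n/= !mul0r oppr0 expR0.
Qed.

Lemma measurable_damp s : measurable_fun setT (damp s).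
Proof.
apply: (measurableT_comp (@measurable_expR R)).
apply: (@measurableT_comp _ _ _ _ _ _ (fun x : R => - (s ^+ 2 * x ^+ 2 / 2))).
  apply: measurableT_comp => //; apply: measurable_funM => //.
  by apply: measurable_funM => //; exact: measurable_funX.
exact: measurable_enorm.
Qed.

Lemma dampE s u : 0 < s ->
  damp s u = (normal_peak s^-1 ^+ d)^-1 * gauss_rV s^-1 u.
Proof.
move=> s0; have si0 : s^-1 != 0 by rewrite invr_neq0// gt_eqF.
rewrite gauss_rVE// mulKf ?expf_neq0 ?gt_eqF ?normal_peak_gt0//; congr (expR (- _)).
by field; rewrite gt_eqF.
Qed.

Lemma integrable_damp s : 0 < s -> leb.-integrable setT (EFin \o damp s).
Proof.
move=> s0; rewrite /comp; under eq_fun do rewrite dampE// EFinM.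
apply: integrableZl => //; apply: integrable_gauss_rV.
by rewrite invr_neq0// gt_eqF.
Qed.

Lemma measurable_cos_inner0 y : measurable_fun setT (fun u => cos (inner u y)).
Proof.
apply: (measurableT_comp (continuous_measurable_fun (@continuous_cos R))).
exact: measurable_inner.
Qed.

(** Fourier inversion for the Gaussian, available by direct computation: [damp s] is a multiple of
    the Gaussian density of deviation [1 / s], whose cosine transform is already known. *)
Lemma gauss_rV_fourier s y : 0 < s ->
  gauss_rV s y = ((2 * pi)^-1) ^+ d * \int[leb]_u (damp s u * cos (inner u y)).
Proof.
move=> s0; have si0 : 0 < s^-1 by rewrite invr_gt0.
have := integral_gauss_rV_cos 0 y si0; under eq_Rintegral do rewrite add0r.
rewrite cos0 mul1r => h.
under eq_Rintegral do rewrite dampE// -mulrA.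
rewrite RintegralZl//; last first.
  apply: integrable_gauss_rVM; first by rewrite gt_eqF.
    exact: measurable_cos_inner0.
  by move=> u; exact: norm_cos_le1.
rewrite h gauss_rVE ?gt_eqF// mulrA -(normal_peakM_inv s0) exprMn mulfK; last first.
  by rewrite expf_neq0// gt_eqF// normal_peak_gt0// gt_eqF.
by congr (_ * expR (- _)); field; rewrite gt_eqF.
Qed.

Lemma innerBr u v w : inner u (v - w) = inner u v - inner u w :> R.
Proof. by rewrite /inner -sumrB; apply: eq_bigr => i _; rewrite !mxE mulrBr. Qed.

Lemma enormN y : enorm (- y) = enorm y.
Proof.
rewrite /enorm (_ : inner (- y) (- y) = inner y y)//.
by apply: eq_bigr => i _; rewrite !mxE mulrNN.
Qed.

Lemma gauss_rVN s y : s != 0 -> gauss_rV s (- y) = gauss_rV s y.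
Proof. by move=> s0; rewrite !gauss_rVE// enormN. Qed.

End gaussian_fourier.

Lemma Rintegral_probability_cst d1 (T1 : measurableType d1) (R : realType)
    (P : probability T1 R) (r : R) : \int[P]_t r = r.
Proof. by rewrite /Rintegral integral_cst//= probability_setT mule1. Qed.

(** Adding 1 makes the integrand nonnegative, so that Tonelli supplies the measurability; the added
    constant is then subtracted. *)
Lemma measurable_Rintegral_bounded d1 d2 (T1 : measurableType d1)
    (T2 : measurableType d2) (R : realType)
    (P : probability T2 R) (h : T1 * T2 -> R) :
  measurable_fun setT h -> (forall z, `|h z| <= 1) ->
  measurable_fun setT (fun x => \int[P]_y h (x, y)).
Proof.
move=> mh h1.
have hx x : P.-integrable setT (fun y => (h (x, y))%:E).
  apply: (@integrable_dominated _ _ _ P (fun y => h (x, y)) (cst 1)) => //.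
    exact: measurableT_comp.
  exact: finite_measure_integrable_cst.
pose h' z := (h z + 1)%:E.
have mF : measurable_fun setT (fun x => \int[P]_y h' (x, y))%E.
  apply: (@measurable_fun_fubini_tonelli_F _ _ _ _ _ P h').
    by apply/measurable_EFinP; exact: measurable_funD.
  by move=> z; rewrite lee_fin; have := h1 z; rewrite ler_norml; lra.
rewrite (_ : (fun x => _) = (fun x => fine (\int[P]_y h' (x, y))%E - 1)).
  apply: measurable_funB => //; exact: measurableT_comp.
apply/funext => x.
rewrite -/(Rintegral P setT (fun y => h (x, y) + 1)) RintegralD//.
  by rewrite Rintegral_probability_cst addrK.
  exact: hx.
exact: finite_measure_integrable_cst.
Qed.

(** * Gaussian smoothing and the inverse Fourier integral *)

Section inversion.
Context (R : realType) (d : nat) disp (T : measurableType disp)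
  (P : probability T R) (X : T -> 'rV[R]_d) (G : 'rV[R]_d -> R).
Hypothesis mX : measurable_fun setT X.
Local Notation leb := (lebesgue_rV R d).

Definition char_cos u := \int[P]_t cos (inner u (X t)).
Definition char_sin u := \int[P]_t sin (inner u (X t)).

(* [Re (exp (- i <u, x>) * phi_X u)] *)
Definition char_at (x u : 'rV[R]_d) :=
  cos (inner u x) * char_cos u + sin (inner u x) * char_sin u.

Definition inversion_pdf x := ((2 * pi)^-1) ^+ d * \int[leb]_u char_at x u.

Lemma measurable_inner_fun d' (T' : measurableType d') (U V : T' -> 'rV[R]_d) :
  measurable_fun setT U -> measurable_fun setT V ->
  measurable_fun setT (fun z => inner (U z) (V z)).
Proof.
move=> mU mV; apply: measurable_sum => i.
by apply: measurable_funM; [exact: (measurable_fun_rVP U).1|exact: (measurable_fun_rVP V).1].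
Qed.

Lemma integrable_cos a u : P.-integrable setT (fun t => (cos (a + inner u (X t)))%:E).
Proof.
apply: (@integrable_dominated _ _ _ P (fun t => cos (a + inner u (X t))) (cst 1)).
- apply: (measurableT_comp (continuous_measurable_fun (@continuous_cos R))).
  by apply: measurable_funD => //; exact: measurable_inner_fun.
- by move=> t; exact: norm_cos_le1.
- exact: finite_measure_integrable_cst.
Qed.

Lemma integrable_sin a u : P.-integrable setT (fun t => (sin (a + inner u (X t)))%:E).
Proof.
apply: (@integrable_dominated _ _ _ P (fun t => sin (a + inner u (X t))) (cst 1)).
- apply: (measurableT_comp (continuous_measurable_fun (@continuous_sin R))).
  by apply: measurable_funD => //; exact: measurable_inner_fun.
- by move=> t; exact: norm_sin_le1.
- exact: finite_measure_integrable_cst.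
Qed.

Lemma integrable_cos0 u : P.-integrable setT (fun t => (cos (inner u (X t)))%:E).
Proof. by have := integrable_cos 0 u; under eq_fun do rewrite add0r. Qed.

Lemma integrable_sin0 u : P.-integrable setT (fun t => (sin (inner u (X t)))%:E).
Proof. by have := integrable_sin 0 u; under eq_fun do rewrite add0r. Qed.

Lemma char_atE x u : \int[P]_t cos (inner u (X t) - inner u x) = char_at x u.
Proof.
under eq_Rintegral do rewrite cosB.
rewrite RintegralD//=.
- rewrite !RintegralZr ?[in RHS]mulrC//; last 2 first.
  + exact: integrable_sin0.
  + exact: integrable_cos0.
  by rewrite /char_at mulrC [in X in _ + X]mulrC.
- have := integrableZr measurableT (cos (inner u x)) (integrable_cos0 u).
  by under eq_fun do rewrite /= -EFinM.
- have := integrableZr measurableT (sin (inner u x)) (integrable_sin0 u).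
  by under eq_fun do rewrite /= -EFinM.
Qed.

Lemma measurable_char_cos : measurable_fun setT char_cos.
Proof.
apply: (@measurable_Rintegral_bounded _ _ _ _ _ P (fun z => cos (inner z.1 (X z.2)))).
- apply: (measurableT_comp (continuous_measurable_fun (@continuous_cos R))).
  by apply: measurable_inner_fun => //; exact: measurableT_comp.
- by move=> z; exact: norm_cos_le1.
Qed.

Lemma measurable_char_sin : measurable_fun setT char_sin.
Proof.
apply: (@measurable_Rintegral_bounded _ _ _ _ _ P (fun z => sin (inner z.1 (X z.2)))).
- apply: (measurableT_comp (continuous_measurable_fun (@continuous_sin R))).
  by apply: measurable_inner_fun => //; exact: measurableT_comp.
- by move=> z; exact: norm_sin_le1.
Qed.

Lemma measurable_char_at : measurable_fun setT (fun z : 'rV[R]_d * 'rV[R]_d => char_at z.1 z.2).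
Proof.
have mi : measurable_fun setT (fun z : 'rV[R]_d * 'rV[R]_d => inner z.2 z.1).
  by apply: measurable_inner_fun.
apply: measurable_funD; apply: measurable_funM.
- exact: (measurableT_comp (continuous_measurable_fun (@continuous_cos R))).
- exact: (measurableT_comp measurable_char_cos).
- exact: (measurableT_comp (continuous_measurable_fun (@continuous_sin R))).
- exact: (measurableT_comp measurable_char_sin).
Qed.

Hypothesis iG : leb.-integrable setT (EFin \o G).
Hypothesis char_cos_le : forall u, `|char_cos u| <= G u.
Hypothesis char_sin_le : forall u, `|char_sin u| <= G u.

Let G_ge0 u : 0 <= G u. Proof. exact: le_trans (char_cos_le u). Qed.

Lemma char_at_le x u : `|char_at x u| <= 2 * G u.
Proof.
rewrite mulrDl !mul1r (le_trans (ler_normD _ _))// !normrM lerD//.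
  by rewrite -[leRHS]mul1r ler_pM// norm_cos_le1.
by rewrite -[leRHS]mul1r ler_pM// norm_sin_le1.
Qed.

Let i2G : leb.-integrable setT (fun u => (2 * G u)%:E).
Proof. by under eq_fun do rewrite EFinM; exact: integrableZl. Qed.

Lemma measurable_char_at1 x : measurable_fun setT (char_at x).
Proof. by have := measurableT_comp measurable_char_at (measurable_pair1 x). Qed.

Lemma integrable_char_at x : leb.-integrable setT (EFin \o char_at x).
Proof.
exact: (integrable_dominated (measurable_char_at1 x) (char_at_le x) i2G).
Qed.

Let K := ((2 * pi)^-1) ^+ d : R.
Let K_ge0 : 0 <= K.
Proof. by rewrite exprn_ge0// invr_ge0 mulr_ge0 ?pi_ge0. Qed.

(** The density at [x] of the sum of [X] and an independent centered Gaussian of variance [s^2]. *)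
Let smooth s x := \int[P]_t gauss_rV s (X t - x).

(** Insert the Fourier formula of the Gaussian and exchange the integrals. The exchange is
    legitimate because the integrand is bounded by [damp s], integrable in [u] and constant in
    [t]. *)
Let smoothE s x : 0 < s ->
  smooth s x = K * \int[leb]_u (damp s u * char_at x u).
Proof.
move=> s0; rewrite /smooth.
under eq_Rintegral => t _.
  rewrite gauss_rV_fourier//.
  under eq_Rintegral do rewrite innerBr.
  over.
pose f (z : T * 'rV[R]_d) := damp s z.2 * cos (inner z.2 (X z.1) - inner z.2 x).
have mf : measurable_fun setT f.
  apply: measurable_funM; first exact: (measurableT_comp (measurable_damp s)).
  apply: (measurableT_comp (continuous_measurable_fun (@continuous_cos R))).
  apply: measurable_funB; last first.
    by apply: (measurableT_comp (measurable_inner x)).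
  by apply: measurable_inner_fun => //; exact: measurableT_comp.
have fle z : `|f z| <= damp s z.2.
  by rewrite normrM ger0_norm ?damp_ge0// ler_piMr ?damp_ge0 ?norm_cos_le1.
have i2 t : leb.-integrable setT (fun u => (f (t, u))%:E).
  apply: (@integrable_dominated _ _ _ leb (fun u => f (t, u)) (damp s)).
  - exact: measurableT_comp.
  - by move=> u; exact: (fle (t, u)).
  - exact: integrable_damp.
have i1 u : P.-integrable setT (fun t => (f (t, u))%:E).
  apply: (@integrable_dominated _ _ _ P (fun t => f (t, u)) (cst (damp s u))).
  - exact: measurableT_comp.
  - by move=> t; exact: (fle (t, u)).
  - exact: finite_measure_integrable_cst.
have i12 : (P \x leb)%E.-integrable setT (EFin \o f).
  apply/integrable12ltyP; first exact/measurable_EFinP.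
  apply: (@le_lt_trans _ _ (\int[P]_t (\int[leb]_u damp s u)%:E)%E).
    apply: ge0_le_integral => //.
    - by move=> t _; apply: integral_ge0.
    - apply: (@measurable_fun_fubini_tonelli_F _ _ _ _ _ leb (abse \o (EFin \o f))) => //.
        by apply: measurableT_comp => //; exact/measurable_EFinP.
      by move=> z; exact: abse_ge0.
    - move=> t _. rewrite EFin_Rintegral; last exact: integrable_damp.
      apply: ge0_le_integral => //.
      + by apply/measurable_EFinP; apply: measurableT_comp => //; exact: measurableT_comp.
      + by apply/measurable_EFinP; exact: measurable_damp.
      + by move=> u _; rewrite lee_fin; exact: (fle (t, u)).
  by rewrite integral_cst//= probability_setT mule1 ltry.
rewrite RintegralZl//; last first.
  rewrite (_ : (EFin \o _) = (fun t => \int[leb]_u (f (t, u))%:E)%E).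
    exact: (integrable_fubini_F i12).
  by apply/funext => t; rewrite -(EFin_Rintegral (i2 t)).
congr (_ * _); rewrite (Rintegral_Fubini i12 i2 i1).
apply: eq_Rintegral => u _.
under eq_Rintegral do rewrite /f /=.
rewrite RintegralZl//; first by rewrite char_atE.
by have := integrable_cos (- inner u x) u; under eq_fun do rewrite addrC.
Qed.

Let smooth_cvg x : smooth n.+1%:R^-1 x @[n --> \oo] --> inversion_pdf x.
Proof.
have -> : (fun n => smooth n.+1%:R^-1 x) =
    (fun n => K * \int[leb]_u (damp n.+1%:R^-1 u * char_at x u)).
  by apply/funext => n; rewrite smoothE.
apply: cvgMl_tmp; apply: (Rintegral_dominated_cvg _ _ i2G).
- move=> n; apply: measurable_funM; [exact: measurable_damp|exact: measurable_char_at1].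
- by move=> u; rewrite -[char_at x u in X in _ --> X]mul1r; apply: cvgMr_tmp; exact: cvg_damp.
- move=> n u; rewrite normrM ger0_norm ?damp_ge0//.
  by rewrite (le_trans _ (char_at_le x u))// ler_piMl// damp_le1.
Qed.

(** The Fourier integral shows no sign; positivity is inherited from the smoothed densities, of
    which it is the limit. *)
Lemma inversion_pdf_ge0 x : 0 <= inversion_pdf x.
Proof.
rewrite -(cvg_lim _ (@smooth_cvg x))//; apply: limr_ge.
  by apply/cvg_ex; eexists; exact: smooth_cvg.
by apply: nearW => n; apply: Rintegral_ge0 => t _; exact: gauss_rV_ge0.
Qed.

Lemma inversion_pdf_le x : inversion_pdf x <= K * \int[leb]_u (2 * G u).
Proof.
rewrite ler_wpM2l//; apply: le_Rintegral => //; first exact: integrable_char_at.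
by move=> u _; rewrite (le_trans (ler_norm _))// char_at_le.
Qed.

Let smooth_le s x : 0 < s -> `|smooth s x| <= K * \int[leb]_u (2 * G u).
Proof.
move=> s0; rewrite smoothE// normrM ger0_norm// ler_wpM2l//.
have le u : `|damp s u * char_at x u| <= 2 * G u.
  rewrite normrM ger0_norm ?damp_ge0//.
  by rewrite (le_trans _ (char_at_le x u))// ler_piMl// damp_le1.
have int : leb.-integrable setT (fun u => (damp s u * char_at x u)%:E).
  apply: (@integrable_dominated _ _ _ leb (fun u => damp s u * char_at x u) _ _ le) => //.
  by apply: measurable_funM; [exact: measurable_damp|exact: measurable_char_at1].
rewrite (le_trans (le_normr_Rintegral _ _))//.
by apply: le_Rintegral => //; exact: integrable_norm.
Qed.

(** The Lipschitz bound alone would leave [|u| * G u], which may fail to be integrable. Capping it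
    by 2 keeps a multiple of [G] as majorant. *)
Lemma char_at_dist x y u :
  `|char_at x u - char_at y u| <= 2 * Num.min 2 `|inner u (x - y)| * G u.
Proof.
have cosd (a b : R) : `|cos a - cos b| <= Num.min 2 `|a - b|.
  rewrite le_min cos_lipschitz andbT (le_trans (ler_normB _ _))//.
  by rewrite -[leRHS]/(1 + 1) lerD// norm_cos_le1.
have sind (a b : R) : `|sin a - sin b| <= Num.min 2 `|a - b|.
  rewrite le_min sin_lipschitz andbT (le_trans (ler_normB _ _))//.
  by rewrite -[leRHS]/(1 + 1) lerD// norm_sin_le1.
have -> : char_at x u - char_at y u =
    (cos (inner u x) - cos (inner u y)) * char_cos u +
    (sin (inner u x) - sin (inner u y)) * char_sin u.
  by rewrite /char_at; ring.
rewrite (le_trans (ler_normD _ _))// !normrM -mulrA mulrDl mul1r innerBr.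
by rewrite lerD// ler_pM.
Qed.

(** Up to the factor [K], a modulus of continuity of [inversion_pdf] for points whose coordinates
    differ by less than [1 / (n+1)]. Dominated convergence makes it tend to 0. *)
Let modulus (n : nat) := \int[leb]_u (2 * Num.min 2 (d%:R * enorm u * n.+1%:R^-1) * G u).

Let measurable_modulus n : measurable_fun setT
  (fun u : 'rV[R]_d => 2 * Num.min 2 (d%:R * enorm u * n.+1%:R^-1) * G u).
Proof.
have /integrableP[/measurable_EFinP mG _] := iG.
apply: measurable_funM => //; apply: measurable_funM => //.
apply: measurable_minr => //; apply: measurable_funM => //; apply: measurable_funM => //.
exact: measurable_enorm.
Qed.

Let modulus_le n u : `|2 * Num.min 2 (d%:R * enorm u * n.+1%:R^-1) * G u| <= 2 * (2 * G u).
Proof.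
have m0 : 0 <= Num.min 2 (d%:R * enorm u * n.+1%:R^-1).
  by rewrite le_min ler0n/= mulr_ge0// mulr_ge0// enorm_ge0.
rewrite ger0_norm ?mulr_ge0// -mulrA ler_wpM2l// ler_wpM2r//.
by rewrite ge_min lexx.
Qed.

Let i4G : leb.-integrable setT (fun u => (2 * (2 * G u))%:E).
Proof. by under eq_fun do rewrite EFinM; exact: integrableZl. Qed.

Let modulus_cvg : modulus n @[n --> \oo] --> 0.
Proof.
have -> : 0 = \int[leb]_u (0 : R) :> R by rewrite /Rintegral integral0.
apply: (Rintegral_dominated_cvg measurable_modulus _ i4G modulus_le).
move=> u; rewrite -[0 in X in _ --> X](mul0r (G u)); apply: cvgMr_tmp.
rewrite -[0 in X in _ --> X](mulr0 2); apply: cvgMl_tmp.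
apply: (@squeeze_cvgr _ _ _ _ (cst 0) (fun n => d%:R * enorm u * n.+1%:R^-1)).
- apply: nearW => n; rewrite ge_min lexx orbT andbT le_min ler0n/=.
  by rewrite mulr_ge0// mulr_ge0// enorm_ge0.
- exact: cvg_cst.
- rewrite -[X in _ --> X](mulr0 (d%:R * enorm u)).
  by apply: cvgMl_tmp; exact: cvg_harmonic.
Qed.

Lemma continuous_inversion_pdf : continuous inversion_pdf.
Proof.
move=> x; apply/(@cvgrPdist_lt _ _ _ (nbhs x) (nbhs_filter x)) => e e0.
(* Dividing by [K + 1] needs only [K >= 0]. *)
have K1 : 0 < K + 1 by rewrite ltr_wpDl.
have /cvgrPdist_lt/(_ (e / (K + 1))) := modulus_cvg.
rewrite divr_gt0// => /(_ isT)[n _ /(_ n (leqnn n))].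
rewrite sub0r normrN => /(le_lt_trans (ler_norm _)) mn.
apply/nbhs_ballP; exists n.+1%:R^-1 => /=; first by rewrite invr_gt0.
move=> y [_ xy].
rewrite /inversion_pdf -mulrBr -RintegralB//; last 2 first.
  exact: integrable_char_at.
  exact: integrable_char_at.
rewrite normrM (ger0_norm K_ge0).
rewrite (@le_lt_trans _ _ (K * modulus n))//; last first.
  rewrite (@le_lt_trans _ _ (K * (e / (K + 1))))//; first by rewrite ler_wpM2l// ltW.
  by rewrite mulrCA gtr_pMr// ltr_pdivrMr// mul1r ltrDl.
rewrite ler_wpM2l//.
have iB := integrableB measurableT (integrable_char_at x) (integrable_char_at y).
rewrite (le_trans (le_normr_Rintegral _ _))//.
apply: le_Rintegral => //.
- exact: integrable_norm.
- exact: (integrable_dominated (measurable_modulus n) (modulus_le n) i4G).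
move=> u _; rewrite (le_trans (char_at_dist x y u))//.
rewrite ler_wpM2r// ler_wpM2l// le_min2//.
rewrite (le_trans (ler_norm_sum _ _ _))//.
have -> : d%:R * enorm u * n.+1%:R^-1 = \sum_(i < d) enorm u * n.+1%:R^-1.
  by rewrite sumr_const card_ord -mulrA mulr_natl.
apply: ler_sum => i _; rewrite normrM ler_pM ?coord_le_enorm//.
by rewrite !mxE ltW//; exact: xy.
Qed.

(** Measurability for the coordinate sigma-algebra is taken from Tonelli, after adding [2 * G] to
    make the integrand nonnegative. *)
Lemma measurable_inversion_pdf : measurable_fun setT inversion_pdf.
Proof.
apply: measurable_funM => //.
have iGx x : leb.-integrable setT (fun u => (char_at x u + 2 * G u)%:E).
  exact: (integrableD measurableT (integrable_char_at x) i2G).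
have /integrableP[/measurable_EFinP mG _] := iG.
rewrite (_ : (fun x => _) = (fun x => fine (\int[leb]_u (char_at x u + 2 * G u)%:E)%E -
    \int[leb]_u (2 * G u))); last first.
  apply/funext => x; rewrite -[fine _]/(\int[leb]_u (char_at x u + 2 * G u)).
  rewrite [in RHS]RintegralD ?addrK//.
  exact: integrable_char_at.
apply: measurable_funB => //; apply: measurableT_comp => //.
apply: (@measurable_fun_fubini_tonelli_F _ _ _ _ _ leb
  (fun z : 'rV[R]_d * 'rV[R]_d => (char_at z.1 z.2 + 2 * G z.2)%:E)).
  apply/measurable_EFinP; apply: measurable_funD; first exact: measurable_char_at.
  by apply: measurable_funM => //; exact: measurableT_comp.
move=> z; rewrite lee_fin; have := char_at_le z.1 z.2; rewrite ler_norml; lra.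
Qed.

Let measurable_gauss_shift s :
  measurable_fun setT (fun z : 'rV[R]_d * 'rV[R]_d => gauss_rV s (z.1 - z.2)).
Proof.
apply: (measurableT_comp (@measurable_gauss_rV R s d)).
apply/measurable_fun_rVP => i.
rewrite (_ : (fun t => _) = (fun z : 'rV[R]_d * 'rV[R]_d => z.1 ord0 i - z.2 ord0 i)).
  apply: measurable_funB.
    exact: (measurableT_comp (measurable_coord_rV i)).
  exact: (measurableT_comp (measurable_coord_rV i)).
by apply/funext => z; rewrite !mxE.
Qed.

Let gauss_rV_sym s (x y : 'rV[R]_d) : s != 0 -> gauss_rV s (x - y) = gauss_rV s (y - x).
Proof. by move=> s0; rewrite -gauss_rVN// opprB. Qed.

Let integrable_gauss_shift s y : s != 0 ->
  leb.-integrable setT (fun x => (gauss_rV s (x - y))%:E).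
Proof.
move=> s0; apply/integrableP; split.
  apply/measurable_EFinP.
  by have := measurableT_comp (measurable_gauss_shift s) (measurable_pair2 y).
under eq_integral do rewrite /= ger0_norm ?gauss_rV_ge0//.
by rewrite integral_gauss_rVB// ltry.
Qed.

Section lipschitz_test.
Variables (h : 'rV[R]_d -> R) (L : R).
Hypothesis mh : measurable_fun setT h.
Hypothesis h_ge0 : forall x, 0 <= h x.
Hypothesis h_le1 : forall x, h x <= 1.
Hypothesis ih : leb.-integrable setT (EFin \o h).
Hypothesis L_ge0 : 0 <= L.
Hypothesis hL : forall x y, `|h x - h y| <= L * enorm (x - y).

Let hg_int s y : s != 0 -> leb.-integrable setT (fun x => (h x * gauss_rV s (x - y))%:E).
Proof.
move=> s0; apply: (@integrable_dominated _ _ _ leb (fun x => h x * gauss_rV s (x - y))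
  (fun x => gauss_rV s (x - y))); last exact: integrable_gauss_shift.
  apply: measurable_funM => //.
  by have := measurableT_comp (measurable_gauss_shift s) (measurable_pair2 y).
by move=> x; rewrite ger0_norm ?mulr_ge0 ?gauss_rV_ge0// ler_piMl ?gauss_rV_ge0.
Qed.

(** Averaging an [L]-Lipschitz function against a Gaussian moves its value by at most [L] times the
    mean norm, which [enorm_gauss_rV_le] bounds by a multiple of [s]. The rate is uniform in [y]. *)
Let test_approx s y : 0 < s ->
  `|\int[leb]_x (h x * gauss_rV s (x - y)) - h y| <= L * (4 * Num.sqrt 2 ^+ d) * s.
Proof.
move=> s0; have sn0 := lt0r_neq0 s0.
have r0 : 0 < Num.sqrt 2 * s by rewrite mulr_gt0// sqrtr_gt0.
have -> : h y = \int[leb]_x (h y * gauss_rV s (x - y)).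
  rewrite RintegralZl//; last exact: integrable_gauss_shift.
  by rewrite /Rintegral integral_gauss_rVB// mulr1.
have ihy : leb.-integrable setT (fun x => (h y * gauss_rV s (x - y))%:E).
  under eq_fun do rewrite EFinM; apply: integrableZl => //.
  exact: integrable_gauss_shift.
rewrite -RintegralB//; last exact: hg_int.
have iB := integrableB measurableT (hg_int y sn0) ihy.
rewrite (le_trans (le_normr_Rintegral _ _))//.
have iR : leb.-integrable setT
    (fun x => (L * (4 * Num.sqrt 2 ^+ d) * s * gauss_rV (Num.sqrt 2 * s) (x - y))%:E).
  under eq_fun do rewrite EFinM; apply: integrableZl => //.
  by apply: integrable_gauss_shift; rewrite gt_eqF.
rewrite (@le_trans _ _ (\int[leb]_x (L * (4 * Num.sqrt 2 ^+ d) * s *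
    gauss_rV (Num.sqrt 2 * s) (x - y))))//.
  apply: le_Rintegral => //; first exact: integrable_norm.
  move=> x _; rewrite -mulrBl normrM (ger0_norm (gauss_rV_ge0 _ _)).
  rewrite (@le_trans _ _ (L * enorm (x - y) * gauss_rV s (x - y)))//.
    by rewrite ler_wpM2r// gauss_rV_ge0.
  by rewrite -!mulrA ler_wpM2l// !mulrA enorm_gauss_rV_le.
rewrite RintegralZl//; last by apply: integrable_gauss_shift; rewrite gt_eqF.
by rewrite [X in _ * X]/Rintegral integral_gauss_rVB ?mulr1// gt_eqF.
Qed.

Let measurable_gauss_X s :
  measurable_fun setT (fun z : 'rV[R]_d * T => gauss_rV s (X z.2 - z.1)).
Proof.
apply: (measurableT_comp (measurable_gauss_shift s) (g := fun z => (X z.2, z.1))).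
by apply: measurable_fun_pair => //; exact: (measurableT_comp mX).
Qed.

Let measurable_smooth s : measurable_fun setT (smooth s).
Proof.
apply: measurableT_comp => //.
apply: (@measurable_fun_fubini_tonelli_F _ _ _ _ _ P
  (fun z : 'rV[R]_d * T => (gauss_rV s (X z.2 - z.1))%:E)).
  by apply/measurable_EFinP; exact: measurable_gauss_X.
by move=> z; rewrite lee_fin gauss_rV_ge0.
Qed.

Let measurable_test s : measurable_fun setT
  (fun z : 'rV[R]_d * T => h z.1 * gauss_rV s (X z.2 - z.1)).
Proof.
apply: measurable_funM; last exact: measurable_gauss_X.
exact: (measurableT_comp mh).
Qed.

Let measurable_test_avg s : s != 0 ->
  measurable_fun setT (fun t => \int[leb]_x (h x * gauss_rV s (x - X t))).
Proof.
move=> s0; rewrite (_ : (fun t => _) =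
    (fun t => fine (\int[leb]_x (h x * gauss_rV s (X t - x))%:E)%E)); last first.
  by apply/funext => t; apply: eq_Rintegral => x _; rewrite gauss_rV_sym.
apply: measurableT_comp => //.
apply: (@measurable_fun_fubini_tonelli_G _ _ _ _ _ leb
  (fun z : 'rV[R]_d * T => (h z.1 * gauss_rV s (X z.2 - z.1))%:E)).
  by apply/measurable_EFinP; exact: measurable_test.
by move=> z; rewrite lee_fin mulr_ge0// gauss_rV_ge0.
Qed.

(** By Fubini and the symmetry of the Gaussian, smoothing the law of [X] amounts to smoothing the
    test function. The double integral is finite because [h <= 1] and the Gaussian has mass 1. *)
Let smooth_test s : 0 < s ->
  \int[leb]_x (h x * smooth s x) =
  \int[P]_t \int[leb]_x (h x * gauss_rV s (x - X t)).
Proof.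
move=> s0; have sn0 := lt0r_neq0 s0.
pose f (z : 'rV[R]_d * T) := h z.1 * gauss_rV s (X z.2 - z.1).
have mg := measurable_gauss_X s.
have mf : measurable_fun setT f by exact: measurable_test.
have f0 z : 0 <= f z by rewrite mulr_ge0// gauss_rV_ge0.
have if2 t : leb.-integrable setT (fun x => (f (x, t))%:E).
  rewrite (_ : (fun x => _) = (fun x => (h x * gauss_rV s (x - X t))%:E)).
    exact: (hg_int (X t) sn0).
  by apply/funext => x; rewrite /f gauss_rV_sym.
have gi x : P.-integrable setT (fun t => (gauss_rV s (X t - x))%:E).
  apply: (@integrable_dominated _ _ _ P (fun t => gauss_rV s (X t - x))
    (cst (normal_peak s ^+ d))).
  - by have := measurableT_comp mg (measurable_pair1 x).
  - move=> t; rewrite ger0_norm ?gauss_rV_ge0// gauss_rVE//.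
    rewrite ler_piMr ?exprn_ge0 ?normal_peak_ge0// -expR0 ler_expR oppr_le0.
    by rewrite divr_ge0 ?sqr_ge0// mulrn_wge0// sqr_ge0.
  - exact: finite_measure_integrable_cst.
have if1 x : P.-integrable setT (fun t => (f (x, t))%:E).
  exact: (integrableZl measurableT (h x) (gi x)).
have if12 : (leb \x P)%E.-integrable setT (EFin \o f).
  apply/integrable21ltyP; first exact/measurable_EFinP.
  apply: (@le_lt_trans _ _ (\int[P]_t 1)%E); last first.
    by rewrite integral_cst//= probability_setT mule1 ltry.
  apply: ge0_le_integral => //.
  - by move=> t _; apply: integral_ge0.
  - apply: (@measurable_fun_fubini_tonelli_G _ _ _ _ _ leb (abse \o (EFin \o f))) => //.
      by apply: measurableT_comp => //; exact/measurable_EFinP.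
    by move=> z; exact: abse_ge0.
  - move=> t _; rewrite -(integral_gauss_rVB (X t) sn0).
    apply: ge0_le_integral => //.
    + by apply: measurableT_comp => //; exact: (measurable_int _ (if2 t)).
    + exact: (measurable_int _ (integrable_gauss_shift (X t) sn0)).
    + move=> x _; rewrite lee_fin ger0_norm// /f gauss_rV_sym//.
      by rewrite ler_piMl// gauss_rV_ge0.
transitivity (\int[leb]_x \int[P]_t f (x, t)).
  by apply: eq_Rintegral => x _; rewrite -(RintegralZl (h x) measurableT (gi x)).
rewrite (Rintegral_Fubini if12 if1 if2); apply: eq_Rintegral => t _.
by apply: eq_Rintegral => x _; rewrite gauss_rV_sym.
Qed.

(** One sequence, two limits. The smoothed densities converge to [inversion_pdf] under a constant
    bound, with [h] integrable; on the other hand, once the Gaussian is moved onto [h], the error is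
    at most a constant times [s]. *)
Lemma inversion_pdf_lipschitz_test :
  \int[P]_t h (X t) = \int[leb]_x (h x * inversion_pdf x).
Proof.
pose s n : R := n.+1%:R^-1.
have s0 n : 0 < s n by rewrite invr_gt0.
have cvg1 : \int[leb]_x (h x * smooth (s n) x) @[n --> \oo] -->
    \int[leb]_x (h x * inversion_pdf x).
  apply: (@Rintegral_dominated_cvg _ _ _ leb _ _ (fun x => h x * (K * \int[leb]_u (2 * G u)))).
  - move=> n; apply: measurable_funM => //; exact: measurable_smooth.
  - by move=> x; apply: cvgMl_tmp; exact: smooth_cvg.
  - exact: (integrableZr measurableT _ ih).
  - move=> n x; rewrite normrM ger0_norm// ler_wpM2l//.
    exact: smooth_le.
have cvg2 : \int[leb]_x (h x * smooth (s n) x) @[n --> \oo] --> \int[P]_t h (X t).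
  pose C := L * (4 * Num.sqrt 2 ^+ d).
  apply/cvgrPdist_le => e e0; near=> n.
  rewrite smooth_test//.
  have ihX : P.-integrable setT (fun t => (h (X t))%:E).
    apply: (@integrable_dominated _ _ _ P (fun t => h (X t)) (cst 1)).
    - exact: measurableT_comp.
    - by move=> t; rewrite ger0_norm.
    - exact: finite_measure_integrable_cst.
  have ia : P.-integrable setT
      (fun t => (\int[leb]_x (h x * gauss_rV (s n) (x - X t)))%:E).
    apply: (@integrable_dominated _ _ _ P
      (fun t => \int[leb]_x (h x * gauss_rV (s n) (x - X t))) (cst (C * s n + 1))).
    - by apply: measurable_test_avg; rewrite gt_eqF.
    - move=> t; have := test_approx (X t) (s0 n); rewrite -/C => hC.
      rewrite -[X in `|X|](subrK (h (X t))) (le_trans (ler_normD _ _))// lerD//.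
      by rewrite ger0_norm.
    - exact: finite_measure_integrable_cst.
  rewrite distrC -RintegralB//.
  have iB := integrableB measurableT ia ihX.
  rewrite (le_trans (le_normr_Rintegral _ _))//.
  rewrite (@le_trans _ _ (\int[P]_t (C * s n)))//.
    apply: le_Rintegral => //; first exact: integrable_norm.
      exact: finite_measure_integrable_cst.
    by move=> t _; exact: test_approx.
  rewrite Rintegral_probability_cst ler_pdivrMr// [e * _]mulrC -ler_pdivrMr//.
  apply/ltW/(@lt_le_trans _ _ n%:R); last by rewrite ler_nat.
  by near: n; exact: nbhs_infty_gtr.
exact: (cvg_unique _ cvg2 cvg1).
Unshelve. all: end_near. Qed.

End lipschitz_test.

End inversion.

(** * Open boxes and tent functions *)

Section boxes.
Context (R : realType) (d : nat).
Implicit Types a b : 'I_d -> R.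

Definition open_box a b : set 'rV[R]_d :=
  [set v | forall i, a i < v ord0 i < b i].

Lemma measurable_open_box a b : measurable (open_box a b).
Proof.
rewrite (_ : open_box a b = \bigcap_(i in [set: 'I_d])
    ((fun v : 'rV[R]_d => v ord0 i) @^-1` [set` `]a i, b i[])).
  apply: fin_bigcap_measurable => [|i _]; first exact: finite_finset.
  rewrite -[X in measurable X]setTI.
  by apply: (measurable_coord_rV i measurableT); exact: measurable_itv.
apply/seteqP; split => v h i; first by move=> _; rewrite /= in_itv/=; exact: h.
by have := h i I; rewrite /= in_itv.
Qed.

Lemma lebesgue_rV_open_box a b : (forall i, a i <= b i) ->
  lebesgue_rV R d (open_box a b) = (\prod_i (b i - a i))%:E.
Proof.
move=> ab.
have -> : open_box a b = [set v | forall i, `]a i, b i[%classic (v ord0 i)].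
  by apply/seteqP; split => v h i; have := h i; rewrite /= in_itv.
rewrite (@lebesgue_rV_box R d (fun i => `]a i, b i[%classic)); last first.
  by move=> i; exact: measurable_itv.
rewrite -prodEFin; apply: eq_bigr => i _.
rewrite lebesgue_measure_itv/= lte_fin.
case: ltP => [_|]; first by rewrite -EFinD.
by move=> ba; rewrite (le_anti (introT andP (conj (ab i) ba))) subrr.
Qed.

Lemma lebesgue_rV_open_box_lty a b : (lebesgue_rV R d (open_box a b) < +oo)%E.
Proof.
have [ab|] := pselect (forall i, a i <= b i).
  by rewrite lebesgue_rV_open_box// ltry.
move=> /existsNP[i /negP]; rewrite -ltNge => ba.
rewrite (_ : open_box a b = set0) ?measure0//.
by apply/seteqP; split => // v /(_ i) /andP[/lt_trans h /h]; rewrite ltNge (ltW ba).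
Qed.

(** A cylinder over one open interval is the union of the boxes that have this interval as one side
    and []-n, n[] as all the others. *)
Lemma measurable_rV_open_boxE :
  @measurable _ 'rV[R]_d = <<s [set A | exists a b, A = open_box a b] >>.
Proof.
set G := [set A | _].
apply/seteqP; split; last first.
  apply: smallest_sub; first exact: sigma_algebra_measurable.
  by move=> _ [a [b ->]]; exact: measurable_open_box.
apply: smallest_sub; first exact: smallest_sigma_algebra.
move=> A; rewrite -bigcup_seq/= => -[i _ [B mB <-]].
pose c := (fun v => v ord0 i) : g_sigma_algebraType G -> R.
suff : measurable_fun setT c by move=> /(_ measurableT _ mB).
apply: (measurability _ (RGenOpens.measurableE R)).
move=> _ [_ [x [y ->]] <-]; rewrite setTI.
rewrite (_ : _ @^-1` _ = \bigcup_n open_box (fun j => if j == i then x else - n%:R)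
    (fun j => if j == i then y else n%:R)).
  apply: bigcupT_measurable => n; apply: sub_sigma_algebra.
  by do 2 eexists.
apply/seteqP; split => [v|v [n _ /(_ i)]]; rewrite /= in_itv/=; last by rewrite eqxx.
move=> xy; exists (Num.truncn (\sum_j `|v ord0 j|)).+1 => // j.
case: eqP => [->//|_]; rewrite -ltr_norml.
apply: (le_lt_trans _ (truncnS_gt _)).
by rewrite (bigD1 j)//= lerDl sumr_ge0.
Qed.

Lemma open_boxI a b a' b' :
  open_box a b `&` open_box a' b' =
  open_box (fun i => Num.max (a i) (a' i)) (fun i => Num.min (b i) (b' i)).
Proof.
apply/seteqP; split => v.
  move=> [h h'] i; have /andP[? ?] := h i; have /andP[? ?] := h' i.
  by rewrite gt_max lt_min; apply/andP; split; apply/andP.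
by move=> h; split=> i; have := h i; rewrite gt_max lt_min => /andP[/andP[? ?] /andP[? ?]]; apply/andP.
Qed.

(** Uniqueness on a generating pi-system: boxes are stable under intersection, and the cubes []-n,
    n[^d] exhaust the space with finite measure. *)
Lemma open_box_measure_unique (m1 m2 : {measure set 'rV[R]_d -> \bar R}) :
  (forall a b, m1 (open_box a b) = m2 (open_box a b)) ->
  (forall a b, (m1 (open_box a b) < +oo)%E) ->
  forall A, measurable A -> m1 A = m2 A.
Proof.
move=> m12 m1oo.
apply: (measure_unique _ (fun n => open_box (fun=> - n%:R) (fun=> n%:R))
    measurable_rV_open_boxE).
- by move=> _ _ [a [b ->]] [a' [b' ->]]; rewrite open_boxI; do 2 eexists.
- by move=> n; do 2 eexists.
- apply/seteqP; split => // v _; exists (Num.truncn (\sum_j `|v ord0 j|)).+1 => // j.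
  rewrite -ltr_norml; apply: (le_lt_trans _ (truncnS_gt _)).
  by rewrite (bigD1 j)//= lerDl sumr_ge0.
- by move=> _ [a [b ->]].
- by [].
Qed.

End boxes.

Section tent.
Context (R : realType).
Implicit Types (k : nat) (a b x y : R).

(** [k] times the distance to the complement of []a, b[], cut off at 1: a [k]-Lipschitz minorant of
    the indicator. *)
Definition tent (k : nat) (a b x : R) : R :=
  Num.min 1 (k%:R * Num.max 0 (Num.min (x - a) (b - x))).

Lemma tent_ge0 k a b x : 0 <= tent k a b x.
Proof. by rewrite le_min ler01/= mulr_ge0// le_max lexx. Qed.

Lemma tent_le1 k a b x : tent k a b x <= 1.
Proof. by rewrite ge_min lexx. Qed.

Lemma measurable_tent k a b : measurable_fun setT (tent k a b).
Proof.
apply: measurable_minr => //; apply: measurable_funM => //.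
apply: measurable_maxr => //; apply: measurable_minr; exact: measurable_funB.
Qed.

Lemma norm_minB (p x y x' y' : R) :
  `|x - x'| <= p -> `|y - y'| <= p -> `|Num.min x y - Num.min x' y'| <= p.
Proof.
rewrite !ler_norml; case: (leP x y); case: (leP x' y') => ? ? /andP[? ?] /andP[? ?];
  apply/andP; split; lra.
Qed.

Lemma norm_maxB (p x y x' y' : R) :
  `|x - x'| <= p -> `|y - y'| <= p -> `|Num.max x y - Num.max x' y'| <= p.
Proof.
rewrite !ler_norml; case: (leP x y); case: (leP x' y') => ? ? /andP[? ?] /andP[? ?];
  apply/andP; split; lra.
Qed.

Lemma tent_lipschitz k a b x y : `|tent k a b x - tent k a b y| <= k%:R * `|x - y|.
Proof.
apply: norm_minB; first by rewrite subrr normr0 mulr_ge0.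
rewrite -mulrBr normrM normr_nat ler_wpM2l//.
apply: norm_maxB; first by rewrite subrr normr0.
apply: norm_minB.
  by rewrite opprB addrA subrK.
by rewrite opprB addrC addrA subrK distrC.
Qed.

Lemma tent_near a b x : \forall k \near \oo, tent k a b x = \1_(`]a, b[%classic) x.
Proof.
rewrite indicE; have [|] := boolP (x \in _).
  rewrite inE/= in_itv/= => /andP[ax xb].
  pose m := Num.min (x - a) (b - x).
  have m0 : 0 < m by rewrite lt_min !subr_gt0 ax.
  near=> k; rewrite /tent -/m (max_r (ltW m0)) min_l//.
  rewrite -ler_pdivrMr// mul1r ltW//.
  near: k; exact: nbhs_infty_gtr.
rewrite notin_setE/= in_itv/= => /negP; rewrite negb_and -!leNgt => h.
apply: nearW => k; rewrite /tent [Num.max _ _]max_l; last by rewrite ge_min !subr_le0.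
by rewrite mulr0 min_r.
Unshelve. all: end_near. Qed.

End tent.

Section box_tent.
Context (R : realType) (d : nat).
Implicit Types (a b : 'I_d -> R) (u v : 'rV[R]_d).

Definition box_tent k a b (v : 'rV[R]_d) : R := \prod_i tent k (a i) (b i) (v ord0 i).

Lemma box_tent_ge0 k a b v : 0 <= box_tent k a b v.
Proof. by apply: prodr_ge0 => i _; exact: tent_ge0. Qed.

Lemma box_tent_le1 k a b v : box_tent k a b v <= 1.
Proof. by apply: prodr_ile1 => i _; rewrite tent_ge0 tent_le1. Qed.

Lemma measurable_box_tent k a b : measurable_fun setT (box_tent k a b).
Proof.
by apply: (@measurable_prod_rV R d (fun i => tent k (a i) (b i))) => i; exact: measurable_tent.
Qed.

Lemma box_tent_le_indic k a b v : box_tent k a b v <= \1_(open_box a b) v.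
Proof.
rewrite indicE; have [|] := boolP (v \in _); first by rewrite box_tent_le1.
rewrite notin_setE => /existsNP[i /negP].
rewrite negb_and -!leNgt => h.
rewrite /box_tent (bigD1 i)//= /tent (_ : Num.max _ _ = 0); last first.
  by rewrite max_l// ge_min !subr_le0.
by rewrite mulr0 min_r// mul0r.
Qed.

Lemma box_tent_lipschitz k a b u v :
  `|box_tent k a b u - box_tent k a b v| <= d%:R * k%:R * enorm (u - v).
Proof.
have -> : d%:R * k%:R * enorm (u - v) = \sum_(i < d) k%:R * enorm (u - v).
  by rewrite sumr_const card_ord -mulrA mulr_natl.
rewrite /box_tent.
(* The bounds in [[0, 1]] travel with the induction because the step
   [x p - y q = (x - y) p + y (p - q)] uses them for [p] and [y]. *)
suff : forall r : seq 'I_d,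
  [/\ 0 <= \prod_(i <- r) tent k (a i) (b i) (u ord0 i) <= 1,
      0 <= \prod_(i <- r) tent k (a i) (b i) (v ord0 i) <= 1 &
    `|\prod_(i <- r) tent k (a i) (b i) (u ord0 i) -
    \prod_(i <- r) tent k (a i) (b i) (v ord0 i)| <= \sum_(i <- r) k%:R * enorm (u - v)].
  by move=> /(_ (index_enum _))[].
elim=> [|i r [/andP[p0 p1] /andP[q0 q1] pq]].
  by rewrite !big_nil ler01 lexx subrr normr0.
rewrite !big_cons; have x0 := tent_ge0 k (a i) (b i) (u ord0 i).
have x1 := tent_le1 k (a i) (b i) (u ord0 i).
have y0 := tent_ge0 k (a i) (b i) (v ord0 i).
have y1 := tent_le1 k (a i) (b i) (v ord0 i).
have xy : `|tent k (a i) (b i) (u ord0 i) - tent k (a i) (b i) (v ord0 i)| <=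
    k%:R * enorm (u - v).
  rewrite (le_trans (tent_lipschitz _ _ _ _ _))// ler_wpM2l//.
  by have := coord_le_enorm (u - v) i; rewrite !mxE.
split; [by rewrite mulr_ge0// mulr_ile1|by rewrite mulr_ge0// mulr_ile1|].
set x := tent _ _ _ _ in x0 x1 xy *; set y := tent _ _ _ _ in y0 y1 xy *.
set p := \prod_(_ <- _) _ in p0 p1 pq *; set q := \prod_(_ <- _) _ in q0 q1 pq *.
have -> : x * p - y * q = (x - y) * p + y * (p - q) by ring.
rewrite (le_trans (ler_normD _ _))// !normrM (ger0_norm p0) (ger0_norm y0).
by rewrite lerD// (le_trans _ pq, le_trans _ xy)// (ler_piMl, ler_piMr).
Qed.

Lemma box_tent_cvg a b v : box_tent k a b v @[k --> \oo] --> (\1_(open_box a b) v : R).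
Proof.
apply: cvg_near_cst.
have : \forall k \near \oo, forall i,
    tent k (a i) (b i) (v ord0 i) = \1_(`]a i, b i[%classic) (v ord0 i) :> R.
  by apply: filter_forall => i; exact: tent_near.
apply: filterS => k hk; rewrite /box_tent (eq_bigr _ (fun i _ => hk i)).
rewrite indicE; have [|] := boolP (v \in _).
  rewrite inE => h; apply: big1 => i _; rewrite indicE mem_set//=.
  by rewrite in_itv/=; exact: h.
rewrite notin_setE => /existsNP[i vi].
by rewrite (bigD1 i)//= indicE memNset ?mul0r//= in_itv.
Qed.

Lemma integrable_box_tent k a b :
  (lebesgue_rV R d).-integrable setT (EFin \o box_tent k a b).
Proof.
apply: (@integrable_dominated _ _ _ (lebesgue_rV R d) _ (\1_(open_box a b))).
- exact: measurable_box_tent.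
- by move=> v; rewrite ger0_norm ?box_tent_ge0// box_tent_le_indic.
apply/integrableP; split.
  apply/measurable_EFinP; apply: measurable_indic; exact: measurable_open_box.
under eq_integral do rewrite /= ger0_norm//.
by rewrite integral_indic// ?setIT; [exact: lebesgue_rV_open_box_lty|exact: measurable_open_box].
Qed.

End box_tent.

(** * From test functions to the density of a law *)

Section density_measure.
Context d (T : measurableType d) (R : realType) (mu : {measure set T -> \bar R}).
Variables (f : T -> R) (mf : measurable_fun setT f) (f0 : forall x, 0 <= f x).

(** The two proofs are arguments, so that the measure structure can be attached to the resulting set
    function. *)
Definition density_measure of measurable_fun setT f & (forall x, 0 <= f x) :=
  fun A : set T => (\int[mu]_(x in A) (f x)%:E)%E.

Local Notation nu := (density_measure mf f0).

Let nu0 : nu set0 = 0%E. Proof. exact: integral_set0. Qed.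

Let nu_ge0 A : (0 <= nu A)%E.
Proof. by apply: integral_ge0 => x _; rewrite lee_fin. Qed.

Let nu_sigma_additive : semi_sigma_additive nu.
Proof.
move=> F mF tF mUF; rewrite /density_measure; apply: cvg_toP.
  apply: ereal_nondecreasing_is_cvgn => m n mn.
  by apply: lee_sum_nneg_natr => // k _ _; exact: nu_ge0.
rewrite ge0_integral_bigcup//.
- by apply/measurable_EFinP; exact: measurable_funTS.
- by move=> x _; rewrite lee_fin.
Qed.

HB.instance Definition _ := isMeasure.Build _ _ _ nu nu0 nu_ge0 nu_sigma_additive.

End density_measure.

Section inversion_density.
Context (R : realType) (d : nat) disp (T : measurableType disp)
  (P : probability T R) (X : T -> 'rV[R]_d) (G : 'rV[R]_d -> R).
Hypothesis mX : measurable_fun setT X.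
Local Notation leb := (lebesgue_rV R d).
Hypothesis iG : leb.-integrable setT (EFin \o G).
Hypothesis char_cos_le : forall u, `|char_cos P X u| <= G u.
Hypothesis char_sin_le : forall u, `|char_sin P X u| <= G u.

Let f := inversion_pdf P X.
Let mf : measurable_fun setT f.
Proof. exact: (measurable_inversion_pdf mX iG char_cos_le char_sin_le). Qed.
Let f0 x : 0 <= f x.
Proof. exact: (inversion_pdf_ge0 mX iG char_cos_le char_sin_le). Qed.

Let fM := inversion_pdf_le mX iG char_cos_le char_sin_le.

(** Apply the identity for Lipschitz tests to the tents of the box and let [k] grow. The left side
    is dominated by 1; the right side by [M] on the box, where [M] is the uniform bound on [f] and
    the box has finite volume. *)
Let box_eq a b :
  P (X @^-1` open_box a b) = (\int[leb]_(x in open_box a b) (f x)%:E)%E.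
Proof.
have mB := measurable_open_box a b.
have mXB : measurable (X @^-1` open_box a b).
  by rewrite -[X in measurable X]setTI; exact: mX.
set B := open_box a b in mB mXB *.
pose M := ((2 * pi)^-1) ^+ d * \int[leb]_u (2 * G u).
have c1 : \int[P]_t box_tent k a b (X t) @[k --> \oo] --> fine (P (X @^-1` B)).
  have -> : fine (P (X @^-1` B)) = \int[P]_t \1_B (X t).
    rewrite /Rintegral -[in LHS](setIT (X @^-1` B)) -integral_indic//.
  apply: (@Rintegral_dominated_cvg _ _ _ P _ _ (cst 1)).
  - by move=> n; exact: (measurableT_comp (measurable_box_tent n a b)).
  - by move=> t; exact: box_tent_cvg.
  - exact: finite_measure_integrable_cst.
  - by move=> n t; rewrite ger0_norm ?box_tent_ge0 ?box_tent_le1.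
have iB : leb.-integrable setT (EFin \o (\1_B : _ -> R)).
  apply/integrableP; split; first by apply/measurable_EFinP; exact: measurable_indic.
  under eq_integral do rewrite /= ger0_norm//.
  by rewrite integral_indic// setIT; exact: lebesgue_rV_open_box_lty.
have iBM : leb.-integrable setT (fun x => (\1_B x * M)%:E).
  exact: (integrableZr measurableT M iB).
have le x : \1_B x * f x <= \1_B x * M by rewrite ler_wpM2l.
have iBf : leb.-integrable setT (fun x => (\1_B x * f x)%:E).
  apply: (@integrable_dominated _ _ _ leb (fun x => \1_B x * f x) _ _ _ iBM).
    by apply: measurable_funM => //; exact: measurable_indic.
  by move=> x; rewrite ger0_norm// mulr_ge0.
have c2 : \int[leb]_x (box_tent k a b x * f x) @[k --> \oo] -->
    \int[leb]_x (\1_B x * f x).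
  apply: (@Rintegral_dominated_cvg _ _ _ leb _ _ (fun x => \1_B x * M)) => //.
  - by move=> n; apply: measurable_funM => //; exact: measurable_box_tent.
  - by move=> x; apply: cvgMr_tmp; exact: box_tent_cvg.
  - move=> n x; rewrite ger0_norm; last exact: mulr_ge0 (box_tent_ge0 _ _ _ _) (f0 x).
    exact: ler_pM (box_tent_ge0 _ _ _ _) (f0 x) (box_tent_le_indic _ _ _ _) (fM x).
have e k : \int[P]_t box_tent k a b (X t) = \int[leb]_x (box_tent k a b x * f x).
  exact: (inversion_pdf_lipschitz_test mX iG char_cos_le char_sin_le
    (measurable_box_tent k a b) (box_tent_ge0 k a b) (box_tent_le1 k a b)
    (integrable_box_tent k a b) (mulr_ge0 (ler0n _ d) (ler0n _ k))
    (box_tent_lipschitz k a b)).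
have E : fine (P (X @^-1` B)) = \int[leb]_x (\1_B x * f x).
  move: c2; rewrite (_ : (fun k => _) = (fun k => \int[P]_t box_tent k a b (X t))).
    exact: cvg_unique c1.
  by apply/funext => k; rewrite e.
rewrite -[LHS]fineK ?fin_num_measure// E EFin_Rintegral//.
rewrite [RHS]integral_mkcond; apply: eq_integral => x _.
by rewrite patchE indicE; case: ifP => _; rewrite ?mul1r ?mul0r.
Qed.

Lemma inversion_has_density : has_density P X f.
Proof.
split => // A mA.
pose m1 : {measure set 'rV[R]_d -> \bar R} := pushforward P X.
apply: (@open_box_measure_unique _ _ (m1 mX) (density_measure leb mf f0)) => // a b.
rewrite /m1 /= /pushforward.
apply: (le_lt_trans (probability_le1 _ _)); last by rewrite ltry.
by rewrite -[X in measurable X]setTI; apply: mX => //; exact: measurable_open_box.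
Qed.

End inversion_density.

(** * Densities and total variation *)

Section density_facts.
Context (R : realType) (d : nat).
Local Notation leb := (lebesgue_rV R d).

Section one_density.
Context disp (T : measurableType disp) (P : probability T R) (X : T -> 'rV[R]_d)
  (f : 'rV[R]_d -> R).
Hypothesis hf : has_density P X f.

Lemma has_density_integral1 : (\int[leb]_x (f x)%:E = 1)%E.
Proof.
have [_ _ /(_ setT measurableT)] := hf.
by rewrite preimage_setT => <-; exact: probability_setT.
Qed.

Lemma has_density_integrable : leb.-integrable setT (EFin \o f).
Proof.
have [mf f0 _] := hf; apply/integrableP; split; first exact/measurable_EFinP.
under eq_integral do rewrite /= ger0_norm//.
by rewrite has_density_integral1 ltry.
Qed.

End one_density.

(** Transfers estimates from the inversion formula to an arbitrary version of the density. *)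
Lemma has_density_ae_eq disp (T : measurableType disp) (P : probability T R)
    (X : T -> 'rV[R]_d) f g :
  has_density P X f -> has_density P X g -> ae_eq leb setT f g.
Proof.
move=> hf hg; have [mf f0 fE] := hf; have [mg g0 gE] := hg.
have := @integral_ae_eq _ _ _ leb setT measurableT (EFin \o g) (EFin \o f)
  (has_density_integrable hf).
move=> /(_ (measurable_int _ (has_density_integrable hg))) h.
have {}h : ae_eq leb setT (EFin \o f) (EFin \o g).
  by apply: h => E _ mE; rewrite -fE// -gE.
by apply: filterS h => x /(_ I) [].
Qed.

(** The bound used for those small [n] that the rate does not reach. *)
Lemma dTV_le2 disp1 (T1 : measurableType disp1) (P1 : probability T1 R)
    disp2 (T2 : measurableType disp2) (P2 : probability T2 R)
    (X1 : T1 -> 'rV[R]_d) (X2 : T2 -> 'rV[R]_d) :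
  measurable_fun setT X1 -> measurable_fun setT X2 ->
  (dTV P1 P2 X1 X2 <= 2%:E)%E.
Proof.
move=> mX1 mX2; apply: ge_ereal_sup => _ [h [mh h1] <-].
have E1 disp (T : measurableType disp) (P : probability T R) (X : T -> 'rV[R]_d) :
    measurable_fun setT X -> (`|'E_P[h \o X]| <= 1)%E.
  move=> mX; rewrite unlock.
  rewrite (le_trans (le_abse_integral _ _ _))//.
    by apply/measurable_EFinP; exact: measurableT_comp.
  rewrite -[leRHS](_ : \int[P]_t 1 = 1)%E; last first.
    by rewrite integral_cst//= probability_setT mule1.
  apply: ge0_le_integral => //.
    by apply: measurableT_comp => //; apply/measurable_EFinP; exact: measurableT_comp.
  by move=> t _; rewrite lee_fin; exact: h1.
rewrite (le_trans (lee_abs_sub _ _))//.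
by rewrite -[leRHS]/(1%:E + 1%:E)%E leeD// E1.
Qed.

(** With [p] and [q] the two positive parts, [f1 + p = f2 + q]: the two laws become equal after
    adding [rho] to one and [rho'] to the other. Both laws have mass 1, so [rho] and [rho'] have the
    same mass, at most [delta], and integrals of a function with values in [[0, 1]] differ by at
    most [delta]. *)
Lemma dTV_density_le disp1 (T1 : measurableType disp1) (P1 : probability T1 R)
    disp2 (T2 : measurableType disp2) (P2 : probability T2 R)
    (X1 : T1 -> 'rV[R]_d) (X2 : T2 -> 'rV[R]_d) f1 f2 (delta : R) :
  measurable_fun setT X1 -> measurable_fun setT X2 ->
  has_density P1 X1 f1 -> has_density P2 X2 f2 ->
  (\int[leb]_x (Num.max 0 (f2 x - f1 x))%:E <= delta%:E)%E ->
  (dTV P1 P2 X1 X2 <= (2 * delta)%:E)%E.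
Proof.
move=> mX1 mX2 [mf1 f10 f1E] [mf2 f20 f2E] hd.
pose p x := Num.max 0 (f2 x - f1 x); pose q x := Num.max 0 (f1 x - f2 x).
have mp : measurable_fun setT p by apply: measurable_maxr => //; exact: measurable_funB.
have mq : measurable_fun setT q by apply: measurable_maxr => //; exact: measurable_funB.
have p0 x : 0 <= p x by rewrite le_max lexx.
have q0 x : 0 <= q x by rewrite le_max lexx.
have pq x : f1 x + p x = f2 x + q x.
  by rewrite /p /q; case: (leP 0 (f2 x - f1 x)); case: (leP 0 (f1 x - f2 x)) => ? ?; lra.
pose m1 : {measure set 'rV[R]_d -> \bar R} := pushforward P1 X1.
pose m2 : {measure set 'rV[R]_d -> \bar R} := pushforward P2 X2.
pose rho := density_measure leb mp p0.
pose rho' := density_measure leb mq q0.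
have madd A : measurable A ->
    measure_add (m1 mX1) rho A = measure_add (m2 mX2) rho' A.
  move=> mA; rewrite !measure_addE /m1 /m2 /= /pushforward f1E// f2E//.
  rewrite /rho /rho' /density_measure -!ge0_integralD//.
  - by apply: eq_integral => x _; rewrite -!EFinD pq.
  - by move=> x _; rewrite lee_fin.
  - by apply/measurable_EFinP; exact: measurable_funTS.
  - by move=> x _; rewrite lee_fin.
  - by apply/measurable_EFinP; exact: measurable_funTS.
  - by move=> x _; rewrite lee_fin.
  - by apply/measurable_EFinP; exact: measurable_funTS.
  - by move=> x _; rewrite lee_fin.
  - by apply/measurable_EFinP; exact: measurable_funTS.
have rhoT : rho' setT = rho setT.
  have := madd _ measurableT; rewrite !measure_addE /m1 /m2 /= /pushforward !preimage_setT.
  rewrite !probability_setT -/rho -/rho'.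
  by move: (rho setT) (rho' setT) => [a| |] [b| |] // -[/addrI ->].
have rho_le : (rho setT <= delta%:E)%E by [].
have rho'_le : (rho' setT <= delta%:E)%E by rewrite rhoT.
have ule (m : {measure set 'rV[R]_d -> \bar R}) (u : 'rV[R]_d -> R) :
    measurable_fun setT u -> (forall x, 0 <= u x <= 1) ->
    (0 <= \int[m]_x (u x)%:E <= m setT)%E.
  move=> mu u01; have u0 x : 0 <= u x by have /andP[] := u01 x.
  apply/andP; split; first by apply: integral_ge0 => x _; rewrite lee_fin.
  rewrite -[leRHS]mul1e -integral_cst//; apply: ge0_le_integral => //.
  - by move=> x _; rewrite lee_fin.
  - exact/measurable_EFinP.
  - by move=> x _; rewrite lee_fin; have /andP[] := u01 x.
have key (u : 'rV[R]_d -> R) : measurable_fun setT u -> (forall x, 0 <= u x <= 1) ->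
    `|\int[P1]_t u (X1 t) - \int[P2]_t u (X2 t)| <= delta.
  move=> mu u01; have u0 x : 0 <= u x by have /andP[] := u01 x.
  have pushE dispT (T : measurableType dispT) (P : probability T R) (X : T -> 'rV[R]_d) :
      measurable_fun setT X ->
      (\int[pushforward P X]_x (u x)%:E = (\int[P]_t u (X t))%:E)%E.
    move=> mX; rewrite ge0_integral_pushforward//.
    - rewrite preimage_setT EFin_Rintegral//.
      apply: (@integrable_dominated _ _ _ P (fun t => u (X t)) (cst 1)).
      + exact: measurableT_comp.
      + by move=> t; rewrite ger0_norm//; have /andP[] := u01 (X t).
      + exact: finite_measure_integrable_cst.
    - exact/measurable_EFinP.
    - by move=> x _; rewrite lee_fin.
  have e : (\int[measure_add (m1 mX1) rho]_x (u x)%:E =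
      \int[measure_add (m2 mX2) rho']_x (u x)%:E)%E.
    by apply: eq_measure_integral => A mA _; exact: madd.
  move: e; rewrite !ge0_integral_measure_add//; last 4 first.
  - by move=> x _; rewrite lee_fin.
  - exact/measurable_EFinP.
  - by move=> x _; rewrite lee_fin.
  - exact/measurable_EFinP.
  rewrite (pushE _ _ P1)// (pushE _ _ P2)//.
  have /andP[] := ule rho u mu u01; have /andP[] := ule rho' u mu u01.
  move=> r'0 /le_trans/(_ rho'_le) r'1 r0 /le_trans/(_ rho_le) r1; move: r'0 r'1 r0 r1.
  case: (\int[rho']_x _)%E => [r'| |]//; case: (\int[rho]_x _)%E => [r| |]//.
  rewrite !lee_fin => ? ? ? ? [?].
  by rewrite ler_norml; apply/andP; split; lra.
apply: ge_ereal_sup => _ [h [mh h1] <-].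
(* Rescaling the test function into [[0, 1]] leaves only integrals of nonnegative functions; undoing
   it gives the factor 2. *)
pose u x := (h x + 1) / 2.
have mu : measurable_fun setT u.
  by apply: measurable_funM => //; exact: measurable_funD.
have u01 x : 0 <= u x <= 1.
  by have := h1 x; rewrite ler_norml /u => /andP[? ?]; apply/andP; split; lra.
have E disp (T : measurableType disp) (P : probability T R) (X : T -> 'rV[R]_d) :
    measurable_fun setT X -> ('E_P[h \o X])%E = (2 * \int[P]_t u (X t) - 1)%:E.
  move=> mX; rewrite unlock.
  have iu : P.-integrable setT (fun t => (u (X t))%:E).
    apply: (@integrable_dominated _ _ _ P (fun t => u (X t)) (cst 1)).
    - exact: measurableT_comp.
    - by move=> t; have /andP[? ?] := u01 (X t); rewrite ger0_norm.
    - exact: finite_measure_integrable_cst.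
  have i2u : P.-integrable setT (fun t => (2 * u (X t))%:E).
    exact: (integrableZl measurableT 2 iu).
  have i1 : P.-integrable setT (fun=> (1 : R)%:E).
    exact: finite_measure_integrable_cst.
  rewrite -RintegralZl// -[X in _ - X](Rintegral_probability_cst P) -RintegralB//.
  rewrite EFin_Rintegral; last exact: (integrableB measurableT i2u i1).
  by apply: eq_integral => t _; congr EFin; rewrite /u /=; field.
rewrite !E// -EFinB /= lee_fin.
have -> : 2 * \int[P1]_t u (X1 t) - 1 - (2 * \int[P2]_t u (X2 t) - 1) =
  2 * (\int[P1]_t u (X1 t) - \int[P2]_t u (X2 t)) by ring.
by rewrite normrM ger0_norm// ler_wpM2l// key.
Qed.
End density_facts.

(** * Sums of independent variables *)

Section independence.
Context (R : realType) disp (T : measurableType disp) (P : probability T R).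

Lemma measurable_preimage d' (V : measurableType d') (X : T -> V) (A : set V) :
  measurable_fun setT X -> measurable A -> measurable (X @^-1` A).
Proof. by move=> mX mA; rewrite -[X in measurable X]setTI; exact: mX. Qed.

Lemma joint_measure_unique (m1 m2 : {measure set (R * R) -> \bar R}) :
  (forall A B, measurable A -> measurable B -> m1 (A `*` B) = m2 (A `*` B)) ->
  (m1 setT < +oo)%E ->
  forall C, measurable C -> m1 C = m2 C.
Proof.
move=> m12 m1oo.
apply: (measure_unique [set A `*` B | A in measurable & B in measurable]
  (fun=> [set: R * R])).
- by rewrite measurable_prod_measurableType.
- move=> _ _ [A mA [B mB <-]] [A' mA' [B' mB' <-]]; rewrite -setXI.
  by exists (A `&` A'); [exact: measurableI|exists (B `&` B') => //; exact: measurableI].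
- by move=> n; exists setT => //; exists setT => //; rewrite setXTT.
- by apply/seteqP; split => // x _; exists 0%N.
- by move=> _ [A mA [B mB <-]]; exact: m12.
- by [].
Qed.

(** The joint law agrees with the product of the marginals on rectangles, hence everywhere, and
    Fubini factors the integral. *)
Lemma Rintegral_indep (U V : {RV P >-> R}) (g h : R -> R) :
  (forall A B, measurable A -> measurable B ->
    P (U @^-1` A `&` V @^-1` B) = (P (U @^-1` A) * P (V @^-1` B))%E) ->
  measurable_fun setT g -> measurable_fun setT h ->
  (forall x, `|g x| <= 1) -> (forall x, `|h x| <= 1) ->
  \int[P]_t (g (U t) * h (V t)) = (\int[P]_t g (U t)) * (\int[P]_t h (V t)).
Proof.
move=> UV mg mh g1 h1.
have mW : measurable_fun setT (fun t => (U t, V t)) by exact: measurable_fun_pair.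
pose f (z : R * R) := (g z.1 * h z.2)%:E.
have mf : measurable_fun setT f.
  apply/measurable_EFinP; apply: measurable_funM.
    exact: (measurableT_comp mg).
  exact: (measurableT_comp mh).
have fle z : (`|f z| <= 1)%E.
  by rewrite lee_fin normrM -[leRHS]mulr1 ler_pM.
have int1 d' (V' : measurableType d') (Q : probability V' R) (u : V' -> R) :
    measurable_fun setT u -> (forall x, `|u x| <= 1) -> Q.-integrable setT (EFin \o u).
  move=> mu u1; apply: (integrable_dominated mu u1).
  exact: finite_measure_integrable_cst.
pose mUV : {measure set (R * R) -> \bar R} := pushforward P (fun t => (U t, V t)).
pose dU := distribution P U; pose dV := distribution P V.
have ifUV : P.-integrable setT (fun t => f (U t, V t)).
  apply: int1 => [|t].
    by apply/measurable_EFinP; exact: (measurableT_comp mf).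
  by have := fle (U t, V t); rewrite lee_fin.
have e1 : (\int[P]_t f (U t, V t) = \int[mUV mW]_z f z)%E.
  by rewrite integral_pushforward.
have e2 : (\int[mUV mW]_z f z = \int[dU \x dV]_z f z)%E.
  apply: eq_measure_integral => C mC _; apply/esym.
  exact: product_measure_unique.
have if12 : (dU \x dV)%E.-integrable setT f.
  apply/integrableP; split => //.
  rewrite (@le_lt_trans _ _ (\int[dU \x dV]_z 1)%E)//.
    by apply: ge0_le_integral => //; exact: measurableT_comp.
  rewrite integral_cst//= mul1e -setXTT product_measure1E//.
  rewrite -[X in (X < _)%E]/(dU setT * dV setT)%E.
  by rewrite [dU _]probability_setT [dV _]probability_setT mule1 ltry.
have e3 : (\int[dU \x dV]_z f z = \int[dU]_x \int[dV]_y f (x, y))%E.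
  by rewrite -integral12_prod_meas1.
have e4 : (\int[dV]_y (h y)%:E = (\int[P]_t h (V t))%:E)%E.
  rewrite /dV integral_pushforward//; first by rewrite preimage_setT EFin_Rintegral// int1//; exact: measurableT_comp.
  - exact/measurable_EFinP.
  - by apply: int1 => //; exact: measurableT_comp.
have e5 : (\int[dU]_x (g x)%:E = (\int[P]_t g (U t))%:E)%E.
  rewrite /dU integral_pushforward//; first by rewrite preimage_setT EFin_Rintegral// int1//; exact: measurableT_comp.
  - exact/measurable_EFinP.
  - by apply: int1 => //; exact: measurableT_comp.
rewrite [LHS]/Rintegral [X in fine X]e1 e2 e3.
under eq_integral => x _.
  under eq_integral do rewrite /f /= EFinM.
  rewrite integralZl//; last exact: int1.
  rewrite e4.
  over.
rewrite integralZr//; last exact: int1.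
by rewrite e5.
Qed.

Lemma preimage_cylinderU1 d' (V : measurableType d') (X : nat -> T -> V) J A k B :
  k \notin J ->
  \bigcap_(j in [set` (k |` J)%fset]) (X j @^-1` (if j == k then B else A j)) =
  X k @^-1` B `&` \bigcap_(j in [set` J]) (X j @^-1` A j).
Proof.
move=> kJ; apply/seteqP; split => t.
  move=> h; split; first by have := h k (fset1U1 k J); rewrite eqxx.
  move=> j jJ; have := h j (fset1Ur k jJ).
  by case: eqP => // jk; rewrite -jk jJ in kJ.
move=> [tB h] j /=; rewrite in_fset1U => /orP[/eqP ->|jJ]; first by rewrite eqxx.
by case: eqP => [->//|_]; exact: h.
Qed.

Section partial_sums.
Variable Z : nat -> {RV P >-> R}.
Hypothesis indepZ : mutually_independent P Z.

Definition partial_sum k (t : T) : R := \sum_(1 <= j < k.+1) Z j t.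

Lemma measurable_partial_sum k : measurable_fun setT (partial_sum k).
Proof. by apply: measurable_sum => j. Qed.

Lemma measurable_cylinder (J : {fset nat}) (A : nat -> set R) :
  (forall j, j \in J -> measurable (A j)) ->
  measurable (\bigcap_(j in [set` J]) (Z j @^-1` A j)).
Proof.
move=> mA; apply: fin_bigcap_measurable => [|j jJ]; first exact: finite_fset.
by apply: measurable_preimage => //; exact: mA.
Qed.

Lemma cylinderU1 (J : {fset nat}) (A : nat -> set R) k B : k \notin J ->
  (forall j, j \in J -> measurable (A j)) -> measurable B ->
  P (Z k @^-1` B `&` \bigcap_(j in [set` J]) (Z j @^-1` A j)) =
  (P (Z k @^-1` B) * P (\bigcap_(j in [set` J]) (Z j @^-1` A j)))%E.
Proof.
move=> kJ mA mB; rewrite -(preimage_cylinderU1 (fun j => Z j : T -> R) A B kJ).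
rewrite indepZ; last first.
  move=> j; case: eqP => // jk; rewrite in_fset1U => /orP[/eqP//|]; exact: mA.
rewrite indepZ// big_fsetU1//= eqxx; congr (_ * _)%E.
rewrite big_seq [RHS]big_seq; apply: eq_bigr => j jJ.
by case: eqP => // jk; rewrite -jk jJ in kJ.
Qed.

(* The cylinder [E] is carried along so that the induction applies to both
   [Z_(k+1)] joined to [E] and to [Z_(k+1)] alone. *)
Lemma partial_sum_cylinder k (J : {fset nat}) (A : nat -> set R) (B : set R) :
  (forall j, j \in J -> (k < j)%N) ->
  (forall j, j \in J -> measurable (A j)) -> measurable B ->
  P (partial_sum k @^-1` B `&` \bigcap_(j in [set` J]) (Z j @^-1` A j)) =
  (P (partial_sum k @^-1` B) * P (\bigcap_(j in [set` J]) (Z j @^-1` A j)))%E.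
Proof.
elim: k J A B => [|k IHk] J A B kJ mA mB.
  have S0 t : partial_sum 0 t = 0 by rewrite /partial_sum big_geq.
  have [B0|B0] := pselect (B 0).
    have -> : partial_sum 0 @^-1` B = setT.
      by apply/seteqP; split => // t _; rewrite /= S0.
    by rewrite setTI probability_setT mul1e.
  have -> : partial_sum 0 @^-1` B = set0.
    by apply/seteqP; split => // t; rewrite /= S0.
  by rewrite set0I measure0 mul0e.
set E := \bigcap_(j in _) _.
have mE : measurable E by exact: measurable_cylinder.
have k1J : k.+1 \notin J by apply/negP => /kJ; rewrite ltnn.
pose W t := (partial_sum k t, Z k.+1 t).
have mW : measurable_fun setT W.
  by apply: measurable_fun_pair => //; exact: measurable_partial_sum.
(* The law of [W] restricted to [E] is compared with the law of [W] scaled by [P E]. They agree on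
   rectangles by induction, hence on the set [D] where the sum of the coordinates lies in [B], which
   is not a rectangle. *)
pose r : {nonneg R} := NngNum (fine_ge0 (measure_ge0 P E)).
have PE : P E = (r%:num)%:E by rewrite /= fineK// fin_num_measure.
pose m1 : {measure set (R * R) -> \bar R} := pushforward (mrestr P mE) W.
pose m0 : {measure set (R * R) -> \bar R} := pushforward P W.
have IH1 C D (J' : {fset nat}) A' : (forall j, j \in J' -> (k.+1 < j)%N) ->
    (forall j, j \in J' -> measurable (A' j)) -> measurable C -> measurable D ->
    P (partial_sum k @^-1` C `&` (Z k.+1 @^-1` D `&`
      \bigcap_(j in [set` J']) (Z j @^-1` A' j))) =
    (P (partial_sum k @^-1` C) * (P (Z k.+1 @^-1` D) *
      P (\bigcap_(j in [set` J']) (Z j @^-1` A' j))))%E.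
  move=> kJ' mA' mC mD.
  have k1J' : k.+1 \notin J' by apply/negP => /kJ'; rewrite ltnn.
  rewrite -cylinderU1// -(preimage_cylinderU1 (fun j => Z j : T -> R) A' D k1J').
  rewrite IHk//.
  - by move=> j; rewrite in_fset1U => /orP[/eqP->//|/kJ']; exact: ltnW.
  - move=> j; case: eqP => // jk; rewrite in_fset1U => /orP[/eqP//|]; exact: mA'.
have key : forall C, measurable C -> m1 mW C = mscale r (m0 mW) C.
  apply: joint_measure_unique => [C D mC mD|].
    rewrite -[LHS]/(P (W @^-1` (C `*` D) `&` E)).
    rewrite -[RHS]/((r%:num)%:E * P (W @^-1` (C `*` D)))%E -PE.
    transitivity (P (partial_sum k @^-1` C `&` (Z k.+1 @^-1` D `&` E))).
      by rewrite setIA.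
    rewrite IH1//.
    have := IH1 C D fset0 (fun=> setT).
    rewrite set_fset0 bigcap_set0 setIT probability_setT mule1 => e.
    rewrite [P (W @^-1` _)](_ : _ = P (partial_sum k @^-1` C `&` Z k.+1 @^-1` D))//.
    by rewrite e// muleA muleC.
  rewrite -[X in (X < _)%E]/(P (W @^-1` setT `&` E)) preimage_setT setTI.
  by rewrite (le_lt_trans (probability_le1 _ _))// ltry.
pose D := [set z : R * R | B (z.1 + z.2)].
have mD : measurable D.
  have ma : measurable_fun setT (fun z : R * R => z.1 + z.2) by exact: measurable_funD.
  by rewrite -[X in measurable X]setTI; exact: (ma measurableT B mB).
have SE : partial_sum k.+1 @^-1` B = W @^-1` D.
  rewrite (_ : partial_sum k.+1 = (fun t => partial_sum k t + Z k.+1 t))//.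
  by apply/funext => t; rewrite /partial_sum big_nat_recr.
have e : P (W @^-1` D `&` E) = ((r%:num)%:E * P (W @^-1` D))%E := key _ mD.
by rewrite SE e -PE muleC.
Qed.

Lemma partial_sum_indep k A B : measurable A -> measurable B ->
  P (partial_sum k @^-1` A `&` Z k.+1 @^-1` B) =
  (P (partial_sum k @^-1` A) * P (Z k.+1 @^-1` B))%E.
Proof.
move=> mA mB; have := @partial_sum_cylinder k [fset k.+1]%fset (fun=> B) A.
have -> : \bigcap_(j in [set` [fset k.+1]%fset]) (Z j @^-1` B) = Z k.+1 @^-1` B.
  apply/seteqP; split => t; first by move=> /(_ k.+1); apply; rewrite /= inE.
  by move=> tB j /=; rewrite inE => /eqP ->.
by apply => // j; rewrite inE => /eqP ->.
Qed.

End partial_sums.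
End independence.

Section char_fun_sum.
Context (R : realType) disp (T : measurableType disp) (P : probability T R).

Lemma char_funE d (X : T -> 'rV[R]_d) u :
  char_fun P X u = Complex (char_cos P X u) (char_sin P X u).
Proof.
by rewrite /char_fun /cexpectation unlock.
Qed.

Lemma normc_char_fun d (X : T -> 'rV[R]_d) u :
  Normc.normc (char_fun P X u) =
  Num.sqrt (char_cos P X u ^+ 2 + char_sin P X u ^+ 2).
Proof. by rewrite char_funE. Qed.

Variable Z : nat -> {RV P >-> R}.
Hypothesis indepZ : mutually_independent P Z.

Let phi j : R[i] := Complex (\int[P]_t cos (Z j t)) (\int[P]_t sin (Z j t)).

(** The complex product packages the addition formulas of cosine and sine, each term of which
    factors by independence. *)
Lemma char_partial_sum k :
  Complex (\int[P]_t cos (partial_sum Z k t)) (\int[P]_t sin (partial_sum Z k t)) =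
  \prod_(1 <= j < k.+1) phi j :> R[i].
Proof.
elim: k => [|k IHk].
  rewrite big_geq//.
  under eq_Rintegral do rewrite /partial_sum big_geq// cos0.
  under [X in Complex _ X]eq_Rintegral do rewrite /partial_sum big_geq// sin0.
  by rewrite !Rintegral_probability_cst.
rewrite big_nat_recr//= -IHk.
pose S : {RV P >-> R} := mfun_Sub (mem_set (measurable_partial_sum Z k)).
have SE t : S t = partial_sum Z k t by [].
have ind A B := @partial_sum_indep R disp T P Z indepZ k A B.
have mc := continuous_measurable_fun (@continuous_cos R).
have ms := continuous_measurable_fun (@continuous_sin R).
have prod (g h : R -> R) := @Rintegral_indep R _ T P S (Z k.+1) g h (fun A B mA mB => ind A B mA mB).
have recr t : partial_sum Z k.+1 t = partial_sum Z k t + Z k.+1 t.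
  by rewrite /partial_sum big_nat_recr.
have int (g h : R -> R) : measurable_fun setT g -> measurable_fun setT h ->
    (forall x : R, `|g x| <= 1) -> (forall x : R, `|h x| <= 1) ->
    P.-integrable setT (fun t => (g (partial_sum Z k t) * h (Z k.+1 t))%:E).
  move=> mg mh g1 h1.
  apply: (@integrable_dominated _ _ _ P
    (fun t => g (partial_sum Z k t) * h (Z k.+1 t)) (cst 1)).
  - apply: measurable_funM; last exact: (measurableT_comp mh).
    by apply: (measurableT_comp mg); exact: measurable_partial_sum.
  - by move=> t; rewrite normrM -[leRHS]mulr1 ler_pM.
  - exact: finite_measure_integrable_cst.
have c1 := @norm_cos_le1 R; have s1 := @norm_sin_le1 R.
rewrite /phi; apply/eqP; rewrite eq_complex /=; apply/andP; split; apply/eqP.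
  under eq_Rintegral do rewrite recr cosD.
  by rewrite RintegralB ?int// !prod.
under eq_Rintegral do rewrite recr sinD.
rewrite RintegralD ?int// !prod//.
by rewrite addrC.
Qed.

End char_fun_sum.

(** Projecting on the direction [w] reduces the claim to the independent real variables [<w, Y_j>].
    Identical distribution then replaces each factor by the one of index 0. *)
Lemma char_fun_normalized_sum (R : realType) (d : nat) disp
    (T : measurableType disp) (P : probability T R) (Y : nat -> {RV P >-> 'rV[R]_d}) n u :
  mutually_independent P Y -> identically_distributed Y ->
  char_fun P (normalized_sum Y n) u =
  char_fun P (Y 0%N) ((Num.sqrt n%:R)^-1 *: u) ^+ n.
Proof.
move=> indepY idY; set w := _ *: u.
have mw : measurable_fun setT (inner w).
  exact: measurable_inner_fun.
pose Z j : {RV P >-> R} := mfun_Sub (mem_set (measurableT_comp mw (measurable_funPT (Y j)))).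
have ZE j t : Z j t = inner w (Y j t) by [].
have indepZ : mutually_independent P Z.
  move=> J A mA; apply: (indepY J (fun j => inner w @^-1` A j)) => j jJ.
  by rewrite -[X in measurable X]setTI; exact: (mw measurableT _ (mA _ jJ)).
have := char_partial_sum indepZ n.
rewrite char_funE /char_cos /char_sin.
have SE t : inner u (normalized_sum Y n t) = partial_sum Z n t.
  rewrite /inner /normalized_sum /partial_sum.
  under [RHS]eq_bigr do rewrite ZE /inner.
  rewrite exchange_big/=; apply: eq_bigr => i _.
  rewrite !mxE summxE mulrCA mulrA mulr_sumr; exact: eq_bigr.
have SEg (g : R -> R) : \int[P]_t g (inner u (normalized_sum Y n t)) =
    \int[P]_t g (partial_sum Z n t).
  by apply: eq_Rintegral => t _; congr g; exact: SE.
rewrite (SEg cos) (SEg sin) => ->; rewrite char_funE.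
have law (g : R -> R) j : measurable_fun setT g -> (forall x, `|g x| <= 1) ->
    \int[P]_t g (Z j t) = \int[P]_t g (inner w (Y 0%N t)).
  move=> mg g1.
  pose h y := (g (inner w y))%:E.
  have mh : measurable_fun setT h.
    by apply/measurable_EFinP; exact: (measurableT_comp mg).
  have e k : (\int[P]_t h (Y k t) = \int[distribution P (Y k)]_y h y)%E.
    rewrite /distribution integral_pushforward//.
    have mY := measurable_funPT (Y k).
    apply: (@integrable_dominated _ _ _ P (fun t => g (inner w (Y k t))) (cst 1)).
    - by apply: (measurableT_comp mg); exact: (measurableT_comp mw).
    - by move=> t; exact: g1.
    - exact: finite_measure_integrable_cst.
  rewrite /Rintegral; congr fine.
  rewrite -[LHS]/(\int[P]_t h (Y j t))%E -[RHS]/(\int[P]_t h (Y 0%N t))%E !e.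
  by apply: eq_measure_integral => A mA _; exact: idY.
rewrite (eq_bigr (fun=> Complex (char_cos P (Y 0%N) w) (char_sin P (Y 0%N) w))).
  by rewrite prodr_const_nat subn1.
have mc := continuous_measurable_fun (@continuous_cos R).
have ms := continuous_measurable_fun (@continuous_sin R).
by move=> j _; rewrite (law cos j mc (@norm_cos_le1 R)) (law sin j ms (@norm_sin_le1 R)).
Qed.

(** * Estimates on characteristic functions *)

Section char_norm.
Context (R : realType) (d : nat) disp (T : measurableType disp)
  (P : probability T R) (X : T -> 'rV[R]_d).
Hypothesis mX : measurable_fun setT X.
Implicit Types (a b : R) (u : 'rV[R]_d).

Definition char_norm u := Num.sqrt (char_cos P X u ^+ 2 + char_sin P X u ^+ 2).

Lemma char_norm_ge0 u : 0 <= char_norm u. Proof. exact: sqrtr_ge0. Qed.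

Lemma sqr_char_norm u : char_norm u ^+ 2 = char_cos P X u ^+ 2 + char_sin P X u ^+ 2.
Proof. by rewrite sqr_sqrtr// addr_ge0 ?sqr_ge0. Qed.

Lemma char_cos_le_norm u : `|char_cos P X u| <= char_norm u.
Proof. by rewrite -sqrtr_sqr ler_sqrt ?addr_ge0 ?sqr_ge0// lerDl sqr_ge0. Qed.

(** Cauchy-Schwarz in the plane, through Lagrange's identity. *)
Lemma unit_comb_le a b (c s r : R) : 0 <= r -> r ^+ 2 = c ^+ 2 + s ^+ 2 ->
  a ^+ 2 + b ^+ 2 = 1 -> a * c + b * s <= r.
Proof.
move=> r0 rE ab; rewrite -(@ger0_norm _ r)// ler_normr; apply/orP; left.
case: (leP (a * c + b * s) r) => // h; exfalso.
have : (a * c + b * s) ^+ 2 = (a ^+ 2 + b ^+ 2) * r ^+ 2 - (a * s - b * c) ^+ 2.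
  by rewrite rE; ring.
rewrite ab mul1r => e; have := sqr_ge0 (a * s - b * c).
have : r ^+ 2 < (a * c + b * s) ^+ 2 by rewrite ltrXn2r//= ?nnegrE ?(le_trans r0 (ltW h)).
lra.
Qed.

(** Rotating by the argument of the characteristic function turns its modulus into the mean of a
    real trigonometric function, so that pointwise inequalities can be integrated. At modulus 0 any
    unit vector serves. *)
Lemma char_norm_attained u : exists a b,
  a ^+ 2 + b ^+ 2 = 1 /\ a * char_cos P X u + b * char_sin P X u = char_norm u.
Proof.
have e := sqr_char_norm u.
have [r0|r0] := eqVneq (char_norm u) 0.
  exists 1, 0; rewrite expr1n expr0n/= addr0; split => //.
  rewrite r0 in e; have := char_cos_le_norm u.
  by rewrite r0 normr_le0 => /eqP ->; ring.
exists (char_cos P X u / char_norm u), (char_sin P X u / char_norm u); split.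
  by rewrite !expr_div_n -mulrDl -e divff// expf_neq0.
apply: (@mulIf _ (char_norm u)) => //; rewrite -expr2 e.
by field.
Qed.

Lemma integrable_trig_comb a b u : P.-integrable setT
  (EFin \o (fun t => a * cos (inner u (X t)) + b * sin (inner u (X t)))).
Proof.
exact: (integrableD measurableT (integrableZl measurableT a (integrable_cos0 P mX u))
  (integrableZl measurableT b (integrable_sin0 P mX u))).
Qed.

Lemma Rintegral_trig_comb a b u :
  \int[P]_t (a * cos (inner u (X t)) + b * sin (inner u (X t))) =
  a * char_cos P X u + b * char_sin P X u.
Proof.
rewrite (RintegralD measurableT (integrableZl measurableT a (integrable_cos0 P mX u))
  (integrableZl measurableT b (integrable_sin0 P mX u))).
by rewrite (RintegralZl _ measurableT (integrable_cos0 P mX u))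
  (RintegralZl _ measurableT (integrable_sin0 P mX u)).
Qed.

Lemma char_norm_le1 u : char_norm u <= 1.
Proof.
have [a [b [ab <-]]] := char_norm_attained u.
rewrite -Rintegral_trig_comb -[leRHS](Rintegral_probability_cst P).
apply: le_Rintegral => //; first exact: integrable_trig_comb.
  exact: finite_measure_integrable_cst.
by move=> t _; apply: unit_comb_le => //; rewrite expr1n cos2Dsin2.
Qed.

(* With [w = a cos x + b sin x] the real part of a unit multiple of [e^(ix)],
   that of its square is [2 w^2 - 1 >= 4 w - 3]. *)
Lemma char_norm_double u : 1 - char_norm (u + u) <= 4 * (1 - char_norm u).
Proof.
have [a [b [ab e]]] := char_norm_attained u.
suff : 4 * char_norm u - 3 <= char_norm (u + u) by lra.
(* The pair [(a^2 - b^2, 2 a b)] is the square of [a + i b], again a unit vector. *)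
have ab2 : (a ^+ 2 - b ^+ 2) ^+ 2 + (2 * a * b) ^+ 2 = 1.
  by transitivity ((a ^+ 2 + b ^+ 2) ^+ 2); [ring|rewrite ab expr1n].
apply: (@le_trans _ _ ((a ^+ 2 - b ^+ 2) * char_cos P X (u + u) +
    (2 * a * b) * char_sin P X (u + u))); last first.
  by apply: unit_comb_le => //; [exact: char_norm_ge0|exact: sqr_char_norm].
have i4 := integrable_trig_comb (4 * a) (4 * b) u.
have i3 : P.-integrable setT (EFin \o cst (3 : R)) by exact: finite_measure_integrable_cst.
rewrite -Rintegral_trig_comb.
have -> : 4 * char_norm u - 3 =
    \int[P]_t (4 * a * cos (inner u (X t)) + 4 * b * sin (inner u (X t)) - 3).
  by rewrite (RintegralB measurableT i4 i3) Rintegral_trig_comb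
    Rintegral_probability_cst -e; ring.
apply: le_Rintegral => //; first exact: (integrableB measurableT i4 i3).
  exact: integrable_trig_comb.
move=> t _; have -> : inner (u + u) (X t) = inner u (X t) + inner u (X t).
  by rewrite /inner -big_split/=; apply: eq_bigr => i _; rewrite mxE mulrDl.
set x := inner u (X t); rewrite cosD sinD -subr_ge0.
have cs := cos2Dsin2 x.
suff -> : (a ^+ 2 - b ^+ 2) * (cos x * cos x - sin x * sin x) +
    2 * a * b * (sin x * cos x + cos x * sin x) -
    (4 * a * cos x + 4 * b * sin x - 3) =
    2 * (a * cos x + b * sin x - 1) ^+ 2.
  by rewrite mulr_ge0// sqr_ge0.
have {}cs : sin x ^+ 2 = 1 - cos x ^+ 2 by lra.
have {}ab : b ^+ 2 = 1 - a ^+ 2 by lra.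
have -> : (a * cos x + b * sin x - 1) ^+ 2 = a ^+ 2 * cos x ^+ 2 + b ^+ 2 * sin x ^+ 2
  + 2 * a * b * cos x * sin x + 1 - 2 * a * cos x - 2 * b * sin x by ring.
rewrite -[cos x * cos x]expr2 -[sin x * sin x]expr2 cs ab; ring.
Qed.

End char_norm.

Section moments.
Context (R : realType) (d : nat) disp (T : measurableType disp)
  (P : probability T R) (X : T -> 'rV[R]_d).
Hypothesis mX : measurable_fun setT X.
Hypothesis EX0 : forall i, ('E_P[fun t => X t ord0 i] = 0)%E.
Hypothesis covX : forall i j,
  covariance P (fun t => X t ord0 i) (fun t => X t ord0 j) = ((i == j)%:R)%:E.
Hypothesis moment3 : ('E_P[fun t => (enorm (X t) ^+ 3)%R] < +oo)%E.

Lemma measurable_enorm_exp k : measurable_fun setT (fun t => enorm (X t) ^+ k).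
Proof.
by apply: measurable_funX; apply: measurableT_comp mX; exact: measurable_enorm.
Qed.

Lemma integrable_enorm3 : P.-integrable setT (fun t => (enorm (X t) ^+ 3)%:E).
Proof.
apply/integrableP; split; first exact/measurable_EFinP/measurable_enorm_exp.
move: moment3; rewrite unlock; congr (_ < _)%E; apply: eq_integral => t _ /=.
by rewrite ger0_norm// exprn_ge0// enorm_ge0.
Qed.

(** Lets the third moment control the lower ones. *)
Lemma exp_le_1Dexp3 (x : R) k : 0 <= x -> (k <= 3)%N -> x ^+ k <= 1 + x ^+ 3.
Proof.
move=> x0 k3; case: (leP x 1) => x1.
  by rewrite (le_trans (exprn_ile1 k x0 x1))// lerDl exprn_ge0.
by rewrite (le_trans (ler_weXn2l (ltW x1) k3))// lerDr.
Qed.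

Lemma integrable_1Denorm3 (a : R) :
  P.-integrable setT (fun t => (a * (1 + enorm (X t) ^+ 3))%:E).
Proof.
under eq_fun do rewrite EFinM EFinD.
apply: integrableZl => //; apply: integrableD => //; last exact: integrable_enorm3.
exact: finite_measure_integrable_cst.
Qed.

Lemma integrable_coord i : P.-integrable setT (fun t => (X t ord0 i)%:E).
Proof.
apply: (@integrable_dominated _ _ _ P (fun t => X t ord0 i)
    (fun t => 1 * (1 + enorm (X t) ^+ 3))); last exact: integrable_1Denorm3.
- exact: (measurable_fun_rVP X).1.
- move=> t; rewrite mul1r (le_trans (coord_le_enorm _ _))//.
  by rewrite -[leLHS]expr1 exp_le_1Dexp3// enorm_ge0.
Qed.

Lemma integrable_coordM i j :
  P.-integrable setT (fun t => (X t ord0 i * X t ord0 j)%:E).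
Proof.
apply: (@integrable_dominated _ _ _ P (fun t => X t ord0 i * X t ord0 j)
    (fun t => 1 * (1 + enorm (X t) ^+ 3))); last exact: integrable_1Denorm3.
- by apply: measurable_funM; exact: (measurable_fun_rVP X).1.
- move=> t; rewrite mul1r normrM (le_trans _ (@exp_le_1Dexp3 _ 2 (enorm_ge0 (X t)) _))//.
  by rewrite expr2 ler_pM// coord_le_enorm.
Qed.

Lemma Rintegral_coord i : \int[P]_t X t ord0 i = 0.
Proof. by move: (EX0 i); rewrite unlock /Rintegral => ->. Qed.

Lemma Rintegral_coordM i j : \int[P]_t (X t ord0 i * X t ord0 j) = (i == j)%:R.
Proof.
have := covX i j; rewrite unlock !EX0 /= unlock /Rintegral.
move=> e; rewrite (_ : integral _ _ _ = ((i == j)%:R)%:E)//.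
rewrite -e; apply: eq_integral => t _.
rewrite -[RHS]/(((X t ord0 i - 0) * (X t ord0 j - 0))%:E).
by rewrite !subr0.
Qed.

Lemma Rintegral_sum_ord n (f : 'I_n -> T -> R) :
  (forall i, P.-integrable setT (EFin \o f i)) ->
  \int[P]_t (\sum_i f i t) = \sum_i \int[P]_t f i t.
Proof.
move=> fi; rewrite /Rintegral; under eq_integral do rewrite -sumEFin.
rewrite integral_sum//= (eq_bigr (fun i => (\int[P]_t f i t)%:E)) ?sumEFin//.
by move=> i _; rewrite EFin_Rintegral//; exact: fi.
Qed.

Lemma Rintegral_inner u : \int[P]_t inner u (X t) = 0.
Proof.
rewrite /inner Rintegral_sum_ord.
  rewrite big1// => i _; rewrite RintegralZl// ?Rintegral_coord ?mulr0//.
  exact: integrable_coord.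
by move=> i; exact: (integrableZl measurableT _ (integrable_coord i)).
Qed.

Lemma inner_sqrE u (x : 'rV[R]_d) :
  inner u x ^+ 2 = \sum_i \sum_j (u ord0 i * u ord0 j) * (x ord0 i * x ord0 j).
Proof.
rewrite expr2 {1}/inner mulr_suml; apply: eq_bigr => i _.
rewrite /inner mulr_sumr; apply: eq_bigr => j _; ring.
Qed.

Lemma integrable_inner_sqr u : P.-integrable setT (fun t => (inner u (X t) ^+ 2)%:E).
Proof.
under eq_fun do rewrite inner_sqrE -sumEFin.
apply: integrable_sum => // i _; under eq_fun do rewrite -sumEFin.
apply: integrable_sum => // j _; exact: (integrableZl measurableT _ (integrable_coordM i j)).
Qed.

Lemma integrable_inner u : P.-integrable setT (fun t => (inner u (X t))%:E).
Proof.
under eq_fun do rewrite /inner -sumEFin.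
apply: integrable_sum => // i _; exact: (integrableZl measurableT _ (integrable_coord i)).
Qed.

Lemma Rintegral_inner_sqr u : \int[P]_t inner u (X t) ^+ 2 = enorm u ^+ 2.
Proof.
have iM i j : P.-integrable setT
    (EFin \o (fun t => (u ord0 i * u ord0 j) * (X t ord0 i * X t ord0 j))).
  exact: (integrableZl measurableT _ (integrable_coordM i j)).
have iS i : P.-integrable setT
    (EFin \o (fun t => \sum_j (u ord0 i * u ord0 j) * (X t ord0 i * X t ord0 j))).
  rewrite /comp; under eq_fun do rewrite -sumEFin.
  by apply: integrable_sum => // j _; exact: iM.
under eq_Rintegral do rewrite inner_sqrE.
rewrite Rintegral_sum_ord// sqr_enorm /inner; apply: eq_bigr => i _.
rewrite Rintegral_sum_ord// (bigD1 i)//= RintegralZl//; last exact: integrable_coordM.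
rewrite Rintegral_coordM eqxx mulr1 big1 ?addr0// => j ji.
rewrite RintegralZl//; last exact: integrable_coordM.
by rewrite Rintegral_coordM eq_sym (negbTE ji) mulr0.
Qed.

(** The factor [d ^+ 3] comes from [inner_norm_le], cubed. *)
Definition taylor_cst := d%:R ^+ 3 * \int[P]_t (enorm (X t) ^+ 3).

Lemma taylor_cst_ge0 : 0 <= taylor_cst.
Proof.
by rewrite mulr_ge0 ?exprn_ge0// Rintegral_ge0// => t _; rewrite exprn_ge0// enorm_ge0.
Qed.

Lemma Rintegral_inner3 (f : T -> R) u : P.-integrable setT (EFin \o f) ->
  (forall t, `|f t| <= `|inner u (X t)| ^+ 3) ->
  `|\int[P]_t f t| <= taylor_cst * enorm u ^+ 3.
Proof.
move=> fi fle; rewrite (le_trans (le_normr_Rintegral measurableT fi))//.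
have -> : taylor_cst * enorm u ^+ 3 =
    \int[P]_t ((d%:R * enorm u) ^+ 3 * enorm (X t) ^+ 3).
  by rewrite (RintegralZl _ measurableT integrable_enorm3) /taylor_cst exprMn; ring.
apply: le_Rintegral => //.
- exact: (integrable_abse fi).
- exact: (integrableZl measurableT _ integrable_enorm3).
- move=> t _; rewrite (le_trans (fle t))// -exprMn lerXn2r ?nnegrE//.
    by rewrite !mulr_ge0// enorm_ge0.
  exact: inner_norm_le.
Qed.

(** The pointwise Taylor bound is integrated; identity covariance makes the quadratic term exactly
    [|u|^2 / 2]. In the sine part below, zero mean removes the linear term. *)
Lemma char_cos_taylor u :
  `|char_cos P X u - 1 + enorm u ^+ 2 / 2| <= taylor_cst * enorm u ^+ 3.
Proof.
have ic0 := integrable_cos0 P mX u.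
have i1 : P.-integrable setT (EFin \o cst (1 : R)) by exact: finite_measure_integrable_cst.
have i2 : P.-integrable setT (EFin \o (fun t => inner u (X t) ^+ 2 * 2^-1)).
  exact: (integrableZr measurableT _ (integrable_inner_sqr u)).
have iB : P.-integrable setT (EFin \o (fun t => cos (inner u (X t)) - 1)).
  exact: (integrableB measurableT ic0 i1).
have iD : P.-integrable setT (EFin \o (fun t => cos (inner u (X t)) - 1 + inner u (X t) ^+ 2 / 2)).
  exact: (integrableD measurableT iB i2).
have -> : char_cos P X u - 1 + enorm u ^+ 2 / 2 =
    \int[P]_t (cos (inner u (X t)) - 1 + inner u (X t) ^+ 2 / 2).
  rewrite (RintegralD measurableT iB i2) (RintegralB measurableT ic0 i1).
  rewrite Rintegral_probability_cst (RintegralZr _ measurableT (integrable_inner_sqr u)).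
  by rewrite Rintegral_inner_sqr.
by apply: Rintegral_inner3 => // t; exact: norm_cos_taylor.
Qed.

Lemma char_sin_taylor u : `|char_sin P X u| <= taylor_cst * enorm u ^+ 3.
Proof.
have is0 := integrable_sin0 P mX u.
have iB := integrableB measurableT is0 (integrable_inner u).
have -> : char_sin P X u = \int[P]_t (sin (inner u (X t)) - inner u (X t)).
  by rewrite (RintegralB measurableT is0 (integrable_inner u)) Rintegral_inner subr0.
by apply: Rintegral_inner3 => // t; exact: norm_sin_taylor.
Qed.

End moments.

(** * Scalar and complex inequalities *)

Section scalar_bounds.
Context {R : realType}.
Implicit Types (x p b c : R) (z : R[i]).

(** For an integer [k >= p], [exp (b x) >= (1 + b x / k) ^ k], and [1 + x <= L * (1 + b x / k)] with
    [L = 1 + k / b]. *)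
Lemma powR_expR_bounded p b : 0 < b ->
  exists2 K, 0 < K & forall x, 0 <= x -> (1 + x) `^ p * expR (- (b * x)) <= K.
Proof.
move=> b0; pose k := (Num.trunc `|p|).+1.
have pk : p <= k%:R by rewrite (le_trans (ler_norm p))// ltW// truncnS_gt.
have k0 : 0 < k%:R :> R by rewrite ltr0n.
pose L := 1 + k%:R / b.
have L0 : 0 < L by rewrite addr_gt0// divr_gt0.
exists (L ^+ k); first exact: exprn_gt0.
move=> x x0; rewrite expRN ler_pdivrMr ?expR_gt0//.
have x1 : 1 <= 1 + x by rewrite lerDl.
rewrite (le_trans (ler_powR x1 pk))// powR_mulrn ?addr_ge0//.
have -> : b * x = k%:R * (b * x / k%:R) by field; rewrite gt_eqF.
rewrite expRM_natl -exprMn lerXn2r ?nnegrE ?addr_ge0// ?mulr_ge0 ?(ltW L0) ?expR_ge0//.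
apply: (@le_trans _ _ (L * (1 + b * x / k%:R))); last first.
  by rewrite ler_wpM2l ?expR_ge1Dx// ltW.
have -> : L * (1 + b * x / k%:R) = 1 + x + (k%:R / b + b * x / k%:R).
  by rewrite /L; field; rewrite !gt_eqF.
by rewrite lerDl addr_ge0// ?divr_ge0 ?mulr_ge0 ?(ltW b0) ?(ltW k0).
Qed.

(** From [(x - 1)^2 >= 0] one gets [- c x^2 <= c - 2 c x], which reduces the Gaussian to an
    exponential. *)
Lemma exp_gauss_bounded (q : nat) p c : 0 < c ->
  exists2 K, 0 < K & forall x, 0 <= x ->
    x ^+ q * expR (- (c * x ^+ 2)) <= K * (1 + x) `^ (- p).
Proof.
move=> c0; have [K K0 KP] := powR_expR_bounded (q%:R + p) (mulr_gt0 (ltr0Sn R 1) c0).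
exists (expR c * K); first by rewrite mulr_gt0 ?expR_gt0.
move=> x x0; have x1 : 0 < 1 + x by rewrite ltr_pwDl.
rewrite powRN ler_pdivlMr ?powR_gt0//.
apply: (@le_trans _ _ ((1 + x) `^ (q%:R + p) * (expR c * expR (- (2 * c * x))))); last first.
  by rewrite mulrCA ler_wpM2l ?expR_ge0// KP.
rewrite powRD; last by rewrite (gt_eqF x1) implybT.
rewrite powR_mulrn ?(ltW x1)// mulrAC ler_pM ?mulr_ge0 ?exprn_ge0 ?powR_ge0 ?expR_ge0//.
  by rewrite ler_wpM2r ?powR_ge0// lerXn2r ?nnegrE ?(ltW x1)// lerDr.
rewrite -expRD ler_expR -subr_ge0.
have -> : c - 2 * c * x - - (c * x ^+ 2) = c * (x - 1) ^+ 2 by ring.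
by rewrite mulr_ge0 ?sqr_ge0// ltW.
Qed.

(** Far from the origin the factor [2^(-n)] has to pay for powers of [n]; it is [exp (- n ln 2)]. *)
Lemma half_exp_powR_bounded p :
  exists2 K, 0 < K & forall n : nat, (1 / 2) ^+ n * (1 + n%:R) `^ p <= K.
Proof.
have l0 : 0 < ln 2 :> R by rewrite ln_gt0// ltr1n.
have [K K0 KP] := powR_expR_bounded p l0.
exists K => // n; rewrite mulrC (le_trans _ (KP n%:R (ler0n _ _)))//.
rewrite ler_wpM2l ?powR_ge0// (mulrC (ln 2)) -mulrN expRM_natl expRN lnK ?posrE//.
by rewrite div1r.
Qed.

(** With [y = x^2 / 2], the lower bound is [exp (- y) >= 1 - y]. For [x <= 1],
    [(1 - y + y^2)(1 + y) = 1 + y^3 >= 1] gives [exp (- y) <= 1 - y + y^2], and [y^2 <= x^3]. For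
    [x > 1], [exp (- y) <= 1] and [y <= x^3] suffice. *)
Lemma norm_expRN_taylor x : 0 <= x ->
  `|expR (- (x ^+ 2 / 2)) - 1 + x ^+ 2 / 2| <= x ^+ 3.
Proof.
move=> x0; set y := x ^+ 2 / 2.
have y0 : 0 <= y by rewrite divr_ge0 ?sqr_ge0.
have lo := expR_ge1Dx (- y).
rewrite ger0_norm; last lra.
have ex3 : 0 <= x ^+ 3 by exact: exprn_ge0.
case: (leP x 1) => x1.
  have h : expR (- y) <= 1 - y + y ^+ 2.
    rewrite expRN -div1r ler_pdivrMr ?expR_gt0//.
    have h0 : 0 <= 1 - y + y ^+ 2 by have := sqr_ge0 (y - 1 / 2); lra.
    rewrite (le_trans _ (ler_wpM2l h0 (expR_ge1Dx y)))//.
    have -> : (1 - y + y ^+ 2) * (1 + y) = 1 + y ^+ 3 by ring.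
    by rewrite lerDl exprn_ge0.
  have : y ^+ 2 <= x ^+ 3.
    have -> : y ^+ 2 = x ^+ 3 * (x / 4) by rewrite /y; field.
    by rewrite -[leRHS]mulr1 ler_wpM2l//; lra.
  lra.
have h : expR (- y) <= 1 by rewrite -expR0 ler_expR oppr_le0.
have : y <= x ^+ 3.
  have -> : x ^+ 3 = x ^+ 2 * x by ring.
  by rewrite ler_wpM2l ?sqr_ge0//; lra.
lra.
Qed.

Lemma normcX z n : Normc.normc (z ^+ n) = Normc.normc z ^+ n.
Proof.
by elim: n => [|n IHn]; rewrite ?Normc.normc1// !exprS Normc.normcM IHn.
Qed.

Lemma normc_ge0 z : 0 <= Normc.normc z.
Proof. by case: z => a b; exact: sqrtr_ge0. Qed.

Lemma normc_le_Re_Im z :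
  Normc.normc z <= `|complex.Re z| + `|complex.Im z|.
Proof.
case: z => a b /=; rewrite -(@ler_pXn2r _ 2)// ?nnegrE ?sqrtr_ge0 ?addr_ge0//.
rewrite sqr_sqrtr ?addr_ge0 ?sqr_ge0// sqrrD !real_normK ?num_real//.
by rewrite addrAC lerDl mulrn_wge0// mulr_ge0.
Qed.

Lemma Re_le_normc z : `|complex.Re z| <= Normc.normc z.
Proof.
by case: z => a b /=; rewrite -sqrtr_sqr ler_sqrt ?addr_ge0 ?sqr_ge0// lerDl sqr_ge0.
Qed.

Lemma Im_le_normc z : `|complex.Im z| <= Normc.normc z.
Proof.
by case: z => a b /=; rewrite -sqrtr_sqr ler_sqrt ?addr_ge0 ?sqr_ge0// lerDr sqr_ge0.
Qed.

(** Telescoping. Keeping [M ^+ n] instead of 1 is what preserves Gaussian decay when [M] is an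
    exponential. *)
Lemma normc_subX (a z : R[i]) M n : Normc.normc a <= M -> Normc.normc z <= M ->
  Normc.normc (a ^+ n.+1 - z ^+ n.+1) <= n.+1%:R * Normc.normc (a - z) * M ^+ n.
Proof.
move=> aM zM; have M0 : 0 <= M := le_trans (normc_ge0 _) aM.
elim: n => [|n IHn]; first by rewrite !expr1 mul1r expr0 mulr1.
have -> : a ^+ n.+2 - z ^+ n.+2 = a * (a ^+ n.+1 - z ^+ n.+1) + (a - z) * z ^+ n.+1.
  rewrite (exprS a n.+1) (exprS z n.+1); ring.
rewrite (le_trans (le_normcD _ _))// !Normc.normcM normcX.
have -> : n.+2%:R * Normc.normc (a - z) * M ^+ n.+1 =
    M * (n.+1%:R * Normc.normc (a - z) * M ^+ n) + Normc.normc (a - z) * M ^+ n.+1.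
  by rewrite -[n.+2%:R]natr1 exprS; ring.
rewrite lerD//; first by rewrite ler_pM// normc_ge0.
by rewrite ler_wpM2l ?normc_ge0// lerXn2r ?nnegrE ?normc_ge0.
Qed.

End scalar_bounds.

Lemma enormZ (R : realType) d (a : R) (u : 'rV[R]_d) : enorm (a *: u) = `|a| * enorm u.
Proof.
rewrite /enorm -sqrtr_sqr -sqrtrM ?sqr_ge0//; congr Num.sqrt.
by rewrite /inner mulr_sumr; apply: eq_bigr => i _; rewrite !mxE; ring.
Qed.

Section char_norm_near0.
Context (R : realType) (d : nat) disp (T : measurableType disp)
  (P : probability T R) (X : T -> 'rV[R]_d).
Hypothesis mX : measurable_fun setT X.
Implicit Types u : 'rV[R]_d.
Local Notation r := (char_norm P X).

Lemma char_norm_iter_double k u : 1 - r (2 ^+ k *: u) <= 4 ^+ k * (1 - r u).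
Proof.
elim: k => [|k IHk]; first by rewrite !expr0 scale1r mul1r.
have -> : 2 ^+ k.+1 *: u = 2 ^+ k *: u + 2 ^+ k *: u.
  by rewrite -scalerDl exprS; congr (_ *: _); ring.
rewrite (le_trans (char_norm_double P mX _))// exprS -mulrA ler_wpM2l//.
Qed.

(* Doubling [u] until its norm exceeds [A] costs a factor [4 ^+ k] that is
   comparable to [(A / |u|) ^+ 2]. *)
Lemma char_norm_near0 A u : 0 < A -> (forall v, A <= enorm v -> r v <= 1 / 2) ->
  enorm u <= A -> r u <= expR (- ((8 * A ^+ 2)^-1 * enorm u ^+ 2)).
Proof.
move=> A0 rA uA; rewrite (le_trans _ (expR_ge1Dx _))//.
have A20 : 0 < A ^+ 2 by exact: exprn_gt0.
suff : (8 * A ^+ 2)^-1 * enorm u ^+ 2 <= 1 - r u by lra.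
have := enorm_ge0 u; rewrite le_eqVlt => /predU1P[<-|u0].
  by rewrite expr0n/= mulr0 subr_ge0 char_norm_le1.
have ex : exists k, A <= 2 ^+ k * enorm u.
  exists (Num.trunc (A / enorm u)).+1; rewrite -ler_pdivrMr// (le_trans (ltW (truncnS_gt _)))//.
  by rewrite -natrX ler_nat ltnW// ltn_expl.
have /= [k Ak kmin] := ex_minnP ex.
have lo : A <= enorm (2 ^+ k *: u) by rewrite enormZ ger0_norm ?exprn_ge0.
(* By minimality of [k] one doubling fewer stays below [A]; for [k = 0] the assumption [|u| <= A] is
   used instead. *)
have hi : 2 ^+ k * enorm u <= 2 * A.
  case: k Ak kmin {lo} => [|k] Ak kmin; first by rewrite mul1r; lra.
  rewrite exprS -mulrA ler_wpM2l// leNgt; apply/negP => h.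
  by have := kmin k (ltW h); rewrite ltnn.
have h1 : 1 / 2 <= 4 ^+ k * (1 - r u).
  by rewrite (le_trans _ (char_norm_iter_double k u))//; have := rA _ lo; lra.
have h2 : 4 ^+ k * enorm u ^+ 2 <= 4 * A ^+ 2.
  have -> : 4 ^+ k = (2 ^+ k) ^+ 2 :> R by rewrite -exprM mulnC exprM; congr (_ ^+ _); ring.
  have -> : 4 * A ^+ 2 = (2 * A) ^+ 2 by ring.
  by rewrite -exprMn lerXn2r ?nnegrE ?mulr_ge0 ?exprn_ge0 ?(ltW u0) ?(ltW A0).
(* The constant 8 combines the gap [1 / 2] of [h1] with the factor 4 of [h2]. *)
have k0 : 0 < 4 ^+ k :> R by exact: exprn_gt0.
rewrite -(ler_pM2l k0) (le_trans _ h1)// mulrCA ler_pdivrMl ?mulr_gt0//.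
by rewrite (le_trans h2)//; lra.
Qed.

Lemma char_norm_decay_half alpha C : 0 < alpha ->
  (forall u, r u <= C * (1 + enorm u) `^ (- alpha)) ->
  exists2 A, 0 < A & forall u, A <= enorm u -> r u <= 1 / 2.
Proof.
(* [B] exceeds twice [|C|] and stays positive even for [C = 0], so its power [1 / alpha] is a valid
   radius. *)
move=> a0 rC; pose B := 2 * (1 + `|C|).
have B0 : 0 < B by rewrite mulr_gt0// ltr_pwDl.
exists (B `^ (alpha^-1)); first exact: powR_gt0.
move=> u Bu; rewrite (le_trans (rC u))// powRN.
have e0 := enorm_ge0 u.
have hB : B <= (1 + enorm u) `^ alpha.
  have -> : B = (B `^ alpha^-1) `^ alpha.
    by rewrite -powRrM mulVf ?powRr1 ?(ltW B0)// lt0r_neq0.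
  rewrite ge0_ler_powR ?nnegrE ?(ltW a0) ?powR_ge0 ?addr_ge0//.
  by rewrite (le_trans Bu)// lerDr.
rewrite ler_pdivrMr ?powR_gt0 ?ltr_pwDl//.
rewrite (le_trans (ler_norm C))// (le_trans _ (ler_wpM2l _ hB))// /B; lra.
Qed.

End char_norm_near0.

(** * Pointwise comparison with the Gaussian characteristic function *)

Section clt_pointwise.
Context (R : realType) (d : nat) (psi : 'rV[R]_d -> R[i]).
Variables (K A c C alpha : R).
Hypotheses (K0 : 0 <= K) (A0 : 0 < A) (c0 : 0 < c) (c1 : c <= 1 / 2) (alpha0 : 0 < alpha).
Local Notation N := (@Normc.normc R).
Local Notation g := (fun w : 'rV[R]_d => expR (- (enorm w ^+ 2 / 2))).
Hypothesis psi_taylor : forall w, N (psi w - ((g w)%:C)%C) <= K * enorm w ^+ 3.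
Hypothesis psi_near0 : forall w, enorm w <= A -> N (psi w) <= expR (- (c * enorm w ^+ 2)).
Hypothesis psi_half : forall w, A <= enorm w -> N (psi w) <= 1 / 2.
Hypothesis psi_decay : forall w, N (psi w) <= C * (1 + enorm w) `^ (- alpha).

Let C0 : 0 <= C.
Proof.
have := le_trans (normc_ge0 (psi 0)) (psi_decay 0).
by rewrite pmulr_lge0// powR_gt0// ltr_pwDl// enorm_ge0.
Qed.

Lemma normcR (x : R) : N (x%:C)%C = `|x|.
Proof. by rewrite /= expr0n/= addr0 sqrtr_sqr. Qed.

Section fixed_n.
Variables (n : nat) (u : 'rV[R]_d).
Hypothesis n2 : (2 <= n)%N.
Let e := (Num.sqrt n%:R : R)^-1.

Let n0 : 0 < n%:R :> R. Proof. by rewrite ltr0n (leq_trans _ n2). Qed.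

Lemma isqrt_gt0 : 0 < e. Proof. by rewrite invr_gt0 sqrtr_gt0. Qed.

Lemma sqr_isqrt : e ^+ 2 * n%:R = 1.
Proof. by rewrite exprVn sqr_sqrtr ?(ltW n0)// mulVf// gt_eqF. Qed.

Lemma isqrt_le1 : e <= 1.
Proof.
have := isqrt_gt0; have := sqr_isqrt => h e0.
have n1 : 1 <= n%:R :> R by rewrite ler1n (leq_trans _ n2).
rewrite -(@ler_pXn2r _ 2)// ?nnegrE ?(ltW e0)// expr1n -h.
by rewrite ler_peMr// exprn_ge0// ltW.
Qed.

Let eu : enorm (e *: u) = e * enorm u.
Proof. by rewrite enormZ ger0_norm// ltW// isqrt_gt0. Qed.

Let gX : ((g (e *: u))%:C)%C ^+ n = ((g u)%:C)%C :> R[i].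
Proof.
rewrite -(rmorphXn (real_complex R)) /= -expRM_natl eu exprMn.
have -> : n%:R * - (e ^+ 2 * enorm u ^+ 2 / 2) = - (e ^+ 2 * n%:R * enorm u ^+ 2 / 2) by ring.
by rewrite sqr_isqrt mul1r.
Qed.

(* Of the [n] factors in [n |a - b| M^(n-1)], a power [(n-1)/n >= 1/2] of the
   Gaussian survives, whence the exponent [c / 2]. *)
Lemma clt_pointwise_center : enorm (e *: u) <= A ->
  N (psi (e *: u) ^+ n - ((g u)%:C)%C) <=
  e * K * (enorm u ^+ 3 * expR (- (c / 2 * enorm u ^+ 2))).
Proof.
move=> uA; have u0 := enorm_ge0 u; have e0 := isqrt_gt0; have ee := sqr_isqrt.
rewrite -gX; have -> : n = n.-1.+1 by rewrite prednK// (leq_trans _ n2).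
(* [c <= 1 / 2] places the Gaussian under the same majorant as [psi], as the telescoping bound
   demands. *)
have gM : N ((g (e *: u))%:C)%C <= expR (- (c * enorm (e *: u) ^+ 2)).
  rewrite normcR ger0_norm ?expR_ge0// ler_expR lerN2 mulrC ler_wpM2l ?sqr_ge0//.
  by rewrite -div1r.
rewrite (le_trans (normc_subX _ (psi_near0 uA) gM))//.
apply: (@le_trans _ _ (n%:R * (K * enorm (e *: u) ^+ 3) * expR (- (c * enorm (e *: u) ^+ 2)) ^+ n.-1)).
  rewrite prednK ?(leq_trans _ n2)// ler_wpM2r ?exprn_ge0 ?expR_ge0//.
  by rewrite ler_wpM2l ?psi_taylor// ltW.
rewrite eu -expRM_natl exprMn exprMn.
have -> : n%:R * (K * (e ^+ 3 * enorm u ^+ 3)) = e * K * enorm u ^+ 3.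
  have -> : n%:R * (K * (e ^+ 3 * enorm u ^+ 3)) = (e ^+ 2 * n%:R) * (e * K * enorm u ^+ 3) by ring.
  by rewrite ee mul1r.
rewrite [leRHS]mulrA ler_wpM2l ?mulr_ge0 ?exprn_ge0 ?(ltW e0)// ler_expR.
have nE : n.-1%:R = n%:R - 1 :> R by rewrite -subn1 natrB ?(leq_trans _ n2).
have -> : n.-1%:R * - (c * (e ^+ 2 * enorm u ^+ 2)) =
    - (c * ((e ^+ 2 * n%:R - e ^+ 2) * enorm u ^+ 2)) by rewrite nE; ring.
rewrite ee lerN2 -[leLHS]mulrA ler_wpM2l ?(ltW c0)// ler_wpM2r ?sqr_ge0//.
have : 2 * e ^+ 2 <= 1.
  by rewrite -[leRHS]ee mulrC ler_wpM2l ?sqr_ge0// (ler_nat R 2 n).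
lra.
Qed.

(** Of the [n] factors, [m] are spent on decay in [u] and the other [n - m] on [2^(-(n-m))]. Since
    [e <= 1], [1 + e |u| >= e (1 + |u|)], which costs the power of [e] that [2^(-n)] later
    absorbs. *)
Lemma clt_pointwise_tail m : (m <= n)%N -> A <= enorm (e *: u) ->
  N (psi (e *: u) ^+ n) <=
  (2 * C) ^+ m * ((1 / 2) ^+ n * e `^ (- (alpha * m%:R))) * (1 + enorm u) `^ (- (alpha * m%:R)).
Proof.
move=> mn uA; have u0 := enorm_ge0 u; have e0 := isqrt_gt0; have e1 := isqrt_le1.
have half : N (psi (e *: u)) ^+ (n - m) <= (1 / 2) ^+ (n - m).
  by rewrite lerXn2r ?nnegrE ?normc_ge0 ?psi_half//; lra.
have dec : N (psi (e *: u)) ^+ m <= C ^+ m * (1 + e * enorm u) `^ (- (alpha * m%:R)).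
  rewrite -mulNr powRrM powR_mulrn ?powR_ge0// -exprMn lerXn2r ?nnegrE ?normc_ge0//.
    by rewrite mulr_ge0 ?powR_ge0.
  by rewrite -eu psi_decay.
rewrite normcX -(subnKC mn) exprD.
apply: (le_trans (ler_pM _ _ dec half)); rewrite ?exprn_ge0 ?normc_ge0//.
rewrite subnKC//.
have -> : (1 / 2) ^+ (n - m) = 2 ^+ m * (1 / 2) ^+ n :> R.
  by rewrite -{2}(subnKC mn) exprD mulrA -exprMn (_ : 2 * (1 / 2) = 1) ?expr1n ?mul1r//; field.
have le1 : (1 + e * enorm u) `^ (- (alpha * m%:R)) <=
    e `^ (- (alpha * m%:R)) * (1 + enorm u) `^ (- (alpha * m%:R)).
  rewrite -powRM ?addr_ge0 ?(ltW e0)// !powRN lef_pV2 ?posrE ?powR_gt0 ?mulr_gt0 ?ltr_pwDl//.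
    rewrite ge0_ler_powR ?nnegrE ?mulr_ge0 ?addr_ge0 ?mulr_ge0 ?(ltW alpha0) ?(ltW e0)//.
    by rewrite mulrDr mulr1 lerD2r.
  by rewrite mulr_ge0// ltW.
rewrite [(2 * C) ^+ m]exprMn.
set x := _ `^ _ in le1 *; set y := e `^ _ in le1 *; set z := _ `^ _ in le1 *.
have -> : 2 ^+ m * C ^+ m * ((1 / 2) ^+ n * y) * z =
  C ^+ m * (y * z) * (2 ^+ m * (1 / 2) ^+ n) by ring.
have half0 : 0 <= 1 / 2 :> R by lra.
by rewrite ler_wpM2r ?mulr_ge0 ?exprn_ge0// ler_wpM2l// exprn_ge0.
Qed.

End fixed_n.

Lemma clt_pointwise m : exists2 K', 0 < K' & forall (n : nat) (u : 'rV[R]_d),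
  (2 <= n)%N -> (m <= n)%N ->
  N (psi ((Num.sqrt n%:R)^-1 *: u) ^+ n - ((g u)%:C)%C) <=
  K' * (Num.sqrt n%:R)^-1 * (1 + enorm u) `^ (- (alpha * m%:R)).
Proof.
set b := alpha * m%:R; have b0 : 0 <= b by rewrite mulr_ge0// ltW.
have [K1 K10 H1] := exp_gauss_bounded 3 b (divr_gt0 c0 (ltr0Sn R 1)).
have [K2 K20 H2] := @exp_gauss_bounded R 1 b (1 / 2) (divr_gt0 ltr01 (ltr0Sn R 1)).
have [K3 K30 H3] := @half_exp_powR_bounded R (b + 1).
exists (K * K1 + (2 * C) ^+ m * K3 + K2 / A).
  by rewrite ltr_wpDl ?divr_gt0// addr_ge0 ?mulr_ge0 ?exprn_ge0 ?mulr_ge0 ?(ltW K10) ?(ltW K30).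
move=> n u n2 mn; have e0 := isqrt_gt0 n2; set e := (Num.sqrt _)^-1 in e0 *.
have u0 := enorm_ge0 u.
have [uA|/ltW uA] := leP (enorm (e *: u)) A.
  rewrite (le_trans (clt_pointwise_center n2 uA))//.
  apply: (@le_trans _ _ (e * K * (K1 * (1 + enorm u) `^ (- b)))).
    by rewrite ler_wpM2l ?H1// mulr_ge0// ltW.
  rewrite !mulrA -[leRHS]/(_ * _) ler_wpM2r ?powR_ge0//.
  have -> : e * K * K1 = K * K1 * e by ring.
  rewrite ler_wpM2r ?(ltW e0)// -addrA lerDl addr_ge0 ?divr_ge0 ?mulr_ge0 ?exprn_ge0 ?mulr_ge0//; exact: ltW.
rewrite (le_trans (le_normcD _ _))// normcN normcR ger0_norm ?expR_ge0//.
(* The exponent [b + 1] in [H3] covers both [e^(-b)] and the extra factor [e] wanted on the right,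
   using [sqrt n <= 1 + n]. *)
have h1 : N (psi (e *: u) ^+ n) <= (2 * C) ^+ m * K3 * e * (1 + enorm u) `^ (- b).
  rewrite (le_trans (clt_pointwise_tail n2 mn uA))// ler_wpM2r ?powR_ge0//.
  rewrite -[leRHS]mulrA ler_wpM2l ?exprn_ge0 ?mulr_ge0//.
  rewrite -ler_pdivrMr// (le_trans _ (H3 n))// -mulrA ler_wpM2l ?exprn_ge0//.
  rewrite -/e -/b; have -> : e `^ (- b) / e = (Num.sqrt n%:R) `^ (b + 1).
    have s0 : 0 < Num.sqrt n%:R :> R by rewrite -invr_gt0.
    rewrite powRD ?(gt_eqF s0) ?implybT// powRr1 ?(ltW s0)// /e invrK -powR_inv1 ?(ltW s0)//.
    by rewrite -powRrM mulrNN mul1r.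
  rewrite ge0_ler_powR ?nnegrE ?addr_ge0 ?sqrtr_ge0//.
  rewrite -(@ler_pXn2r _ 2)// ?nnegrE ?sqrtr_ge0 ?addr_ge0// sqr_sqrtr//.
  have := ler0n R n; have := sqr_ge0 (n%:R : R).
  have -> : (1 + n%:R) ^+ 2 = 1 + 2 * n%:R + n%:R ^+ 2 :> R by ring.
  lra.
(* In this region [1 <= e |u| / A]; this produces the factor [e] at the price of one power of
   [|u|]. *)
have h2 : g u <= K2 / A * e * (1 + enorm u) `^ (- b).
  have h := H2 _ u0; rewrite expr1 in h.
  have eu_e : enorm (e *: u) = e * enorm u by rewrite enormZ ger0_norm ?(ltW e0).
  have -> : g u = expR (- (1 / 2 * enorm u ^+ 2)) by congr (expR (- _)); field.
  have -> : K2 / A * e * (1 + enorm u) `^ (- b) = e * (K2 * (1 + enorm u) `^ (- b)) / A by ring.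
  rewrite ler_pdivlMr// mulrC (le_trans (ler_wpM2r (expR_ge0 _) uA))//.
  by rewrite eu_e -[leLHS]mulrA ler_wpM2l// ltW.
by rewrite (le_trans (lerD h1 h2))// -!mulrDl ler_wpM2r ?powR_ge0// ler_wpM2r ?(ltW e0)// -addrA lerDr mulr_ge0 // ltW.
Qed.

End clt_pointwise.

(** * Rates of convergence *)

Section density_bound.
Context (R : realType) (d : nat) disp (T : measurableType disp) (P : probability T R).
Variables (Y : nat -> {RV P >-> 'rV[R]_d}) (alpha C : R).
Hypotheses (d0 : (0 < d)%N) (indepY : mutually_independent P Y).
Hypothesis idY : identically_distributed Y.
Hypothesis EY0 : (forall i, 'E_P[fun t => Y 0%N t ord0 i] = 0)%E.
Hypothesis covY : forall i j,
  covariance P (fun t => Y 0%N t ord0 i) (fun t => Y 0%N t ord0 j) = ((i == j)%:R)%:E.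
Hypothesis alpha0 : 0 < alpha.
Hypothesis char_decay : forall u : 'rV[R]_d,
  Normc.normc (char_fun P (Y 0%N) u) <= C * (1 + enorm u) `^ (- alpha).
Hypothesis moment3 : ('E_P[fun t => (enorm (Y 0%N t) ^+ 3)%R] < +oo)%E.
Local Notation leb := (lebesgue_rV R d).
Local Notation S := (normalized_sum Y).
Local Notation psi := (char_fun P (Y 0%N)).

Let mY0 : measurable_fun setT (Y 0%N). Proof. exact: measurable_funPT. Qed.

Lemma measurable_normalized_sum n : measurable_fun setT (S n).
Proof.
apply/measurable_fun_rVP => i.
rewrite (_ : (fun t => _) = (fun t => (Num.sqrt n%:R)^-1 * \sum_(1 <= j < n.+1) Y j t ord0 i)).
  apply: measurable_funM => //; apply: measurable_sum => j.
  by apply: (measurable_fun_rVP (Y j)).1; exact: measurable_funPT.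
by apply/funext => t; rewrite /normalized_sum mxE summxE.
Qed.

Let C0 : 0 <= C.
Proof.
have := le_trans (normc_ge0 (psi 0)) (char_decay 0).
by rewrite pmulr_lge0// powR_gt0// ltr_pwDl// enorm_ge0.
Qed.

(** The constant depends on [n] without control: the bound only provides integrability for
    inversion, not a rate. *)
Lemma char_normalized_sum_decay n : exists2 K, 0 <= K &
  forall u, Normc.normc (char_fun P (S n) u) <= K * (1 + enorm u) `^ (- (alpha * n%:R)).
Proof.
case: n => [|n].
  exists 1 => // u; rewrite char_fun_normalized_sum// expr0 Normc.normc1 mulr0 oppr0.
  by rewrite powRr0 mulr1.
set e := (Num.sqrt n.+1%:R : R)^-1.
have e0 : 0 < e by rewrite invr_gt0 sqrtr_gt0.
have e1 : e <= 1.
  rewrite -[leRHS]invr1 lef_pV2 ?posrE ?sqrtr_gt0// -[leLHS]sqrtr1 ler_sqrt//.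
  by rewrite ler1n.
exists (C ^+ n.+1 * e `^ (- (alpha * n.+1%:R))).
  by rewrite mulr_ge0 ?exprn_ge0 ?powR_ge0.
move=> u; have u0 := enorm_ge0 u; rewrite char_fun_normalized_sum// -/e normcX.
have eu : enorm (e *: u) = e * enorm u by rewrite enormZ ger0_norm ?(ltW e0).
apply: (@le_trans _ _ ((C * (1 + e * enorm u) `^ (- alpha)) ^+ n.+1)).
  rewrite lerXn2r ?nnegrE ?normc_ge0 ?mulr_ge0 ?powR_ge0//.
  by rewrite -eu char_decay.
rewrite exprMn -mulrA ler_wpM2l ?exprn_ge0// -powR_mulrn ?powR_ge0// -powRrM mulNr.
rewrite -powRM ?addr_ge0 ?(ltW e0)// !powRN lef_pV2 ?posrE ?powR_gt0 ?mulr_gt0 ?ltr_pwDl//.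
  rewrite ge0_ler_powR ?nnegrE ?mulr_ge0 ?addr_ge0 ?mulr_ge0 ?(ltW alpha0) ?(ltW e0)//.
  by rewrite mulrDr mulr1 lerD2r.
by rewrite mulr_ge0// ltW.
Qed.

Lemma normalized_sum_inversion n : d%:R < alpha * n%:R -> exists G : 'rV[R]_d -> R,
  [/\ leb.-integrable setT (EFin \o G), (forall u, `|char_cos P (S n) u| <= G u) &
      forall u, `|char_sin P (S n) u| <= G u].
Proof.
move=> dn; have [K K0 KP] := char_normalized_sum_decay n.
exists (fun u => K * (1 + enorm u) `^ (- (alpha * n%:R))); split.
- exact: (integrableZl measurableT K (integrable_enorm_decay d0 dn)).
- move=> u; rewrite (le_trans _ (KP u))// -[char_cos _ _ _]/(complex.Re (Complex (char_cos P (S n) u) (char_sin P (S n) u))).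
  by rewrite -char_funE Re_le_normc.
- move=> u; rewrite (le_trans _ (KP u))// -[char_sin _ _ _]/(complex.Im (Complex (char_cos P (S n) u) (char_sin P (S n) u))).
  by rewrite -char_funE Im_le_normc.
Qed.

Lemma continuous_density n : d%:R < alpha * n%:R -> exists f : 'rV[R]_d -> R,
  [/\ has_density P (S n) f, continuous f & exists M, forall x, f x <= M].
Proof.
move=> dn; have [G [iG Gc Gs]] := normalized_sum_inversion dn.
have mS := measurable_normalized_sum n.
exists (inversion_pdf P (S n)); split.
- exact: inversion_has_density mS iG Gc Gs.
- exact: (continuous_inversion_pdf mS iG Gc Gs).
- by eexists => x; exact: (inversion_pdf_le mS iG Gc Gs).
Qed.

Lemma normc_psi u : Normc.normc (psi u) = char_norm P (Y 0%N) u.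
Proof. exact: normc_char_fun. Qed.

Lemma char_normalized_sum_clt b : exists K m, [/\ 0 < K, b < alpha * m%:R &
  forall n u, (2 <= n)%N -> (m <= n)%N ->
  Normc.normc (char_fun P (S n) u - ((damp 1 u)%:C)%C) <=
  K / Num.sqrt n%:R * (1 + enorm u) `^ (- (alpha * m%:R))].
Proof.
have [A0 A00 HA0] : exists2 A, 0 < A & forall u, A <= enorm u -> char_norm P (Y 0%N) u <= 1 / 2.
  by apply: (char_norm_decay_half alpha0) => u; rewrite -normc_psi; exact: char_decay.
(* Enlarging the radius to [A >= 1] ensures [c = 1 / (8 A^2) <= 1 / 2]. *)
pose A := A0 + 1; have A1 : 1 <= A by rewrite lerDr ltW.
have A_gt0 : 0 < A by rewrite (lt_le_trans ltr01).
have HA u : A <= enorm u -> char_norm P (Y 0%N) u <= 1 / 2.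
  by move=> Au; apply: HA0; rewrite (le_trans _ Au)// lerDl.
have A2 : 1 <= A ^+ 2 by exact: exprn_ege1.
pose c := (8 * A ^+ 2)^-1.
have c0 : 0 < c by rewrite invr_gt0; lra.
have c1 : c <= 1 / 2.
  rewrite div1r lef_pV2 ?posrE//; lra.
pose M := taylor_cst P (Y 0%N); have M0 : 0 <= M by exact: taylor_cst_ge0.
(* One [M] for the real part, one for the imaginary part, and 1 for the Taylor remainder of the
   Gaussian. *)
pose K0 := 2 * M + 1; have K00 : 0 <= K0 by rewrite addr_ge0// mulr_ge0.
have psi_taylor w : Normc.normc (psi w - ((expR (- (enorm w ^+ 2 / 2)))%:C)%C) <= K0 * enorm w ^+ 3.
  rewrite (le_trans (normc_le_Re_Im _))// char_funE /= oppr0 addr0.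
  have h1 := char_cos_taylor mY0 EY0 covY moment3 w.
  have h2 := char_sin_taylor mY0 EY0 moment3 w.
  have h3 := norm_expRN_taylor (enorm_ge0 w).
  have -> : char_cos P (Y 0%N) w - expR (- (enorm w ^+ 2 / 2)) =
    (char_cos P (Y 0%N) w - 1 + enorm w ^+ 2 / 2) -
    (expR (- (enorm w ^+ 2 / 2)) - 1 + enorm w ^+ 2 / 2) by ring.
  have h4 := ler_normB (char_cos P (Y 0%N) w - 1 + enorm w ^+ 2 / 2)
    (expR (- (enorm w ^+ 2 / 2)) - 1 + enorm w ^+ 2 / 2).
  have -> : K0 * enorm w ^+ 3 = M * enorm w ^+ 3 + M * enorm w ^+ 3 + enorm w ^+ 3 by rewrite /K0; ring.
  rewrite -/M in h1 h2; lra.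
have near0 w : enorm w <= A -> Normc.normc (psi w) <= expR (- (c * enorm w ^+ 2)).
  by rewrite normc_psi; exact: char_norm_near0.
have half w : A <= enorm w -> Normc.normc (psi w) <= 1 / 2.
  by rewrite normc_psi; exact: HA.
pose m := (Num.trunc (`|b| / alpha)).+1.
have [K K_gt0 KP] := clt_pointwise K00 A_gt0 c0 c1 alpha0 psi_taylor near0 half char_decay m.
exists K, m; split => //.
  rewrite mulrC -ltr_pdivrMr// (le_lt_trans _ (truncnS_gt _))//.
  by rewrite ler_wpM2r ?invr_ge0 ?(ltW alpha0) ?ler_norm.
move=> n u n2 mn; rewrite char_fun_normalized_sum//.
by rewrite /damp expr1n mul1r; exact: KP.
Qed.

(** Both densities are inverse Fourier integrals, so their difference is bounded by the integral of
    the difference of the characteristic functions. The exponent [alpha * m > d] is fixed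
    independently of [n], which makes the remaining integral [I] a constant. *)
Lemma inversion_pdf_clt : exists K n0, [/\ 0 < K, (2 <= n0)%N &
  forall n, (n0 <= n)%N -> d%:R < alpha * n%:R /\
    forall x, `|inversion_pdf P (S n) x - std_gauss_pdf x| <= K / Num.sqrt n%:R].
Proof.
have [K [m [K0 dm KP]]] := char_normalized_sum_clt d%:R.
have iH := integrable_enorm_decay d0 dm.
set H := fun u => _ in iH.
pose I := \int[leb]_u (1 + enorm u) `^ (- (alpha * m%:R)).
have I0 : 0 <= I by apply: Rintegral_ge0 => u _; exact: powR_ge0.
pose k := ((2 * pi)^-1 : R) ^+ d.
have k0 : 0 <= k by rewrite exprn_ge0// invr_ge0 mulr_ge0 ?pi_ge0.
exists (k * (2 * K * I) + 1), (maxn 2 m); split.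
- by rewrite ltr_wpDl// !mulr_ge0// ltW.
- exact: leq_maxl.
move=> n; rewrite geq_max => /andP[n2 mn].
have dn : d%:R < alpha * n%:R.
  by rewrite (lt_le_trans dm)// ler_wpM2l ?(ltW alpha0)// ler_nat.
split => // x.
have [G [iG Gc Gs]] := normalized_sum_inversion dn.
have mS := measurable_normalized_sum n.
have iq := integrable_char_at mS iG Gc Gs x.
have id : leb.-integrable setT (EFin \o (fun u => damp 1 u * cos (inner u x))).
  apply: (@integrable_dominated _ _ _ leb (fun u => damp 1 u * cos (inner u x)) (damp 1)).
  - by apply: measurable_funM; [exact: measurable_damp|exact: measurable_cos_inner0].
  - move=> u; rewrite normrM ger0_norm ?expR_ge0// -[leRHS]mulr1.
    by rewrite ler_wpM2l ?expR_ge0// norm_cos_le1.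
  - exact: integrable_damp.
have iB := integrableB measurableT iq id.
rewrite std_gauss_pdfE (@gauss_rV_fourier _ _ 1 x ltr01) /inversion_pdf -/k -mulrBr normrM.
rewrite (ger0_norm k0) -(RintegralB measurableT iq id).
have s0 : 0 < Num.sqrt n%:R :> R by rewrite sqrtr_gt0 ltr0n (leq_trans _ n2).
apply: (@le_trans _ _ (k * (2 * (K / Num.sqrt n%:R) * I))); last first.
  have -> : k * (2 * (K / Num.sqrt n%:R) * I) = k * (2 * K * I) / Num.sqrt n%:R by ring.
  by rewrite ler_wpM2r ?invr_ge0 ?(ltW s0)// lerDl.
rewrite ler_wpM2l// (le_trans (le_normr_Rintegral measurableT iB))//.
rewrite /I -(RintegralZl _ measurableT iH); apply: le_Rintegral => //.
- exact: (integrable_abse iB).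
- exact: (integrableZl measurableT _ iH).
move=> u _.
set z := char_fun P (S n) u - ((damp 1 u)%:C)%C.
have -> : char_at P (S n) x u - damp 1 u * cos (inner u x) =
  cos (inner u x) * complex.Re z + sin (inner u x) * complex.Im z.
  by rewrite /z char_funE /= /char_at; ring.
apply: (@le_trans _ _ (2 * Normc.normc z)).
  rewrite (le_trans (ler_normD _ _))// !normrM.
  rewrite mulrDl !mul1r lerD// -[leRHS]mul1r ler_pM ?norm_cos_le1 ?norm_sin_le1 ?Re_le_normc ?Im_le_normc//.
by rewrite -mulrA ler_wpM2l// KP.
Qed.

End density_bound.

(** * Passing from almost everywhere to everywhere *)

Section continuous_versions.
Context {R : realType} {d : nat}.
Local Notation leb := (lebesgue_rV R d).
Implicit Types (x : 'rV[R]_d) (h : 'rV[R]_d -> R).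

Lemma continuous_sqr_enorm : continuous (fun x => enorm x ^+ 2).
Proof.
move=> x; under eq_fun do rewrite sqr_enorm.
rewrite /inner.
have ac : continuous (fun z : R * R => z.1 + z.2) by exact: add_continuous.
have := @cvg_big R 'I_d +%R 0 xpredT ac 'rV[R]_d (nbhs x) (index_enum 'I_d)
  (fun i (y : 'rV[R]_d) => y ord0 i * y ord0 i) (fun i => x ord0 i * x ord0 i) (nbhs_filter x).
apply => i _.
have cx := @coord_continuous R 1 d ord0 i x.
exact: (@cvgM _ _ (nbhs x) _ _ _ _ _ cx cx).
Qed.

Lemma continuous_std_gauss_pdf : continuous (@std_gauss_pdf R d).
Proof.
move=> x; pose k (r : R) := (2 * pi) `^ (- (d%:R / 2)) * expR (- (r / 2)).
apply: (@continuous_comp _ _ _ (fun y => enorm y ^+ 2) k x); first exact: continuous_sqr_enorm.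
move: (enorm x ^+ 2) => r; apply: cvgMl_tmp.
apply: continuous_cvg; first exact: continuous_expR.
by apply: cvgN; apply: cvgMr_tmp.
Qed.

Lemma nbhs_open_box x (A : set 'rV[R]_d) : nbhs x A ->
  exists2 e, 0 < e & open_box (fun i => x ord0 i - e) (fun i => x ord0 i + e) `<=` A.
Proof.
move=> /nbhs_ballP[e e0 eA]; exists e => // y yb; apply: eA; split => // i j.
rewrite (ord1 i) /ball/= distrC ltr_norml; have := yb j; lra.
Qed.

(** A strict violation at one point would persist on an open box around it, and such a box has
    positive volume. *)
Lemma ae_le_continuous h c : continuous h -> {ae leb, forall x, h x <= c} ->
  forall x, h x <= c.
Proof.
move=> ch [N [mN N0 hN]] x; rewrite leNgt; apply/negP => hx.
have : nbhs x (h @^-1` [set y | c < y]).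
  by apply: (ch x); apply: open_nbhs_nbhs; split; [exact: open_gt|].
move=> /nbhs_open_box[e e0 eA].
pose B := open_box (fun i => x ord0 i - e) (fun i => x ord0 i + e).
have : (leb B <= leb N)%E.
  apply: le_measure; rewrite ?inE//; first exact: measurable_open_box.
  move=> y /eA hy; apply: hN => /=.
  by apply/negP; rewrite -ltNge.
rewrite N0 lebesgue_rV_open_box; last by move=> i; lra.
apply/negP; rewrite -ltNge lte_fin; apply: prodr_gt0 => i _; lra.
Qed.

Lemma continuous_dist_le h1 h2 c : continuous h1 -> continuous h2 ->
  {ae leb, forall x, `|h1 x - h2 x| <= c} -> forall x, `|h1 x - h2 x| <= c.
Proof.
move=> c1 c2; apply: ae_le_continuous => x.
have cB := @cvgB _ R^o _ (nbhs x) (nbhs_filter x) h1 h2 (h1 x) (h2 x) (c1 x) (c2 x).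
exact: (cvg_norm cB).
Qed.

End continuous_versions.

(** Write the minimum as [m = m^(1-p) m^p] and bound each factor by a different argument. *)
Lemma min_le_powRM (R : realType) (a b p : R) : 0 <= a -> 0 <= b -> 0 < p < 1 ->
  Num.min a b <= a `^ (1 - p) * b `^ p.
Proof.
move=> a0 b0 /andP[p0 p1].
have [m0|m0] := leP (Num.min a b) 0.
  by rewrite (le_trans m0)// mulr_ge0// powR_ge0.
have m_ge0 := ltW m0.
have -> : Num.min a b = Num.min a b `^ (1 - p) * Num.min a b `^ p.
  by rewrite -powRD ?(gt_eqF m0) ?implybT// subrK powRr1.
rewrite ler_pM ?powR_ge0// ge0_ler_powR ?nnegrE//; try lra.
  by rewrite ge_min lexx.
by rewrite ge_min lexx orbT.
Qed.

Lemma powR_dominates_prefix (R : realType) (p : R) (a : nat -> R) n0 :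
  (forall j, 0 <= a j) ->
  exists2 B, 0 <= B & forall n, (0 < n)%N -> (n < n0)%N -> a n <= B * n%:R `^ p.
Proof.
(* The sum of all ratios [a j / j^p] dominates each of them, since none is negative. *)
move=> a0; exists (\sum_(j < n0) a j / j%:R `^ p).
  by apply: sumr_ge0 => j _; rewrite divr_ge0// powR_ge0.
move=> n npos nn0; rewrite -ler_pdivrMr ?powR_gt0 ?ltr0n//.
rewrite (bigD1 (Ordinal nn0))//= lerDl; apply: sumr_ge0 => j _.
by rewrite divr_ge0// powR_ge0.
Qed.

Section tv_rate.
Context (R : realType) (d : nat).
Local Notation leb := (lebesgue_rV R d).

Lemma std_gauss_pdf_powR (p : R) x : 0 <= p ->
  @std_gauss_pdf R d x `^ p = ((2 * pi) `^ (- (d%:R / 2))) `^ p * damp (Num.sqrt p) x.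
Proof.
move=> p0; rewrite /std_gauss_pdf powRM ?powR_ge0 ?expR_ge0//; congr (_ * _).
rewrite /powR gt_eqF ?expR_gt0// expRK /damp (sqr_sqrtr p0).
by have -> : p * - (enorm x ^+ 2 / 2) = - (p * enorm x ^+ 2 / 2) by ring.
Qed.

(** A power of a Gaussian is again Gaussian, here [damp] with [s^2 = p] up to a constant. As [p] may
    be arbitrarily small, so may the loss in the exponent of the rate. *)
Lemma integrable_std_gauss_pdf_powR (p : R) : 0 < p ->
  leb.-integrable setT (EFin \o (fun x => std_gauss_pdf x `^ p)).
Proof.
move=> p0; rewrite /comp; under eq_fun do rewrite (std_gauss_pdf_powR _ (ltW p0)) EFinM.
by apply: integrableZl => //; apply: integrable_damp; rewrite sqrtr_gt0.
Qed.

Lemma std_gauss_pdf_ge0 x : 0 <= @std_gauss_pdf R d x.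
Proof. by rewrite mulr_ge0 ?powR_ge0 ?expR_ge0. Qed.

Lemma dTV_std_gauss_le disp (T : measurableType disp) (P : probability T R)
    disp' (T' : measurableType disp') (P' : probability T' R)
    (X : T -> 'rV[R]_d) (Phi : T' -> 'rV[R]_d) f (D p : R) :
  measurable_fun setT X -> measurable_fun setT Phi ->
  has_density P X f -> has_density P' Phi std_gauss_pdf -> 0 <= D -> 0 < p < 1 ->
  (forall x, `|f x - std_gauss_pdf x| <= D) ->
  (dTV P P' X Phi <=
    (2 * (D `^ (1 - p) * \int[leb]_x std_gauss_pdf x `^ p))%:E)%E.
Proof.
move=> mX mPhi fX gPhi D0 p01 fg; have p0 : 0 < p by case/andP: p01.
have iG := integrable_std_gauss_pdf_powR p0.
have iDG := integrableZl measurableT (D `^ (1 - p)) iG.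
apply: (dTV_density_le mX mPhi fX gPhi).
rewrite -(RintegralZl _ measurableT iG) (EFin_Rintegral iDG).
have [mf f0 _] := fX; have [mg g0 _] := gPhi.
apply: ge0_le_integral => //.
- by move=> x _; rewrite lee_fin le_max lexx.
- apply/measurable_EFinP; apply: measurable_maxr => //; exact: measurable_funB.
- exact: (measurable_int _ iDG).
move=> x _; rewrite lee_fin.
apply: le_trans (min_le_powRM D0 (g0 x) p01); rewrite le_min !ge_max D0 g0/=.
have := fg x; have := f0 x; rewrite ler_norml => h1 /andP[h2 h3].
by apply/andP; split; lra.
Qed.

End tv_rate.

Lemma isqrt_powR (R : realType) (n : nat) : (Num.sqrt n%:R : R)^-1 = n%:R `^ (- (1 / 2)).
Proof. by rewrite div1r powRN -powR12_sqrt. Qed.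

(* For the finitely many small [n] the law of [X] need not have a bounded
   density; the bound is then vacuous. *)
Lemma bounded_density_dist (R : realType) d disp (T : measurableType disp)
    (P : probability T R) (X : T -> 'rV[R]_d) :
  exists2 a, 0 <= a & forall f, has_density P X f ->
    (ess_sup (lebesgue_rV R d) (fun x => (f x)%:E) < +oo)%E ->
    {ae lebesgue_rV R d, forall x, `|f x - std_gauss_pdf x| <= a}.
Proof.
(* If some bounded density [f0] exists, all others equal it almost everywhere, so one constant
   serves them all. *)
have [[f0 [f0X f0b]]|none] := pselect (exists f0, has_density P X f0 /\
    (ess_sup (lebesgue_rV R d) (fun x => (f0 x)%:E) < +oo)%E); last first.
  by exists 0 => // f fX fb; case: none; exists f.
have [M f0M] := ess_supr_bounded f0b.
pose c : R := (2 * pi) `^ (- (d%:R / 2)).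
exists (`|M| + c); first by rewrite addr_ge0// powR_ge0.
move=> f fX fb; have [_ f_ge0 _] := fX.
have := has_density_ae_eq f0X fX; move: f0M; apply: filterS2 => x f0x /(_ I) ff0.
have gc : std_gauss_pdf x <= c.
  by rewrite -[leRHS]mulr1 ler_wpM2l ?powR_ge0// -expR0 ler_expR oppr_le0 divr_ge0 ?sqr_ge0.
have g0 := std_gauss_pdf_ge0 x; have fx0 := f_ge0 x; have Mn := ler_norm M.
have c0 : 0 <= c by exact: powR_ge0.
by rewrite ler_norml -ff0; rewrite -ff0 in fx0; apply/andP; split; lra.
Qed.

Theorem theorem4p2 (R : realType) (d : nat)
    (disp : measure_display) (T : measurableType disp) (P : probability T R)
    (Y : nat -> {RV P >-> 'rV[R]_d})
    (disp' : measure_display) (T' : measurableType disp')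
    (P' : probability T' R) (Phi : {RV P' >-> 'rV[R]_d}) (alpha C : R) :
  (1 <= d)%N ->
  mutually_independent P Y ->
  identically_distributed Y ->
  (forall n i, 'E_P[fun t => Y n t ord0 i] = 0)%E ->
  (forall n i j, covariance P (fun t => Y n t ord0 i) (fun t => Y n t ord0 j) =
     ((i == j)%:R)%:E) ->
  0 < alpha ->
  (forall u : 'rV[R]_d,
     Normc.normc (char_fun P (Y 0%N) u) <= C * (1 + enorm u) `^ (- alpha)) ->
  (forall k : nat, ('E_P[fun t => (enorm (Y 0%N t) ^+ k)%R] < +oo)%E) ->
  has_density P' Phi std_gauss_pdf ->
  let Sn : nat -> T -> 'rV[R]_d := normalized_sum Y in
  (forall n : nat, d%:R < alpha * n%:R ->
     exists f : 'rV[R]_d -> R,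
       [/\ has_density P (Sn n) f, continuous f & exists M, forall x, f x <= M])
  /\
  forall eps : R, 0 < eps ->
    (exists C_eps : R, forall n : nat, (2 <= n)%N ->
       (dTV P P' (Sn n) Phi <= (C_eps * n%:R `^ (- (1 / 2) + eps))%:E)%E)
    /\
    (exists C'_eps : R, forall (n : nat) (f : 'rV[R]_d -> R), (2 <= n)%N ->
       has_density P (Sn n) f ->
       (ess_sup (lebesgue_rV R d) (fun x => (f x)%:E) < +oo)%E ->
       (ess_sup (lebesgue_rV R d) (fun x => `|f x - std_gauss_pdf x|%:E) <=
          (C'_eps * n%:R `^ (- (1 / 2) + eps))%:E)%E /\
       (continuous f ->
        (ereal_sup [set `|f x - std_gauss_pdf x|%:E | x in [set: 'rV[R]_d]] <=
          (C'_eps * n%:R `^ (- (1 / 2) + eps))%:E)%E)).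
Proof.
move=> d0 indepY idY EY covY alpha0 decay moments gPhi Sn.
have mPhi : measurable_fun setT Phi by exact: measurable_funPT.
have mS n : measurable_fun setT (Sn n) by exact: measurable_normalized_sum.
have [K [n0 [K0 n02 KP]]] := inversion_pdf_clt d0 indepY idY (EY 0%N)
  (covY 0%N) alpha0 decay (moments 3).
split=> [n dn|eps eps0].
  exact: (continuous_density d0 indepY idY alpha0 decay dn).
set p := - (1 / 2) + eps.
have invE n : (n0 <= n)%N -> has_density P (Sn n) (inversion_pdf P (Sn n)).
  move=> /KP[dn _].
  have [G [iG Gc Gs]] := normalized_sum_inversion d0 indepY idY alpha0 decay dn.
  exact: inversion_has_density (mS n) iG Gc Gs.
split.
  (* The interpolation exponent must be below 1, and [n^(-(1-th)/2) <= n^(-1/2+eps)] holds because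
     [th <= eps]. *)
  pose th := Num.min eps (1 / 2).
  have th01 : 0 < th < 1.
    by rewrite lt_min eps0/= gt_min; apply/andP; split; [lra|apply/orP; right; lra].
  have theps : th <= eps by rewrite ge_min lexx.
  have [th0 th1] := andP th01.
  pose J := \int[lebesgue_rV R d]_x std_gauss_pdf x `^ th.
  have J0 : 0 <= J by apply: Rintegral_ge0 => x _; exact: powR_ge0.
  have [B B0 HB] := @powR_dominates_prefix R p (fun=> 2) n0 (fun=> ler0n R 2).
  exists (2 * (K `^ (1 - th) * J) + B) => n n2.
  have n_gt0 : (0 < n)%N by rewrite (leq_trans _ n2).
  have n1 : 1 <= n%:R :> R by rewrite ler1n.
  have np0 : 0 <= n%:R `^ p by exact: powR_ge0.
  have [nn0|nn0] := ltnP n n0.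
    apply: le_trans (dTV_le2 P P' (mS n) mPhi) _; rewrite lee_fin.
    rewrite (le_trans (HB n n_gt0 nn0))// ler_wpM2r// lerDr.
    by rewrite mulr_ge0// mulr_ge0// powR_ge0.
  have [_ fg] := KP n nn0.
  have s0 : 0 <= K / Num.sqrt n%:R by rewrite divr_ge0 ?sqrtr_ge0// ltW.
  apply: le_trans (dTV_std_gauss_le (mS n) mPhi (invE n nn0) gPhi s0 th01 fg) _.
  rewrite lee_fin (mulrDl _ B) ler_wpDr ?mulr_ge0// -/J -!mulrA ler_wpM2l//.
  rewrite powRM ?(ltW K0) ?invr_ge0 ?sqrtr_ge0// -mulrA ler_wpM2l ?powR_ge0// mulrC.
  rewrite ler_wpM2l// isqrt_powR -powRrM ler_powR// /p; lra.
(* For each [n] one bound valid for all bounded densities of [Sn n], so that the final constant does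
   not depend on the version [f]. *)
have /choice[a aP] : forall n, exists a : R, 0 <= a /\ forall f, has_density P (Sn n) f ->
    (ess_sup (lebesgue_rV R d) (fun x => (f x)%:E) < +oo)%E ->
    {ae lebesgue_rV R d, forall x, `|f x - std_gauss_pdf x| <= a}.
  by move=> n; have [a a0 aP] := bounded_density_dist P (Sn n); exists a.
have [B B0 HB] := @powR_dominates_prefix R p a n0 (fun n => (aP n).1).
exists (K + B) => n f n2 fX fb.
have n_gt0 : (0 < n)%N by rewrite (leq_trans _ n2).
have n1 : 1 <= n%:R :> R by rewrite ler1n.
have np0 : 0 <= n%:R `^ p by exact: powR_ge0.
have fg : {ae lebesgue_rV R d, forall x, `|f x - std_gauss_pdf x| <= (K + B) * n%:R `^ p}.
  have [nn0|nn0] := ltnP n n0.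
    have := (aP n).2 f fX fb; apply: filterS => x h; rewrite (le_trans h)//.
    by rewrite (le_trans (HB n n_gt0 nn0))// ler_wpM2r// lerDr ltW.
  have [_ KPn] := KP n nn0.
  (* The uniform estimate holds for the inversion density; it passes to [f] almost everywhere, and
     for continuous [f] everywhere at the end. *)
  have := has_density_ae_eq (invE n nn0) fX; apply: filterS => x /(_ I) <-.
  rewrite (le_trans (KPn x))// isqrt_powR mulrDl ler_wpDr ?mulr_ge0//.
  by rewrite ler_wpM2l ?(ltW K0)// ler_powR// /p; lra.
split.
  by apply/ess_supP; move: fg; apply: filterS => x; rewrite lee_fin.
move=> cf; apply: ub_ereal_sup => _ [x _ <-]; rewrite lee_fin.
exact: (continuous_dist_le cf continuous_std_gauss_pdf fg).
Qed.
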